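(* Let $n\ge1$. The Koornwinder polynomials are well-defined: there is a unique family of $BC_n$-symmetric Laurent polynomials $K^{(n)}_\lambda(x_1,\dots,x_n;q,t;t_0,t_1,t_2,t_3)$, indexed by partitions $\lambda$ with at most $n$ parts, such that (Triangularity) $K^{(n)}_\lambda(;q,t;t_0,t_1,t_2,t_3)=m_\lambda+{}$a linear combination of $m_\mu$ with $\mu<\lambda$; (Evaluation symmetry) for any pair of partitions $\mu<\lambda$ with at most $n$ parts, $$\frac{K^{(n)}_\lambda(q^{\mu_i}t^{n-i}t_0;q,t;t_0,t_1,t_2,t_3)}{k^0_\lambda(q,t,t^n;t_0{:}t_1,t_2,t_3)}=\frac{K^{(n)}_\mu(q^{\lambda_i}t^{n-i}\hat t_0;q,t;\hat t_0,\hat t_1,\hat t_2,\hat t_3)}{k^0_\mu(q,t,t^n;\hat t_0{:}\hat t_1,\hat t_2,\hat t_3)}.$$ Moreover, they are given by the expansion $$K^{(n)}_\lambda(;q,t;t_0,t_1,t_2,t_3)=\sum_{\mu\subset\lambda}\genfrac[]{0pt}{}{\lambda}{\mu}_{q,t,t^{n-1}\hat t_0}\frac{k^0_\lambda(q,t,t^n;t_0{:}t_1,t_2,t_3)}{k^0_\mu(q,t,t^n;t_0{:}t_1,t_2,t_3)}\;\bar P^{*(n)}_\mu(;q,t,t_0).$$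
   Context: $t_0,t_1,t_2,t_3$ are indeterminates over $\mathbb F=\mathbb Q(q,t)$, and $$\hat t_0=\sqrt{t_0t_1t_2t_3/q},\qquad \hat t_i=t_0t_i/\hat t_0\ (i=1,2,3)$$ (an involution on the parameters). $K(q^{\mu_i}t^{n-i}t_0;\dots)$ means evaluation at $x_i=q^{\mu_i}t^{n-i}t_0$, $1\le i\le n$; the polynomials with hatted parameters are those of the same family with $t_i$ replaced by $\hat t_i$. For a partition $\lambda$: $\lambda'$ is the conjugate, $n(\lambda)=\sum_i(i-1)\lambda_i$; $(i,j)\in\lambda$ means $1\le i$, $1\le j\le\lambda_i$; $\mu\subset\lambda$ means $\mu_i\le\lambda_i$ for all $i$. Dominance: $\mu\le\lambda$ iff $\mu_1+\dots+\mu_k\le\lambda_1+\dots+\lambda_k$ for all $k\ge1$ (the sizes may differ). Put $$C^0_\lambda(x;q,t)=\prod_{(i,j)\in\lambda}(1-q^{j-1}t^{1-i}x),\quad C^-_\lambda(x;q,t)=\prod_{(i,j)\in\lambda}(1-q^{\lambda_i-j}t^{\lambda'_j-i}x),\quad C^+_\lambda(x;q,t)=\prod_{(i,j)\in\lambda}(1-q^{\lambda_i+j-1}t^{2-\lambda'_j-i}x),$$ several arguments before the semicolon indicating a product, and $$k^0_\lambda(q,t,T;t_0{:}t_1,t_2,t_3)=(t_0T/t)^{-|\lambda|}t^{n(\lambda)}\frac{C^0_\lambda(T,Tt_0t_1/t,Tt_0t_2/t,Tt_0t_3/t;q,t)}{C^-_\lambda(t;q,t)\,C^+_\lambda(T^2t_0t_1t_2t_3/(qt^2);q,t)}.$$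 $BC_n$ is the group of permutations of $x_1,\dots,x_n$ and inversions $x_i\mapsto x_i^{-1}$; $m_\lambda(x)$ is the $BC_n$-orbit sum of $\prod_ix_i^{\lambda_i}$. For $\lambda$ with at most $n$ parts, the interpolation polynomial $\bar P^{*(n)}_\lambda(x_1,\dots,x_n;q,t,s)$ is the unique $BC_n$-symmetric Laurent polynomial with coefficients in $\mathbb F(s)$ of the form $m_\lambda+\sum_{\mu<\lambda}c_{\lambda\mu}m_\mu$ whose value $\bar P^{*(n)}_\lambda(\mu;q,t,s)$ at $x_i=q^{\mu_i}t^{n-i}s$ is $0$ for all partitions $\mu<\lambda$ with at most $n$ parts (it is then $0$ whenever $\lambda\not\subset\mu$, and nonzero for $\mu=\lambda$). The generalized binomial coefficient is $$\genfrac[]{0pt}{}{\lambda}{\mu}_{q,t,s}=\frac{\bar P^{*(n)}_\mu(\lambda;q,t,t^{1-n}s)}{\bar P^{*(n)}_\mu(\mu;q,t,t^{1-n}s)},$$ which is independent of $n$ (at least the numbers of parts of $\lambda,\mu$) and depends on $s$ only through $s^2$. *)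

(* Defs.v *)
From Stdlib Require Import ClassicalEpsilon.
From HB Require Import structures.
From mathcomp Require Import all_boot all_algebra perm finmap.
From mathcomp Require Import fraction generic_quotient.
From mathcomp.multinomials Require Import mpoly.

Set Implicit Arguments.
Unset Strict Implicit.
Unset Printing Implicit Defensive.

Import GRing.Theory.
Local Open Scope ring_scope.

(* F = Q(q, t) *)
Definition Fqt : fieldType := {fraction {mpoly rat[2]}}.
Definition qF : Fqt := tofrac ('X_ord0 : {mpoly rat[2]}).
Definition tF : Fqt := tofrac ('X_ord_max : {mpoly rat[2]}).

(* Rational functions in k indeterminates over F. *)
Definition ratfun (k : nat) : fieldType := {fraction {mpoly Fqt[k]}}.
Definition cst (k : nat) (c : Fqt) : ratfun k := tofrac (mpolyC k c).
Definition var (k : nat) (i : 'I_k) : ratfun k := tofrac ('X_i : {mpoly Fqt[k]}).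

(* Substitution of v i for the i-th indeterminate, the coefficients being mapped
   by phi. The value is computed from the representative chosen by repr; it does
   not depend on that choice as long as the denominator does not vanish at v, in
   particular for every r when v is algebraically independent over the image
   of phi, which is the case wherever rsubst is used below. *)
Definition rsubst (k : nat) (E : fieldType) (phi : Fqt -> E) (v : 'I_k -> E)
    (r : ratfun k) : E :=
  let x := repr r in mmap phi v (\n_x) / mmap phi v (\d_x).

(* F(s) and F(t_0, t_1, t_2, t_3). *)
Definition Fs : fieldType := ratfun 1.
Definition FT : fieldType := ratfun 4.
Definition sv : Fs := var ord0.
Definition tpar (i : nat) : FT := var (inord i : 'I_4).

(* Imported only here because it redefines the notation for {mpoly _[_]}; the
   notation below takes precedence over the one of mpoly.v. *)
From mathcomp.multinomials Require Import monalg.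
Local Notation "g @_ k" := (monalg.mcoeff k g) : ring_scope.

Section Partitions.
Variable n : nat.

(* Partitions with at most n parts, padded with zeros to length n. *)
Record part := Part { pval :> n.-tuple nat; _ : sorted geq pval }.
HB.instance Definition _ := [isSub for pval].
HB.instance Definition _ := [Countable of part by <:].

Implicit Types lam mu : part.

(* Rows and columns are numbered from 1, so rows beyond n are zero. *)
Definition prow lam (i : nat) : nat := nth 0%N lam i.-1.
Definition pcol lam (j : nat) : nat := count (fun r => (j <= r)%N) lam.
Definition psize lam : nat := sumn lam.
Definition nstat lam : nat := (\sum_(1 <= i < n.+1) (i - 1) * prow lam i)%N.

Definition contained mu lam : bool :=
  [forall i : 'I_n, (prow mu i.+1 <= prow lam i.+1)%N].

(* Sizes may differ; partial sums are constant from the n-th on. *)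
Definition domle mu lam : bool :=
  [forall k : 'I_n, (\sum_(1 <= i < k.+2) prow mu i <=
                     \sum_(1 <= i < k.+2) prow lam i)%N].
Definition domlt mu lam : bool := (mu != lam) && domle mu lam.

(* Every mu contained in, or dominated by, lam has all its parts at most the
   first part of lam, hence occurs in parts_upto lam (exactly once). *)
Definition parts_upto lam : seq part :=
  pmap insub [seq map_tuple val m | m : n.-tuple 'I_(psize lam).+1].

End Partitions.

Section Laurent.
Variables (n : nat) (E : fieldType).

(* Laurent polynomials in n variables: finitely supported functions on Z^n. *)
Definition expo := {ffun 'I_n -> int}.
Definition laurent := {malg E[expo]}.

Definition leval (p : laurent) (x : 'I_n -> E) : E :=
  \sum_(a <- msupp p) p@_a * \prod_(i < n) x i ^ a i.

(* The pair (s, e) stands for the signed permutation of the variables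
   x_(s i) |-> x_i^(+-1), with inversion where e i holds; every element of
   BC_n is of this form. *)
Definition bcact (w : 'S_n * {ffun 'I_n -> bool}) (a : expo) : expo :=
  [ffun i => (-1) ^+ w.2 i * a (w.1 i)].

Definition lact w (p : laurent) : laurent :=
  \sum_(a <- msupp p) << p@_a *g bcact w a >>.

Definition bcsym (p : laurent) : Prop := forall w, lact w p = p.

Definition expo_of (lam : part n) : expo := [ffun i : 'I_n => (prow lam i.+1)%:Z].

Definition orbit (a : expo) : seq expo :=
  undup [seq bcact w a | w : 'S_n * {ffun 'I_n -> bool}].

Definition msym (lam : part n) : laurent :=
  \sum_(a <- orbit (expo_of lam)) << a >>.

Definition triangular (lam : part n) (p : laurent) : Prop :=
  exists c : part n -> E,
    p = msym lam + \sum_(mu <- parts_upto lam | domlt mu lam) c mu *: msym mu.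

Definition spec (q t s : E) (mu : part n) (i : 'I_n) : E :=
  q ^+ prow mu i.+1 * t ^+ (n - i.+1) * s.

End Laurent.

Definition lmap (n : nat) (E E' : fieldType) (f : E -> E') (p : laurent n E) :
    laurent n E' :=
  \sum_(a <- msupp p) << f p@_a *g a >>.

Section CSymbols.
Variables (n : nat) (E : fieldType).
Implicit Types (lam : part n) (q t x : E).

Definition C0 q t lam x : E :=
  \prod_(1 <= i < n.+1) \prod_(1 <= j < (prow lam i).+1)
    (1 - q ^ (j%:Z - 1) * t ^ (1 - i%:Z) * x).

Definition Cminus q t lam x : E :=
  \prod_(1 <= i < n.+1) \prod_(1 <= j < (prow lam i).+1)
    (1 - q ^ ((prow lam i)%:Z - j%:Z) * t ^ ((pcol lam j)%:Z - i%:Z) * x).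

Definition Cplus q t lam x : E :=
  \prod_(1 <= i < n.+1) \prod_(1 <= j < (prow lam i).+1)
    (1 - q ^ ((prow lam i)%:Z + j%:Z - 1)
         * t ^ (2 - (pcol lam j)%:Z - i%:Z) * x).

Definition k0 q t (T t0 t1 t2 t3 : E) lam : E :=
  (t0 * T / t) ^ (- (psize lam)%:Z) * t ^+ nstat lam
  * (C0 q t lam T * C0 q t lam (T * t0 * t1 / t)
     * C0 q t lam (T * t0 * t2 / t) * C0 q t lam (T * t0 * t3 / t))
  / (Cminus q t lam t
     * Cplus q t lam (T ^+ 2 * t0 * t1 * t2 * t3 / (q * t ^+ 2))).

End CSymbols.

Section Interpolation.
Variable n : nat.

Definition is_interp (lam : part n) (p : laurent n Fs) : Prop :=
  [/\ bcsym p,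
      triangular lam p
    & forall mu : part n, domlt mu lam ->
        leval p (spec (cst 1 qF) (cst 1 tF) sv mu) = 0].

(* The unique polynomial satisfying is_interp lam. *)
Definition interp (lam : part n) : laurent n Fs :=
  epsilon (inhabits 0) (is_interp lam).

Variables (E : fieldType) (phi : Fqt -> E).

(* The interpolation polynomial with s specialized to a in E. *)
Definition interp_at (a : E) (lam : part n) : laurent n E :=
  lmap (rsubst phi (fun _ => a)) (interp lam).

Definition interp_val (a : E) (lam mu : part n) : E :=
  leval (interp_at a lam) (spec (phi qF) (phi tF) a mu).

(* The generalized binomial coefficient with parameter a, computed in n
   variables. *)
Definition gbinom (a : E) (lam mu : part n) : E :=
  let s := phi tF ^ (1 - n%:Z) * a in
  interp_val s mu lam / interp_val s mu mu.

End Interpolation.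

Section Koornwinder.
(* L is an extension of F(t_0, ..., t_3) via iota and h is a chosen square
   root of t_0 t_1 t_2 t_3 / q in it. *)
Variables (n : nat) (L : fieldType) (iota : FT -> L) (h : L).

Definition embF (c : Fqt) : L := iota (cst 4 c).
Definition par (i : nat) : L := iota (tpar i).
Definition hatpar (i : nat) : L := if i is 0%N then h else par 0 * par i / h.

Definition hat (r : FT) : L := rsubst embF (fun i : 'I_4 => hatpar i) r.

Definition k0par (u : nat -> L) (lam : part n) : L :=
  k0 (embF qF) (embF tF) (embF tF ^+ n) (u 0%N) (u 1%N) (u 2%N) (u 3%N) lam.

Definition is_koornwinder (K : part n -> laurent n FT) : Prop :=
  [/\ forall lam, bcsym (K lam),
      forall lam, triangular lam (K lam)
    & forall mu lam : part n, domlt mu lam ->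
        leval (lmap iota (K lam)) (spec (embF qF) (embF tF) (par 0) mu)
          / k0par par lam
        = leval (lmap hat (K mu)) (spec (embF qF) (embF tF) (hatpar 0) lam)
          / k0par hatpar mu].

End Koornwinder.

(* Main.v *)
From Stdlib Require Import ClassicalEpsilon.
From HB Require Import structures.
From mathcomp Require Import all_boot all_order all_algebra perm finmap ring zify.
From mathcomp Require Import fraction generic_quotient.
From mathcomp.multinomials Require Import mpoly.
Require Import Defs.

Set Implicit Arguments.
Unset Strict Implicit.
Unset Printing Implicit Defensive.

Import GRing.Theory.
Local Open Scope ring_scope.

(** A BC_n-symmetric Laurent polynomial in the [x_i] is a symmetric polynomial in
    [y_i = x_i + 1 / x_i], and the points of the theorem become
    [y_i = al * u_i + be / u_i] with [u_i = q ^ mu_i * t ^ (n - i)] and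
    [(al, be) = (s, 1 / s)]. Letting [al] and [be] vary independently makes
    induction possible: removing an empty row from all partitions, or a full
    column, only replaces [(al, be)] by [(al * t, be / t)] or by
    [(al * q, be / q)]. Three facts on such polynomials carry the proof.

    - [vanishing_determines]: a symmetric polynomial whose degree in the first
      [k] variables is at most [b k] for all [k], and which vanishes at every
      partition with partial sums bounded by [b], is zero. This makes the linear
      system for the interpolation polynomial of a partition [nu] invertible.
    - [extra_vanishing]: this polynomial vanishes at [lam] unless [nu] is
      contained in [lam].
    - [leading_value]: its value at [nu] itself is a product over the boxes of
      [nu], up to a factor that depends only on [q] and [t].

    The polynomials [koornwinder lam] are defined by the expansion. Its binomial
    coefficients involve the square root [h], but only through
    [h ^ 2 = t_0 t_1 t_2 t_3 / q], because values are quotiented and a common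
    factor of [al] and [be] can be absorbed in the variables
    ([value_ratio_scale]); hence they are images of elements [model_binom] of
    F(t_0, ..., t_3). The hatted parameters are algebraically independent
    ([hat_independent]), so that [hat] is a field embedding. It sends [h ^ 2] to
    [t_0 ^ 2], and therefore the hatted polynomials have an expansion of the same
    form with the roles of [t_0] and [h] exchanged.

    Writing [P_nu(mu; s)] for the interpolation polynomial of [nu] with parameter
    [s] at the partition [mu], both sides of the evaluation symmetry become sums
    of the terms

      [P_nu(lam; h) / P_nu(nu; h) * (P_nu(mu; t_0) / P_nu(nu; t_0)) * v_nu]

    over [nu] contained in [lam] on one side and in [mu] on the other, and extra
    vanishing cuts both down to the [nu] contained in [lam] and [mu]. The factor
    [v_nu] is [P_nu(nu; t_0)] divided by [k0] on the left, and [P_nu(nu; h)]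
    divided by the hatted [k0] on the right. These agree ([interp_val_k0]): the
    hook product of [leading_value] at [t_0] is the factor [Cplus] of the hatted
    [k0], and conversely, while the other factors of [k0] only see the invariant
    products [t_0 t_i] and a power of [t_0].

    Uniqueness holds because the symmetry prescribes the values of [K lam] at all
    smaller partitions in terms of smaller polynomials, and
    [vanishing_determines] leaves one triangular polynomial with these values. *)

(** * Division by linear forms *)

Section MorphismsOfMpoly.
Variables (n : nat) (R A : comNzRingType).

Lemma mpoly_morph_ext (f g : {rmorphism {mpoly R[n]} -> A}) :
    (forall c, f c%:MP = g c%:MP) -> (forall i, f 'X_i = g 'X_i) -> f =1 g.
Proof.
move=> fgC fgX p; rewrite (mpolyE p) !rmorph_sum; apply: eq_bigr => m _ /=.
rewrite -mul_mpolyC !rmorphM fgC mpolyXE_id !rmorph_prod; congr (_ * _).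
by apply: eq_bigr => i _; rewrite !rmorphXn fgX.
Qed.

End MorphismsOfMpoly.

Section Division.
Variables (n : nat) (E : fieldType).
Implicit Types (p g e : {mpoly E[n]}) (i j : 'I_n).

Definition subst i e : {mpoly E[n]} -> {mpoly E[n]} :=
  mmap (@mpolyC n E) (fun j => if j == i then e else 'X_j).

HB.instance Definition _ i e := GRing.RMorphism.on (subst i e).

Lemma substC i e c : subst i e c%:MP = c%:MP.
Proof. exact: mmapC. Qed.

Lemma substX i e j : subst i e 'X_j = if j == i then e else 'X_j.
Proof. by rewrite /subst mmapX mmap1U. Qed.

Lemma subst_dvd i e p : exists g, p - subst i e p = ('X_i - e) * g.
Proof.
pose P p := exists g, p - subst i e p = ('X_i - e) * g.
have PD p1 p2 : P p1 -> P p2 -> P (p1 + p2).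
  move=> [g1 h1] [g2 h2]; exists (g1 + g2).
  by rewrite mulrDr -h1 -h2 rmorphD /= opprD addrACA.
have PM p1 p2 : P p1 -> P p2 -> P (p1 * p2).
  move=> [g1 h1] [g2 h2]; exists (g1 * p2 + subst i e p1 * g2).
  rewrite mulrDr mulrA -h1 mulrCA -h2 rmorphM /=; ring.
have PC c : P c%:MP by exists 0; rewrite substC subrr mulr0.
have PX j : P 'X_j.
  rewrite /P substX; case: eqP => [->|_]; first by exists 1; rewrite mulr1.
  by exists 0; rewrite subrr mulr0.
have P0 : P 0 by exists 0; rewrite rmorph0 subrr mulr0.
rewrite -/(P p) (mpolyE p); apply: (big_ind P P0 PD) => m _.
rewrite -mul_mpolyC; apply: (PM _ _ (PC _)); rewrite mpolyXE_id.
apply: (big_ind P (PC 1) (fun x y => @PM x y)) => j _.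
elim: (m j) => [|k IH]; first exact: (PC 1).
by rewrite exprS; apply: (PM _ _ (PX j) IH).
Qed.

(** Dividing out the linear forms one at a time needs no unique factorization:
    substituting a root of the next form into the product of the earlier ones
    gives a nonzero factor in a domain. *)
Lemma dvd_linear_forms (s : seq ('I_n * {mpoly E[n]})) p :
    {in s, forall l, subst l.1 l.2 p = 0} ->
    pairwise (fun l l' => subst l'.1 l'.2 ('X_(l.1) - l.2) != 0) s ->
  exists g, p = \prod_(l <- s) ('X_(l.1) - l.2) * g.
Proof.
elim/last_ind: s => [|s [i e] IH] p0 /=.
  by move=> _; exists p; rewrite big_nil mul1r.
rewrite pairwise_rcons => /andP[/allP hs pws].
have [l ls|//|g pE] := IH; first by apply: p0; rewrite mem_rcons inE ls orbT.
have: subst i e p = 0 by apply: (p0 (i, e)); rewrite mem_rcons mem_head.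
rewrite {1}pE rmorphM rmorph_prod /= => /eqP; rewrite mulf_eq0 => /orP[|/eqP g0].
  rewrite prodf_seq_eq0 => /hasP[l ls /=].
  by rewrite (negPf (hs l ls)).
have [g' gE] := subst_dvd i e g; exists g'.
by rewrite pE big_rcons /= -mulrA -gE g0 subr0 .
Qed.

End Division.

(** * Degrees in the first variables *)

Section PartialDegree.
Variables (n : nat) (E : fieldType).
Implicit Types (f g : {mpoly E[n]}) (k d : nat).

Definition pdeg k (m : 'X_{1..n}) : nat := (\sum_(i < n | i < k) m i)%N.

(** The extra variable records the degree in the variables of index less than
    [k]. As the coefficients lie in a domain, this turns that degree into one that
    is additive on products. *)
Definition homogenize k : {mpoly E[n]} -> {poly {mpoly E[n]}} :=
  mmap (polyC \o @mpolyC n E) (fun i => ('X_i)%:P * 'X^(i < k)%N).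

HB.instance Definition _ k := GRing.RMorphism.on (homogenize k).

Lemma homogenizeC k c : homogenize k c%:MP = (c%:MP)%:P.
Proof. exact: mmapC. Qed.

Lemma homogenizeX k i : homogenize k 'X_i = ('X_i)%:P * 'X^(i < k)%N.
Proof. by rewrite /homogenize mmapX mmap1U. Qed.

Lemma homogenizeXm k m : homogenize k 'X_[m] = ('X_[m])%:P * 'X^(pdeg k m).
Proof.
rewrite [pdeg k m]big_mkcond -prodrXr mpolyXE_id !rmorph_prod -big_split /=.
apply: eq_bigr => i _; rewrite !rmorphXn /= homogenizeX exprMn -exprM.
by case: ifP; rewrite ?mul1n ?mul0n.
Qed.

Lemma coef_homogenize k f d m :
  ((homogenize k f)`_d)@_m = f@_m *+ (pdeg k m == d).
Proof.
have term m' : ((homogenize k (f@_m' *: 'X_[m']))`_d)@_m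
    = f@_m' * ('X_[m'])@_m *+ (pdeg k m == d).
  rewrite -mul_mpolyC rmorphM /= homogenizeC homogenizeXm !coefCM coefXn.
  rewrite mcoeffCM -mulrnAr mulr_natr mcoeffMn eq_sym mcoeffX.
  by case: eqP => [->|_]; rewrite ?mul0rn.
rewrite {1}(mpolyE f) rmorph_sum coef_sum raddf_sum /=.
under eq_bigr do rewrite term; rewrite sumrMnl; congr (_ *+ _).
rewrite [in RHS](mpolyE f) raddf_sum /=.
by apply: eq_bigr => m' _; rewrite mcoeffZ.
Qed.

Definition wle k d f := all (fun m => (pdeg k m <= d)%N) (msupp f).

Lemma wleP k d f :
  reflect (forall m, m \in msupp f -> (pdeg k m <= d)%N) (wle k d f).
Proof. exact: allP. Qed.

Lemma homogenize_eq0 k f : (homogenize k f == 0) = (f == 0).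
Proof.
apply/eqP/eqP => [h|->]; last exact: rmorph0.
by apply/mpolyP => m; have := coef_homogenize k f (pdeg k m) m;
  rewrite h coef0 eqxx mcoeff0.
Qed.

Definition wsize k f : nat := size (homogenize k f).

Lemma wsizeM k f g :
  f != 0 -> g != 0 -> wsize k (f * g) = (wsize k f + wsize k g).-1.
Proof.
move=> f0 g0; rewrite /wsize rmorphM /=.
by apply: size_mul; rewrite homogenize_eq0.
Qed.

Lemma wsize_eq0 k f : (wsize k f == 0%N) = (f == 0).
Proof. by rewrite /wsize size_poly_eq0 homogenize_eq0. Qed.

Lemma wleE k d f : wle k d f = (wsize k f <= d.+1)%N.
Proof.
apply/wleP/leq_sizeP => [h e ltd|h m].
  apply/mpolyP => m; rewrite coef_homogenize mcoeff0.
  case: eqP => [me|_]; rewrite ?mulr0n // mulr1n; apply: contraTeq isT => nz.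
  by have := h m; rewrite mcoeff_msupp nz me leqNgt ltd => /(_ isT).
rewrite mcoeff_msupp leqNgt; apply: contraNN => ltd.
by have := coef_homogenize k f (pdeg k m) m;
   rewrite eqxx mulr1n h // mcoeff0 => <-.
Qed.

Lemma wleC k c : wle k 0 c%:MP.
Proof.
apply/wleP => m; rewrite msuppC; case: ifP => // _; rewrite inE => /eqP ->.
by rewrite /pdeg big1 // => i _; rewrite mnm0E.
Qed.

Lemma pdegU k (i : 'I_n) : pdeg k U_(i)%MM = (i < k)%N.
Proof.
rewrite /pdeg; case: ltnP => ik; last first.
  rewrite big1 // => j jk; rewrite mnm1E; apply/eqP; rewrite eqb0.
  by apply: contraTneq jk => <-; rewrite -leqNgt.
rewrite (bigD1 i) //= mnm1E eqxx big1 // => j /andP[_ ji].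
by rewrite mnm1E eq_sym (negPf ji).
Qed.

Lemma wleX k (i : 'I_n) : wle k (i < k)%N 'X_i.
Proof.
by apply/wleP => m; rewrite msuppX inE => /eqP ->; rewrite pdegU.
Qed.

Lemma wsize_gt k m f : m \in msupp f -> (pdeg k m < wsize k f)%N.
Proof.
move=> mf; have : (0 < wsize k f)%N.
  by rewrite lt0n wsize_eq0 -msupp_eq0; case: msupp mf.
have := wleE k (wsize k f).-1 f; case sE : (wsize k f) => [//|s] /= + _.
by rewrite leqnn => /wleP/(_ m mf).
Qed.

Lemma wle_weak k d d' f : (d <= d')%N -> wle k d f -> wle k d' f.
Proof. by move=> dd' /wleP h; apply/wleP => m /h /leq_trans; apply. Qed.

Lemma wleD k d f g : wle k d f -> wle k d g -> wle k d (f + g).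
Proof.
move=> /wleP hf /wleP hg; apply/wleP => m /msuppD_le.
by rewrite mem_cat => /orP[/hf|/hg].
Qed.

Lemma wleM k d e f g : wle k d f -> wle k e g -> wle k (d + e) (f * g).
Proof.
move=> /wleP hf /wleP hg; apply/wleP => m /msuppM_le /allpairsP[[m1 m2] /=].
case=> /hf h1 /hg h2 ->; apply: leq_trans (leq_add h1 h2).
by rewrite /pdeg -big_split /= leq_sum // => i _; rewrite mnmDE.
Qed.

Lemma wle_sum k d (I : Type) (r : seq I) (P : pred I) (F : I -> {mpoly E[n]}) :
  (forall i, P i -> wle k d (F i)) -> wle k d (\sum_(i <- r | P i) F i).
Proof.
move=> h; apply: (big_ind (wle k d)) h; last by move=> *; apply: wleD.
by apply/wleP => m; rewrite msupp0.
Qed.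

Lemma wle_prod k (I : Type) (r : seq I) (P : pred I) (d : I -> nat)
    (F : I -> {mpoly E[n]}) :
  (forall i, P i -> wle k (d i) (F i)) ->
  wle k (\sum_(i <- r | P i) d i) (\prod_(i <- r | P i) F i).
Proof.
move=> h; apply: (big_ind2 (fun x y => wle k y x)) h; first exact: (wleC k 1).
by move=> *; apply: wleM.
Qed.

Lemma wle_exp k d f e : wle k d f -> wle k (e * d) (f ^+ e).
Proof.
move=> hf; elim: e => [|e IH]; first exact: (wleC k 1).
by rewrite exprS mulSn; apply: wleM.
Qed.

Lemma wle_cancel k d e f g : wsize k f = e.+1 -> g != 0 ->
  wle k d (f * g) -> (e <= d)%N /\ wle k (d - e) g.
Proof.
move=> sf g0; rewrite !wleE wsizeM // -?(wsize_eq0 k) ?sf //.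
have : (0 < wsize k g)%N by rewrite lt0n wsize_eq0.
case: (wsize k g) => // s _; rewrite addSn /= addnS !ltnS => h.
by rewrite leq_subRL ?h ?(leq_trans (leq_addr _ _) h).
Qed.

Lemma wsize_prod k (I : eqType) (r : seq I) (d : I -> nat)
    (F : I -> {mpoly E[n]}) :
  (forall i, i \in r -> wsize k (F i) = (d i).+1) ->
  wsize k (\prod_(i <- r) F i) = (\sum_(i <- r) d i).+1.
Proof.
elim: r => [|a r IH] h; first by rewrite !big_nil /wsize rmorph1 size_poly1.
have {}IH : wsize k (\prod_(i <- r) F i) = (\sum_(i <- r) d i).+1.
  by apply: IH => i ir; apply: h; rewrite inE ir orbT.
have ha := h a (mem_head _ _).
by rewrite !big_cons wsizeM -?(wsize_eq0 k) ?ha ?IH // addSn addnS.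
Qed.

End PartialDegree.

(** * Restriction of the last variable *)

Section RestrictLast.
Variables (n : nat) (E : fieldType).
Implicit Types (f g : {mpoly E[n.+1]}) (c : E).

Definition restrict c : {mpoly E[n.+1]} -> {mpoly E[n]} :=
  mmap (@mpolyC n E)
    (fun i => if unlift ord_max i is Some j then 'X_j else c%:MP).

HB.instance Definition _ c := GRing.RMorphism.on (restrict c).

Lemma restrictC c a : restrict c a%:MP = a%:MP.
Proof. exact: mmapC. Qed.

Lemma restrictX c i :
  restrict c 'X_i = if unlift ord_max i is Some j then 'X_j else c%:MP.
Proof. by rewrite /restrict mmapX mmap1U. Qed.

Definition drop_last (m : 'X_{1..n.+1}) : 'X_{1..n} :=
  [multinom m (lift ord_max i) | i < n].

Lemma lift_widen (i : 'I_n) : widen_ord (leqnSn n) i = lift ord_max i.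
Proof. by apply: val_inj; rewrite /= /bump leqNgt ltn_ord. Qed.

Lemma restrictXm c m : restrict c 'X_[m] = c ^+ m ord_max *: 'X_[drop_last m].
Proof.
rewrite !mpolyXE_id rmorph_prod big_ord_recr /= rmorphXn /= restrictX.
rewrite unlift_none -rmorphXn /= mulrC mul_mpolyC; congr (_ *: _).
by apply: eq_bigr => i _; rewrite rmorphXn /= lift_widen restrictX liftK mnmE.
Qed.

Lemma restrictE c f :
  restrict c f = \sum_(m <- msupp f) (f@_m * c ^+ m ord_max) *: 'X_[drop_last m].
Proof.
rewrite {1}(mpolyE f) rmorph_sum; apply: eq_bigr => m _ /=.
by rewrite -mul_mpolyC rmorphM /= restrictC restrictXm mul_mpolyC scalerA.
Qed.

Definition extend_pt (v : 'I_n -> E) c (i : 'I_n.+1) : E :=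
  if unlift ord_max i is Some j then v j else c.

Lemma restrict_eval c f v : (restrict c f).@[v] = f.@[extend_pt v c].
Proof.
rewrite -[LHS]/((meval v \o restrict c) f).
apply: mpoly_morph_ext => [a|i] /=; first by rewrite restrictC !mevalC.
by rewrite restrictX mevalXU /extend_pt; case: unlift => [j|]; rewrite ?mevalXU ?mevalC.
Qed.

Lemma pdeg_drop_last k j m :
  (k <= j)%N -> (pdeg k (drop_last m) <= pdeg j m)%N.
Proof.
move=> kj; rewrite /pdeg [leqRHS]big_mkcond big_ord_recr /=.
apply: leq_trans (leq_addr _ _); rewrite big_mkcond /=; apply: leq_sum => i _.
rewrite mnmE -lift_widen /=; case: ifP => // ik.
by rewrite (leq_trans ik kj).
Qed.

Lemma wle_restrict c k j d f : (k <= j)%N -> wle j d f -> wle k d (restrict c f).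
Proof.
move=> kj /wleP hf; rewrite restrictE big_seq; apply: wle_sum => m /hf h.
apply/wleP => m' /msuppZ_le; rewrite msuppX inE => /eqP ->.
by apply: leq_trans h; apply: pdeg_drop_last.
Qed.

Lemma restrict_sym c f : f \is symmetric -> restrict c f \is symmetric.
Proof.
move=> /issymP sf; apply/issymP => s.
rewrite -[in RHS](sf (lift_perm ord_max ord_max s)).
rewrite -[LHS]/((mpoly.msym s \o restrict c) f).
rewrite -[RHS]/((restrict c \o mpoly.msym (lift_perm ord_max ord_max s)) f).
apply: mpoly_morph_ext => [a|i] /=.
  by rewrite restrictC !/(mpoly.msym _ _) !mmapC restrictC.
rewrite /mpoly.msym !mmapX !mmap1U !restrictX.
case: (unliftP ord_max i) => [j ->|->].
  by rewrite lift_perm_lift liftK mmapX mmap1U.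
by rewrite lift_perm_id unlift_none mmapC.
Qed.

Lemma subst_restrict c f : restrict c f = 0 -> subst ord_max c%:MP f = 0.
Proof.
pose w := mmap (@mpolyC n.+1 E) (fun j : 'I_n => 'X_(lift ord_max j)).
suff -> : subst ord_max c%:MP f = w (restrict c f) by move->; rewrite /w rmorph0.
rewrite -[RHS]/((w \o restrict c) f).
apply: mpoly_morph_ext => [a|i] /=; first by rewrite substC restrictC /w mmapC.
rewrite substX restrictX; case: (unliftP ord_max i) => [j ->|->].
  by rewrite eq_sym (negPf (neq_lift _ _)) /w mmapX mmap1U.
by rewrite eqxx /w mmapC.
Qed.

End RestrictLast.

Section DivideByRoot.
Variables (n : nat) (E : fieldType).
Implicit Types (f g : {mpoly E[n]}) (c : E).

Lemma msymX1 (s : 'S_n) i : mpoly.msym s ('X_i : {mpoly E[n]}) = 'X_(s i).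
Proof. by rewrite /mpoly.msym mmapX mmap1U. Qed.

Lemma msymC (s : 'S_n) c : mpoly.msym s (c%:MP : {mpoly E[n]}) = c%:MP.
Proof. exact: mmapC. Qed.

Lemma subst_sym i j c f : f \is symmetric ->
  subst i c%:MP f = 0 -> subst j c%:MP f = 0.
Proof.
move=> /issymP sf f0.
suff -> : subst j c%:MP f = mpoly.msym (tperm i j) (subst i c%:MP f).
  by rewrite f0 rmorph0.
rewrite -{1}(sf (tperm i j)).
rewrite -[LHS]/((subst j c%:MP \o mpoly.msym (tperm i j)) f).
rewrite -[RHS]/((mpoly.msym (tperm i j) \o subst i c%:MP) f).
apply: mpoly_morph_ext => [a|k] /=; first by rewrite !(msymC, substC).
rewrite msymX1 !substX; case: (eqVneq k i) => [->|ki].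
  by rewrite tpermL eqxx msymC.
rewrite msymX1; case: tpermP => [ik|kj|_ kj]; first by rewrite ik eqxx in ki.
  by case: eqP => // ij; rewrite kj ij eqxx in ki.
by case: eqP.
Qed.

Definition root_prod c : {mpoly E[n]} := \prod_(i < n) ('X_i - c%:MP).

Lemma root_prod_sym c : root_prod c \is symmetric.
Proof.
apply/issymP => s; rewrite /root_prod rmorph_prod [RHS](reindex_inj (@perm_inj _ s)).
by apply: eq_bigr => i _; rewrite rmorphB /= msymX1 msymC.
Qed.

Lemma root_prod_eval c v : (root_prod c).@[v] = \prod_(i < n) (v i - c).
Proof.
rewrite /root_prod rmorph_prod; apply: eq_bigr => i _ /=.
by rewrite mevalB mevalXU mevalC.
Qed.

Lemma mpolyX_neqC (i : 'I_n) c : ('X_i : {mpoly E[n]}) != c%:MP.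
Proof.
apply/eqP => /(congr1 (mcoeff U_(i)%MM)).
by rewrite mcoeffXU mcoeffC eqxx mnm1_eq0 mulr0 => /eqP; rewrite oner_eq0.
Qed.

Lemma wsize_XsubC k (i : 'I_n) c : wsize k ('X_i - c%:MP) = (i < k)%N.+1.
Proof.
apply/eqP; rewrite eqn_leq -wleE; apply/andP; split.
  apply: wleD; first exact: wleX.
  by rewrite -mpolyCN; apply: wle_weak (wleC _ _ _).
rewrite -pdegU; apply: wsize_gt.
by rewrite mcoeff_msupp mcoeffB mcoeffXU mcoeffC eqxx mnm1_eq0 mulr0 subr0 oner_eq0.
Qed.

Lemma wsize_root_prod k c : (k <= n)%N -> wsize k (root_prod c) = k.+1.
Proof.
move=> kn; rewrite /root_prod.
rewrite (@wsize_prod _ _ _ _ _ (fun i : 'I_n => (i < k)%N : nat)).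
  congr _.+1; transitivity (\sum_(i < n | (i < k)%N) 1)%N.
    by rewrite [RHS]big_mkcond; apply: eq_bigr => i _; case: ifP.
  by rewrite (big_ord_narrow kn) sum1_card card_ord.
by move=> i _; rewrite wsize_XsubC.
Qed.

Lemma sym_cancel f g : f != 0 -> f \is symmetric -> f * g \is symmetric ->
  g \is symmetric.
Proof.
move=> f0 /issymP sf /issymP sfg; apply/issymP => s.
by apply: (mulfI f0); rewrite -{1}(sf s) -msymM sfg.
Qed.

Lemma root_prod_neq0 c : root_prod c != 0.
Proof. by apply/prodf_neq0 => i _; rewrite subr_eq0 mpolyX_neqC. Qed.

Lemma dvd_root_prod c f : f \is symmetric ->
    (forall i, subst i c%:MP f = 0) ->
  exists2 g, g \is symmetric & f = root_prod c * g.
Proof.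
move=> sf f0; pose s := [seq (i, c%:MP : {mpoly E[n]}) | i <- enum 'I_n].
have [l /mapP[i _ ->]| |g fE] := @dvd_linear_forms _ _ s f; first exact: f0.
  rewrite pairwise_map; apply: (@sub_pairwise _ (fun i j => i != j)).
    move=> i j ij /=; rewrite rmorphB /= substX substC (negPf ij) subr_eq0.
    exact: mpolyX_neqC.
  by rewrite -uniq_pairwise enum_uniq.
have {}fE : f = root_prod c * g.
  by rewrite {1}fE big_map enumT.
exists g => //; apply: (sym_cancel (root_prod_neq0 c) (root_prod_sym c)).
by rewrite -fE.
Qed.

End DivideByRoot.

(** * Spectral points *)

Section GenericParameters.
Variables (E : fieldType) (q t : E).

Definition mon (a b : int) : E := q ^ a * t ^ b.

(** Distinct pairs of exponents give distinct nodes [q ^ a * t ^ b]; by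
    [generic_ratio] the two preimages [u] and [be / (al * u)] of a value of
    [joukowski al be] are not both nodes, so that the values at nodes are distinct
    as well. *)
Record generic (al be : E) : Prop := Generic {
  generic_q : q != 0;
  generic_t : t != 0;
  generic_al : al != 0;
  generic_be : be != 0;
  generic_2 : 2%:R != 0 :> E;
  generic_mon : forall a b, mon a b = 1 -> a = 0 /\ b = 0;
  generic_ratio : forall a b, al * mon a b != be }.

Definition joukowski (al be u : E) : E := al * u + be / u.

Variables (al be : E).
Hypothesis gen : generic al be.

Let q0 : q != 0. Proof. exact: generic_q gen. Qed.
Let t0 : t != 0. Proof. exact: generic_t gen. Qed.
Let al0 : al != 0. Proof. exact: generic_al gen. Qed.
Let be0 : be != 0. Proof. exact: generic_be gen. Qed.

Lemma mon_neq0 a b : mon a b != 0.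
Proof. by rewrite mulf_neq0 ?expfz_neq0. Qed.

Lemma monD a b c d : mon a b * mon c d = mon (a + c) (b + d).
Proof. by rewrite /mon !expfzDr // mulrACA. Qed.

Lemma monV a b : (mon a b)^-1 = mon (- a) (- b).
Proof. by rewrite /mon invfM !invr_expz. Qed.

Lemma mon_inj a b c d : mon a b = mon c d -> a = c /\ b = d.
Proof.
move=> h; have [|+ +] := generic_mon gen (a := a - c) (b := b - d).
  by rewrite -monD -monV h mulfV // mon_neq0.
by move=> /eqP + /eqP; rewrite !subr_eq0 => /eqP -> /eqP ->.
Qed.

Lemma generic_shift a b c d : generic (al * mon a b) (be * mon c d).
Proof.
case: gen => _ _ _ _ two gm gr.
split=> //; [by rewrite mulf_neq0 ?mon_neq0 | by rewrite mulf_neq0 ?mon_neq0 |].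
move=> e f; rewrite -mulrA monD; apply/eqP => h.
have /eqP := gr (a + e - c) (b + f - d); apply.
by rewrite -monD -monV mulrA h mulfK // mon_neq0.
Qed.

Lemma joukowski_sub u v : u != 0 -> v != 0 ->
  joukowski al be u - joukowski al be v = (u - v) * (al - be / (u * v)).
Proof. by move=> u0 v0; rewrite /joukowski; field; rewrite u0 v0. Qed.

Lemma generic_sub_neq0 a b : al - be / mon a b != 0.
Proof.
rewrite subr_eq0; apply/eqP => h; have /eqP := generic_ratio gen a b; apply.
by rewrite h divfK ?mon_neq0.
Qed.

Lemma joukowski_inj a b c d :
  joukowski al be (mon a b) = joukowski al be (mon c d) -> a = c /\ b = d.
Proof.
move/eqP; rewrite -subr_eq0 joukowski_sub ?mon_neq0 // monD mulf_eq0.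
by rewrite (negPf (generic_sub_neq0 _ _)) orbF subr_eq0 => /eqP/mon_inj.
Qed.

End GenericParameters.

Section SpectralPoints.
Variables (E : fieldType) (q t : E).
Implicit Types (mu nu lam : nat -> nat) (al be : E).

Definition nonincr n mu := forall i j, (i <= j)%N -> (j < n)%N -> (mu j <= mu i)%N.

Definition psum mu k : nat := (\sum_(i < k) mu i)%N.

Definition node n mu i : E := q ^+ mu i * t ^+ (n - i.+1).

Definition spectral n al be mu (i : 'I_n) : E := joukowski al be (node n mu i).

Lemma node_mon n mu i : node n mu i = mon q t (mu i) (n - i.+1)%N.
Proof. by []. Qed.

(** A zero last part has node 1, hence coordinate [al + be]; the nodes of the
    other rows lose a factor [t] when the last row is dropped. *)
Lemma spectral_row n al be mu : t != 0 -> mu n = 0%N ->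
  @spectral n.+1 al be mu =1
  extend_pt (spectral (al * t) (be / t) mu) (al + be).
Proof.
move=> t0 mun i; rewrite /extend_pt /spectral /joukowski /node.
case: (unliftP ord_max i) => [j ->|->]; last first.
  by rewrite /= mun subnn !expr0 !mulr1 invr1 mulr1.
rewrite -lift_widen /= subSn // exprS invfM [in RHS]invfM invfM.
by rewrite !mulrA; congr (_ + _); rewrite ?[X in _ / X]mulrC; ring.
Qed.

Lemma spectral_column n al be mu nu : q != 0 ->
    (forall i, (i < n)%N -> nu i = (mu i).+1) ->
  @spectral n al be nu =1 spectral (al * q) (be / q) mu.
Proof.
move=> q0 munu i; rewrite /spectral /joukowski /node munu // exprS.
by rewrite !invfM !mulrA; congr (_ + _); ring.
Qed.

Lemma psum_leS mu k : (psum mu k <= psum mu k.+1)%N.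
Proof. by rewrite /psum big_ord_recr leq_addr. Qed.

Definition cut n mu i : nat := if (i < n)%N then mu i else 0%N.

Lemma nonincr_cut n mu : nonincr n mu -> nonincr n.+1 (cut n mu).
Proof.
move=> h i j ij jn; rewrite /cut; case: ifP => // jn'.
by rewrite (leq_ltn_trans ij jn') h.
Qed.

Lemma psum_cut n mu k : (k <= n)%N -> psum (cut n mu) k = psum mu k.
Proof.
by move=> kn; apply: eq_bigr => i _; rewrite /cut (leq_trans (ltn_ord i) kn).
Qed.

Lemma psum_cutS n mu : psum (cut n mu) n.+1 = psum mu n.
Proof. by rewrite /psum big_ord_recr /= -/(psum (cut n mu) n) psum_cut // /cut ltnn addn0. Qed.

Lemma psum_succ mu k : psum (fun i => (mu i).+1) k = (psum mu k + k)%N.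
Proof.
rewrite /psum; under eq_bigr do rewrite -addn1.
by rewrite big_split /= sum1_card card_ord.
Qed.

Lemma eq_psum mu nu n k :
  (k <= n)%N -> (forall i, (i < n)%N -> mu i = nu i) -> psum mu k = psum nu k.
Proof. by move=> kn h; apply: eq_bigr => i _; rewrite h // (leq_trans _ kn). Qed.

(** A polynomial vanishing on the points whose last part is zero restricts to
    zero on the hyperplane where the last coordinate is [al + be]. By symmetry
    it is divisible by all the corresponding linear forms, and the quotient
    satisfies the same hypotheses for partitions with one column less. *)
Theorem vanishing_determines n b al be (f : {mpoly E[n]}) :
    generic q t al be -> f \is symmetric ->
    (forall k, (k <= n)%N -> wle k (b k) f) ->
    (forall mu, nonincr n mu -> (forall k, (k <= n)%N -> (psum mu k <= b k)%N) ->
       f.@[spectral al be mu] = 0) ->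
  f = 0.
Proof.
elim: n b al be f => [|n IHn] b al be f gen sf bf vf.
  have fC : f = (f@_0%MM)%:MP.
    apply/mpolyP => m; rewrite mcoeffC.
    have -> : m = 0%MM by apply/mnmP => -[].
    by rewrite eqxx mulr1.
  have := vf (fun _ => 0%N); rewrite fC mevalC => -> //.
  by move=> k; rewrite leqn0 => /eqP ->; rewrite /psum big_ord0.
have q0 := generic_q gen; have t0 := generic_t gen.
have [d] := ubnP (b n.+1); elim: d => // d IHd in b al be f gen sf bf vf *.
rewrite ltnS => bd.
pose c := al + be.
have rf : restrict c f = 0.
  apply: (IHn (fun k => minn (b k) (b n.+1)) (al * t) (be / t)).
  - have := generic_shift gen 0 1 0 (-1).
    by rewrite /mon !expr0z !mul1r expr1z -invr_expz expr1z.
  - exact: restrict_sym.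
  - move=> k kn; rewrite /minn; case: ifP => _.
      by apply: wle_restrict (leqnn k) _; apply: bf; apply: leqW.
    by apply: wle_restrict (leqW kn) _; apply: bf.
  move=> nu pnu hnu; rewrite restrict_eval.
  rewrite -(vf (cut n nu)).
  - apply: meval_eq => i; rewrite spectral_row //; last by rewrite /cut ltnn.
    rewrite /extend_pt; case: unlift => // j.
    by rewrite /spectral /node /cut ltn_ord.
  - exact: nonincr_cut.
  move=> k; rewrite leq_eqVlt => /orP[/eqP ->|kn].
    by rewrite psum_cutS; apply: leq_trans (hnu n (leqnn n)) (geq_minr _ _).
  by rewrite psum_cut //; apply: leq_trans (hnu k kn) (geq_minl _ _).
have [g sg fE] : exists2 g, g \is symmetric & f = root_prod n.+1 c * g.
  by apply: dvd_root_prod => // i; apply: (subst_sym (i := ord_max)) => //;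
     apply: subst_restrict.
case: (eqVneq g 0) => [gz|g0]; first by rewrite fE gz mulr0.
have bg k : (k <= n.+1)%N -> (k <= b k)%N /\ wle k (b k - k) g.
  move=> kn; apply: wle_cancel (wsize_root_prod c kn) g0 _.
  by rewrite -fE; apply: bf.
rewrite fE (IHd (fun k => b k - k)%N (al * q) (be / q) g) ?mulr0 //.
- have := generic_shift gen 1 0 (-1) 0.
  by rewrite /mon !expr0z !mulr1 expr1z -invr_expz expr1z.
- by move=> k kn; have [] := bg k kn.
- move=> mu pmu hmu; pose nu i := (mu i).+1.
  have: f.@[spectral al be nu] = 0.
    apply: vf => [i j ij jn|k kn]; first by rewrite ltnS pmu.
    rewrite psum_succ; have := hmu k kn; have [kb _] := bg k kn.
    by move=> h; rewrite -(subnK kb) leq_add2r.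
  rewrite fE mevalM root_prod_eval.
  rewrite (meval_eq g (spectral_column al be q0 (fun i _ => erefl (nu i)))).
  move/eqP; rewrite mulf_eq0 => /orP[|/eqP //].
  move=> /prodf_eq0[i _]; rewrite subr_eq0 /spectral => /eqP h.
  have c1 : c = joukowski al be (mon q t 0 0).
    by rewrite /joukowski /mon !expr0z !mulr1 divr1.
  by move: h; rewrite c1 node_mon => /(joukowski_inj gen)[].
have [h _] := bg n.+1 (leqnn _); move: h bd; case: (b n.+1) => // m _ md.
by rewrite subSS (leq_ltn_trans (leq_subr _ _)).
Qed.

End SpectralPoints.

(** * Values of polynomials that vanish below a partition *)

Definition dominated n (nu mu : nat -> nat) :=
  forall k, (k <= n)%N -> (psum nu k <= psum mu k)%N.

Definition differ n (nu mu : nat -> nat) := exists2 i, (i < n)%N & nu i != mu i.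

Definition conjugate n (mu : nat -> nat) j : nat := (\sum_(i < n) (j < mu i))%N.

Definition exponent n (mu : nat -> nat) : 'X_{1..n} := [multinom mu i | i < n].

Section LeadingCoefficient.
Variables (n : nat) (E : fieldType).

Lemma prod_XsubC_lower (r : seq 'I_n) (c : E) k :
  wle k (size r).-1
    (\prod_(i <- r) 'X_i - \prod_(i <- r) ('X_i - c%:MP) : {mpoly E[n]}).
Proof.
elim: r => [|a r IH]; first by rewrite !big_nil subrr; apply/wleP => m; rewrite msupp0.
have -> : \prod_(i <- a :: r) 'X_i - \prod_(i <- a :: r) ('X_i - c%:MP) =
   'X_a * (\prod_(i <- r) 'X_i - \prod_(i <- r) ('X_i - c%:MP))
   + c%:MP * \prod_(i <- r) ('X_i - c%:MP) :> {mpoly E[n]}.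
  by rewrite !big_cons; ring.
case: r => [|b r] in IH *.
  by rewrite !big_nil subrr mulr0 add0r mulr1 wleC.
have wX (i : 'I_n) : wle k 1 ('X_i : {mpoly E[n]}).
  by apply: wle_weak (wleX _ k i); case: (i < k)%N.
apply: wleD; first exact: (wleM (wX a) IH).
have wP : wle k (\sum_(i <- b :: r) 1) (\prod_(i <- b :: r) ('X_i - c%:MP : {mpoly E[n]})).
  apply: wle_prod => i _; apply: wleD (wX i) _.
  by rewrite -mpolyCN; apply: wle_weak (wleC _ k _).
by have := wleM (wleC n k c) wP; rewrite sum1_size.
Qed.

Lemma pdeg_full (m : 'X_{1..n}) : pdeg n m = mdeg m.
Proof. by rewrite mdegE /pdeg; apply: eq_bigl => i; rewrite ltn_ord. Qed.

(** The terms of [root_prod n c] other than the product of all the variables have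
    degree less than [n], and contribute nothing in the top degree. *)
Lemma root_prod_top (c : E) (g : {mpoly E[n]}) (m : 'X_{1..n}) :
  (0 < n)%N -> wle n (mdeg m) g ->
  (root_prod n c * g)@_([multinom 1%N | i < n] + m)%MM = g@_m.
Proof.
move=> n_gt0 wg; pose X1 : {mpoly E[n]} := 'X_[[multinom 1%N | i < n]].
have -> : root_prod n c * g = X1 * g - (X1 - root_prod n c) * g by ring.
rewrite mcoeffB mulrC mcoeffMX [X in _ - X](_ : _ = 0) ?subr0 //.
apply/eqP/negPn; rewrite -mcoeff_msupp; apply/negP.
have low : wle n n.-1 (X1 - root_prod n c).
  have := prod_XsubC_lower (index_enum 'I_n) c n.
  rewrite /index_enum -enumT size_enum_ord enumT -/(index_enum _).
  suff -> : X1 = \prod_i 'X_i by [].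
  by rewrite /X1 mpolyXE_id; apply: eq_bigr => i _; rewrite mnmE.
move/wleP: (wleM low wg) => h /h.
rewrite pdeg_full mdegD mdegE; under eq_bigr do rewrite mnmE.
by rewrite sum1_card card_ord leq_add2r leqNgt ltn_predL n_gt0.
Qed.

End LeadingCoefficient.

Section LeadingValue.
Variables (E : fieldType) (q t : E).
Implicit Types (mu nu lam : nat -> nat) (al be : E).

Definition vanishing_below n al be lam (f : {mpoly E[n]}) :=
  [/\ f \is symmetric,
      forall k, (k <= n)%N -> wle k (psum lam k) f
    & forall mu, nonincr n mu -> dominated n mu lam -> differ n mu lam ->
        f.@[spectral q t al be mu] = 0].

(** This is [Cplus q t mu (t ^ (2 * n - 2) * x)], with rows and columns numbered
    from zero; the shift by a power of [t] makes all exponents natural numbers. *)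
Definition hook_product n mu (x : E) : E :=
  \prod_(i < n) \prod_(j < mu i)
    (1 - x * (q ^+ (mu i + j) * t ^+ ((n + n).-1 - i - conjugate n mu j))).

Lemma conjugate_le n mu j : (conjugate n mu j <= n)%N.
Proof.
rewrite -[leqRHS]card_ord -sum1_card; apply: leq_sum => i _.
by case: (j < mu i)%N.
Qed.

Lemma conjugate_row n mu j : mu n = 0%N -> conjugate n.+1 mu j = conjugate n mu j.
Proof. by move=> mun; rewrite /conjugate big_ord_recr /= mun addn0. Qed.

Lemma hook_product_row n mu x :
  mu n = 0%N -> hook_product n.+1 mu x = hook_product n mu (x * t ^+ 2).
Proof.
move=> mun; rewrite /hook_product big_ord_recr /= mun big_ord0 mulr1.
apply: eq_bigr => i _; apply: eq_bigr => j _; rewrite conjugate_row //.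
have := conjugate_le n mu j; have := ltn_ord i => lti lec.
have -> : ((n.+1 + n.+1).-1 - i - conjugate n mu j
          = 2 + ((n + n).-1 - i - conjugate n mu j))%N by lia.
by rewrite [t ^+ (2 + _)]exprD [q ^+ _ * (_ * _)]mulrCA [x * _]mulrA.
Qed.

Lemma hook_product_column n mu nu x :
    (forall i, (i < n)%N -> mu i = (nu i).+1) ->
  hook_product n mu x =
  \prod_(i < n) (1 - x * node q t n mu i) * hook_product n nu (x * q ^+ 2).
Proof.
move=> munu; rewrite -big_split /=; apply: eq_bigr => i _.
have conj0 : conjugate n mu 0 = n.
  rewrite /conjugate -[RHS]card_ord -sum1_card.
  by apply: eq_bigr => k _; rewrite munu.
have conjS j : conjugate n mu j.+1 = conjugate n nu j.
  by apply: eq_bigr => k _; rewrite munu // ltnS.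
rewrite [in LHS]munu // big_ord_recl /= conj0 addn0 /node munu //; congr (_ * _).
  by congr (1 - x * (_ * t ^+ _)); have := ltn_ord i; lia.
apply: eq_bigr => j _; rewrite conjS.
have -> : ((nu i).+1 + bump 0 j = 2 + (nu i + j))%N by rewrite /bump; lia.
by rewrite [q ^+ (2 + _)]exprD -[q ^+ 2 * _ * _]mulrA [x * _]mulrA.
Qed.

(** The bound on the total degree forces a monomial of [f] that restricts to the
    leading one to be free of the last variable. *)
Lemma restrict_leading n c mu (f : {mpoly E[n.+1]}) :
    mu n = 0%N -> wle n.+1 (psum mu n.+1) f ->
  (restrict c f)@_(exponent n mu) = f@_(exponent n.+1 mu).
Proof.
move=> mun /wleP wf; rewrite restrictE raddf_sum /=.
have dropE m : m \in msupp f ->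
    (drop_last m == exponent n mu) = (m == exponent n.+1 mu).
  move=> /wf; rewrite pdeg_full mdegE big_ord_recr /=.
  rewrite /psum big_ord_recr /= mun addn0 => h.
  apply/eqP/eqP => [me|->]; last first.
    by apply/mnmP => i; rewrite !mnmE -lift_widen.
  have mi (i : 'I_n) : m (widen_ord (leqnSn n) i) = mu i.
    by have /mnmP/(_ i) := me; rewrite !mnmE -lift_widen.
  have mn : m ord_max = 0%N.
    by move: h; under eq_bigr do rewrite mi; lia.
  apply/mnmP => i; case: (unliftP ord_max i) => [j ->|->].
    by rewrite -lift_widen mi !mnmE.
  by rewrite mn !mnmE mun.
transitivity (\sum_(m <- msupp f) f@_m * (m == exponent n.+1 mu)%:R).
  rewrite big_seq [RHS]big_seq; apply: eq_bigr => m mf.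
  rewrite mcoeffZ mcoeffX dropE //; case: eqP => [->|_]; rewrite ?mulr0 //.
  by rewrite mnmE mun expr0 mulr1.
rewrite [RHS](congr1 (mcoeff _) (mpolyE f)) raddf_sum /=.
by apply: eq_bigr => m _; rewrite mcoeffZ mcoeffX.
Qed.

(** Setting the last variable to [al + be] removes an empty last row, and
    dividing by the linear forms that vanish there removes a full first column;
    both keep the leading coefficient, and each step contributes its factors to
    [hook_product]. Only their dependence on [al] and [be] is recorded. *)
Theorem leading_value n mu al0 be0 :
    generic q t al0 be0 -> nonincr n mu ->
  exists2 c, c != 0 & forall al be f,
    generic q t al be -> vanishing_below al be mu f ->
    f.@[@spectral _ q t n al be mu] =
    f@_(exponent n mu) * (c * be ^+ psum mu n * hook_product n mu (al / be)).
Proof.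
move=> gen0; have q0 := generic_q gen0; have t0 := generic_t gen0.
elim: n mu => [|n IHn] mu pmu.
  exists 1; first exact: oner_neq0.
  move=> al be f _ _; rewrite /psum /hook_product !big_ord0 expr0 !mulr1.
  have {1}-> : f = (f@_0%MM)%:MP.
    apply/mpolyP => m; rewrite mcoeffC.
    have -> : m = 0%MM by apply/mnmP => -[].
    by rewrite eqxx mulr1.
  by rewrite mevalC; congr (_@__); apply/mnmP => -[].
have [d] := ubnP (mu n); elim: d => // d IHd in mu pmu *; rewrite ltnS => mud.
have gen_row al be : generic q t al be -> generic q t (al * t) (be / t).
  move=> gen; have := generic_shift gen 0 1 0 (-1).
  by rewrite /mon !expr0z !mul1r expr1z -invr_expz expr1z.
case: (posnP (mu n)) => [mun|mun].
  (* The power of [t] comes from [be / t] in place of [be]. *)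
  have [c c0 hc] : exists2 c, c != 0 & forall al be (f : {mpoly E[n]}),
    generic q t al be -> vanishing_below al be mu f ->
    f.@[spectral q t al be mu] =
    f@_(exponent n mu) * (c * be ^+ psum mu n * hook_product n mu (al / be)).
    by apply: IHn => i j ij jn; apply: pmu => //; apply: ltnW.
  exists (c * t ^- psum mu n); first by rewrite mulf_neq0 ?invr_neq0 ?expf_neq0.
  move=> al be f gen [sf wf vf].
  have be_neq0 := generic_be gen.
  rewrite (meval_eq _ (spectral_row _ _ _ t0 mun)) -restrict_eval hc.
  - rewrite (restrict_leading _ mun (wf _ (leqnn _))) hook_product_row //.
    have -> : psum mu n.+1 = psum mu n by rewrite /psum big_ord_recr /= mun addn0.
    congr (_ * _).
    rewrite exprMn exprVn mulrA [c * _ * _]mulrAC; congr (_ * hook_product n mu _).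
    by field; rewrite be_neq0 t0.
  - exact: gen_row.
  split; first exact: restrict_sym.
    by move=> k kn; apply: wle_restrict (leqnn k) _; apply: wf; apply: leqW.
  move=> nu pnu dnu [i ltin ni]; rewrite restrict_eval -(vf (cut n nu)).
  - apply: meval_eq => j; rewrite spectral_row //; last by rewrite /cut ltnn.
    rewrite /extend_pt; case: unlift => // l.
    by rewrite /spectral /node /cut ltn_ord.
  - exact: nonincr_cut.
  - move=> k; rewrite leq_eqVlt => /orP[/eqP ->|kn].
      by rewrite psum_cutS; apply: leq_trans (dnu n (leqnn n)) (psum_leS _ _).
    by rewrite psum_cut // dnu.
  by exists i; [exact: leqW|rewrite /cut ltin].
pose nu i := (mu i).-1.
have munu i : (i < n.+1)%N -> mu i = (nu i).+1.
  by move=> ltin; rewrite /nu prednK // (leq_trans mun) // pmu.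
have pnu : nonincr n.+1 nu by move=> i j ij jn; rewrite -ltnS -!munu ?pmu //; lia.
have psumE k : (k <= n.+1)%N -> psum mu k = (psum nu k + k)%N.
  by move=> kn; rewrite -psum_succ; apply: eq_psum kn munu.
have [c c0 hc] : exists2 c, c != 0 & forall al be (f : {mpoly E[n.+1]}),
    generic q t al be -> vanishing_below al be nu f ->
    f.@[spectral q t al be nu] =
    f@_(exponent n.+1 nu) *
      (c * be ^+ psum nu n.+1 * hook_product n.+1 nu (al / be)).
  by apply: IHd => //; rewrite /nu; lia.
have node0 i : node q t n.+1 mu i != 0 by rewrite mulf_neq0 ?expf_neq0.
have node1 i : (i < n.+1)%N -> node q t n.+1 mu i != 1.
  move=> ltin; apply/eqP; rewrite node_mon.
  by move=> /(generic_mon gen0)[]; rewrite munu.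
exists (c * q ^- psum nu n.+1 *
        \prod_(i < n.+1) (- (node q t n.+1 mu i - 1) / node q t n.+1 mu i)).
  rewrite !mulf_neq0 ?invr_neq0 ?expf_neq0 //; apply/prodf_neq0 => i _.
  by rewrite mulf_neq0 ?invr_neq0 // oppr_eq0 subr_eq0 node1.
move=> al be f gen [sf wf vf]; have be_neq0 := generic_be gen.
pose a := al + be.
(* The last row of [mu] is not empty, so that partitions with an empty last row
   differ from [mu] and [f] vanishes at those dominated by [mu]. *)
have rf : restrict a f = 0.
  apply: (vanishing_determines (b := psum mu) (gen_row _ _ gen)).
  - exact: restrict_sym.
  - by move=> k kn; apply: wle_restrict (leqnn k) _; apply: wf; apply: leqW.
  move=> ka pka dka; rewrite restrict_eval -(vf (cut n ka)).
  - apply: meval_eq => j; rewrite spectral_row //; last by rewrite /cut ltnn.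
    rewrite /extend_pt; case: unlift => // l.
    by rewrite /spectral /node /cut ltn_ord.
  - exact: nonincr_cut.
  - move=> k; rewrite leq_eqVlt => /orP[/eqP ->|kn].
      by rewrite psum_cutS; apply: leq_trans (dka n (leqnn n)) (psum_leS _ _).
    by rewrite psum_cut // dka.
  by exists n => //; rewrite /cut ltnn neq_ltn mun.
have [g sg fE] : exists2 g, g \is symmetric & f = root_prod n.+1 a * g.
  by apply: dvd_root_prod => // i; apply: (subst_sym (i := ord_max)) => //;
     apply: subst_restrict.
have wg k : (k <= n.+1)%N -> wle k (psum nu k) g.
  move=> kn; case: (eqVneq g 0) => [->|g0]; first by apply/wleP => m; rewrite msupp0.
  have := wf k kn; rewrite fE => /(wle_cancel (wsize_root_prod a kn) g0)[_].
  by rewrite psumE // addnK.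
have a1 : a = joukowski al be (mon q t 0 0).
  by rewrite /joukowski /mon !expr0z !mulr1 divr1.
have vg : vanishing_below (al * q) (be / q) nu g.
  split=> // ka pka dka [i ltin ni]; pose ka1 i := (ka i).+1.
  have: f.@[spectral q t al be ka1] = 0.
    apply: vf => [j l jl ln|k kn|]; first by rewrite ltnS pka.
      by rewrite psum_succ psumE // leq_add2r dka.
    by exists i => //; rewrite munu.
  rewrite fE mevalM root_prod_eval.
  rewrite (meval_eq g (spectral_column t al be q0 (fun i _ => erefl (ka1 i)))).
  move/eqP; rewrite mulf_eq0 => /orP[|/eqP //].
  move=> /prodf_eq0[j _]; rewrite subr_eq0 /spectral => /eqP.
  by rewrite a1 node_mon => /(joukowski_inj gen)[].
have -> : f@_(exponent n.+1 mu) = g@_(exponent n.+1 nu).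
  rewrite fE -[RHS](root_prod_top a) //; last first.
    suff -> : mdeg (exponent n.+1 nu) = psum nu n.+1 by exact: wg.
    by rewrite mdegE; apply: eq_bigr => i _; rewrite mnmE.
  by congr (_@__); apply/mnmP => i; rewrite mnmDE !mnmE munu.
rewrite fE mevalM root_prod_eval (meval_eq g (spectral_column t al be q0 munu)).
rewrite hc //; last first.
  have := generic_shift gen 1 0 (-1) 0.
  by rewrite /mon !expr0z !mulr1 expr1z -invr_expz expr1z.
rewrite (hook_product_column _ munu) psumE //.
have -> : \prod_(i < n.+1) (spectral q t al be mu i - a) =
    \prod_(i < n.+1) (- (node q t n.+1 mu i - 1) / node q t n.+1 mu i)
    * be ^+ n.+1 * \prod_(i < n.+1) (1 - al / be * node q t n.+1 mu i).
  rewrite -[X in be ^+ X]card_ord -prodr_const -!big_split /=.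
  apply: eq_bigr => i _; rewrite /spectral a1 joukowski_sub //; last first.
    by rewrite /mon !expr0z mulr1 oner_neq0.
  by rewrite /mon !expr0z !mulr1; field; rewrite be_neq0 node0.
have -> : al * q / (be / q) = al / be * q ^+ 2 by field; rewrite be_neq0 q0.
by rewrite exprMn exprVn exprD; ring.
Qed.

End LeadingValue.

(** * The lowering operator *)

Section EvaluateOneVariable.
Variables (n : nat) (E : fieldType).

Definition in_var (j : 'I_n) (P : {poly E}) : {mpoly E[n]} :=
  \sum_(e < size P) P`_e *: 'X_j ^+ e.

Lemma in_var_eval j P v : (in_var j P).@[v] = P.[v j].
Proof.
rewrite /in_var raddf_sum horner_coef; apply: eq_bigr => e _ /=.
by rewrite mevalZ rmorphXn /= mevalXU.
Qed.

Lemma msym_in_var (s : 'S_n) j P : mpoly.msym s (in_var j P) = in_var (s j) P.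
Proof.
rewrite /in_var raddf_sum; apply: eq_bigr => e _ /=.
by rewrite msymZ rmorphXn /= msymX1.
Qed.

Lemma wle_in_var k (j : 'I_n) (P : {poly E}) d :
  (size P <= d.+1)%N -> wle k ((j < k) * d)%N (in_var j P).
Proof.
move=> sP; apply: wle_sum => e _; rewrite -mul_mpolyC.
apply: wle_weak (wleM (wleC _ k _) (wle_exp e (wleX _ k j))); rewrite add0n.
have ed : (e <= d)%N by rewrite -ltnS; exact: leq_trans (ltn_ord e) sP.
by case: (j < k)%N; rewrite /= ?muln1 ?mul1n ?muln0 ?mul0n.
Qed.

End EvaluateOneVariable.


Lemma det_powers (R : comNzRingType) n (v : 'I_n -> R) :
  \det (\matrix_(j, i) v j ^+ i) =
  \prod_(i < n) \prod_(j < n | (i < j)%N) (v j - v i).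
Proof.
rewrite -det_tr; transitivity (\det (Vandermonde n (\row_j v j))).
  by congr determinant; apply/matrixP => i j; rewrite !mxE.
rewrite det_Vandermonde; apply: eq_bigr => i _; apply: eq_bigr => j _.
by rewrite !mxE.
Qed.

Lemma det_row_perm (R : comNzRingType) n (F : 'I_n -> 'I_n -> R) (s : 'S_n) :
  \det (\matrix_(j, i) F (s j) i) = (-1) ^+ s * \det (\matrix_(j, i) F j i).
Proof.
rewrite -det_perm -det_mulmx -row_permE; congr determinant.
by apply/matrixP => i j; rewrite !mxE.
Qed.

Lemma msym_det (R : comNzRingType) n (M : 'M[{mpoly R[n]}]_n) (s : 'S_n) :
  mpoly.msym s (\det M) = \det (\matrix_(j, i) mpoly.msym s (M j i)).
Proof.
rewrite -[LHS]det_map_mx; congr determinant.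
by apply/matrixP => i j; rewrite !mxE.
Qed.

Section Vandermonde.
Variables (n : nat) (E : fieldType).

Definition vandermonde : {mpoly E[n]} := \det (\matrix_(j, i) 'X_j ^+ i).

Definition vdm_forms : seq ('I_n * {mpoly E[n]}) :=
  [seq (p.2, 'X_(p.1)) | p <- enum [pred p : 'I_n * 'I_n | (p.1 < p.2)%N]].

Lemma vandermondeE : vandermonde = \prod_(l <- vdm_forms) ('X_(l.1) - l.2).
Proof.
rewrite /vandermonde det_powers /vdm_forms big_map big_enum /=.
by rewrite pair_big_dep.
Qed.

Lemma mpolyX_inj (i j : 'I_n) : ('X_i == 'X_j :> {mpoly E[n]}) = (i == j).
Proof.
apply/eqP/eqP => [|-> //] /(congr1 (mcoeff U_(i)%MM)).
rewrite !mcoeffXU eqxx; case: eqP => [-> //|_] /eqP.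
by rewrite oner_eq0.
Qed.

Lemma vandermonde_neq0 : vandermonde != 0.
Proof.
rewrite /vandermonde det_powers; apply/prodf_neq0 => i _; apply/prodf_neq0 => j ij.
by rewrite subr_eq0 mpolyX_inj; apply: contraTneq ij => ->; rewrite ltnn.
Qed.

Lemma vandermonde_eval v :
  vandermonde.@[v] = \prod_(i < n) \prod_(j < n | (i < j)%N) (v j - v i).
Proof.
rewrite /vandermonde det_powers rmorph_prod; apply: eq_bigr => i _.
rewrite rmorph_prod; apply: eq_bigr => j _ /=.
by rewrite mevalB !mevalXU.
Qed.

Lemma msym_vandermonde s : mpoly.msym s vandermonde = (-1) ^+ s * vandermonde.
Proof.
rewrite /vandermonde msym_det -(det_row_perm (fun j i : 'I_n => 'X_j ^+ i)).
congr determinant; apply/matrixP => j i; rewrite !mxE rmorphXn /=.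
by rewrite msymX1.
Qed.

Lemma wsize_vandermonde k : (k <= n)%N ->
  wsize k vandermonde = (\sum_(i < n | (i < k)%N) (n - i.+1)).+1.
Proof.
move=> kn; rewrite vandermondeE big_map.
rewrite (@wsize_prod _ _ _ _ _ (fun p : 'I_n * 'I_n => (p.1 < k)%N : nat)); last first.
  move=> [i j]; rewrite mem_enum inE /= => ij.
  apply/eqP; rewrite eqn_leq -wleE; apply/andP; split.
    apply: wleD; last by rewrite -scaleN1r -mul_mpolyC; apply: wleM (wleC _ k _) (wleX _ k i).
    by apply: wle_weak (wleX _ k j); case: (ltnP j k) => // jk; rewrite (ltn_trans ij jk).
  rewrite -pdegU; apply: wsize_gt; rewrite mcoeff_msupp mcoeffB !mcoeffXU eqxx.
  have nij : j != i by apply: contraTneq ij => ->; rewrite ltnn.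
  by rewrite (negPf nij) sub0r oppr_eq0 oner_eq0.
congr _.+1; rewrite big_enum /=.
rewrite -(pair_big_dep xpredT (fun i j : 'I_n => (i < j)%N) (fun i j => (i < k)%N : nat)) /=.
rewrite [RHS]big_mkcond; apply: eq_bigr => i _.
rewrite sum_nat_const; case: ifP => _; rewrite ?muln0 // muln1.
rewrite -sum1_card; transitivity (\sum_(i.+1 <= j < n) 1)%N.
  by rewrite big_geq_mkord.
by rewrite sum_nat_const_nat muln1.
Qed.

Lemma vdm_forms_pairwise :
  pairwise (fun l l' => subst l'.1 l'.2 ('X_(l.1) - l.2) != 0) vdm_forms.
Proof.
rewrite pairwise_map.
apply: (@sub_in_pairwise _ [pred p : 'I_n * 'I_n | (p.1 < p.2)%N] (fun p p' => p != p')).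
- move=> [i j] [i' j']; rewrite !inE /= => ij ij' np.
  rewrite rmorphB /= !substX.
  case: (eqVneq j j') => [jj|jj]; case: (eqVneq i j') => [ij1|ij1].
  + by move: ij; rewrite jj ij1 ltnn.
  + rewrite subr_eq0 mpolyX_inj; apply: contraNneq np => <-.
    by rewrite jj.
  + rewrite subr_eq0 mpolyX_inj; apply: contraTneq ij => ->.
    by rewrite ij1 -leqNgt ltnW.
  by rewrite subr_eq0 mpolyX_inj; apply: contraTneq ij => ->; rewrite ltnn.
- by apply/allP => p; rewrite mem_enum.
by rewrite -uniq_pairwise enum_uniq.
Qed.

Lemma dvd_vandermonde (f : {mpoly E[n]}) : 2%:R != 0 :> E ->
    (forall s : 'S_n, mpoly.msym s f = (-1) ^+ s * f) ->
  exists2 g, g \is symmetric & f = vandermonde * g.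
Proof.
move=> two anti; have [l| |g fE] := @dvd_linear_forms _ _ vdm_forms f.
- move=> /mapP[[i j]]; rewrite mem_enum inE /= => ij -> /=.
  have nij : i != j by apply: contraTneq ij => ->; rewrite ltnn.
  have : subst j 'X_i (mpoly.msym (tperm i j) f) = subst j 'X_i f.
    rewrite -[LHS]/((subst j 'X_i \o mpoly.msym (tperm i j)) f).
    apply: mpoly_morph_ext => [a|k] /=; first by rewrite msymC.
    rewrite msymX1 !substX; case: tpermP => [->|->|] //.
      by rewrite eqxx (negPf nij).
    by rewrite eqxx (negPf nij).
  rewrite anti odd_tperm nij expr1 mulN1r rmorphN /= => /eqP.
  rewrite -subr_eq0 -opprD oppr_eq0 -mulr2n -scaler_nat scaler_eq0 (negPf two).
  by move=> /eqP.
- exact: vdm_forms_pairwise.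
exists g; last by rewrite vandermondeE.
apply/issymP => s; apply: (mulfI vandermonde_neq0).
have sgn0 : (-1) ^+ s != 0 :> {mpoly E[n]} by rewrite signr_eq0.
apply: (mulfI sgn0); have := anti s.
by rewrite fE msymM -vandermondeE msym_vandermonde -mulrA.
Qed.

End Vandermonde.

Section SumsOfDistinct.
Variable n : nat.

Lemma sum_set_ge (A : {set 'I_n}) : (\sum_(i < #|A|) i <= \sum_(i in A) i)%N.
Proof.
have [k] := ubnP #|A|; elim: k => // k IH in A *; rewrite ltnS => cA.
case: (set_0Vmem A) => [->|[x0 x0A]]; first by rewrite cards0 big_ord0.
case: (arg_maxnP (fun i : 'I_n => i : nat) x0A) => x xA xmax.
have cE : #|A| = #|A :\ x|.+1 by rewrite (cardsD1 x) [x \in A]xA.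
rewrite (big_setD1 x) //= cE big_ord_recr /= addnC.
apply: leq_add; last by apply: IH; rewrite -ltnS -cE.
have : (#|A| <= x.+1)%N; last by rewrite cE ltnS.
have xn : (x.+1 <= n)%N by [].
apply: (@leq_trans #|[pred i : 'I_n | (i < x.+1)%N]|).
  by apply/subset_leq_card/subsetP => i iA; rewrite inE ltnS; apply: xmax.
by rewrite -sum1_card (big_ord_narrow xn) sum1_card card_ord.
Qed.

Lemma sum_perm_le (s : 'S_n) k : (k <= n)%N ->
  (\sum_(j < n | (j < k)%N) s j <= \sum_(j < n | (j < k)%N) (n - j.+1))%N.
Proof.
move=> kn.
pose A := [set rev_ord (s j) | j in [pred j : 'I_n | (j < k)%N]].
have cA : #|A| = k.
  rewrite card_imset; last by move=> i j /rev_ord_inj/perm_inj.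
  by rewrite -sum1_card (big_ord_narrow kn) sum1_card card_ord.
have sA : (\sum_(i in A) i = \sum_(j < n | (j < k)%N) (n - (s j).+1))%N.
  by rewrite big_imset //= => i j _ _ /rev_ord_inj/perm_inj.
have tot (F : 'I_n -> nat) : (forall j, F j < n)%N ->
    (\sum_(j < n | (j < k)%N) F j + \sum_(j < n | (j < k)%N) (n - (F j).+1)
     = k * n.-1)%N.
  move=> Fn; rewrite -big_split /= (eq_bigr (fun=> n.-1)) => [|j _].
    by rewrite (big_ord_narrow kn) sum_nat_const card_ord.
  by have := Fn j; lia.
have h1 := tot (fun j => s j) (fun j => ltn_ord _).
have h2 := tot (fun j => j) (fun j => ltn_ord _).
have h3 := sum_set_ge A; rewrite sA cA in h3.
have h4 : (\sum_(j < n | (j < k)%N) j = \sum_(j < k) j)%N.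
  by rewrite (big_ord_narrow kn).
by lia.
Qed.

End SumsOfDistinct.

Section LoweringOperator.
Variables (E : fieldType) (q t al be w : E).
Hypotheses (al0 : al != 0) (be0 : be != 0).

(** Pairs of polynomials are coordinates on Laurent polynomials in [u], which form
    a free module with basis [1, al * u] over polynomials in
    [y = al * u + be / u]. *)
Definition pair_val (P : {poly E} * {poly E}) (u : E) : E :=
  P.1.[joukowski al be u] + P.2.[joukowski al be u] * (al * u).

(** Multiplication by [joukowski (al * k) be u], reduced by means of
    [(al * u) ^+ 2 = y * (al * u) - al * be]. *)
Definition pair_step (k : E) (P : {poly E} * {poly E}) :=
  ('X * P.1 - ((k - 1) * (al * be)) *: P.2, (k - 1) *: P.1 + k *: ('X * P.2)).

Definition pair_base : {poly E} * {poly E} :=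
  (w *: 'X - (be + al * w)%:P, (1 - w)%:P).

Definition pair_col i a := iter a (pair_step q) (iter i (pair_step t) pair_base).

(** The factor [be - al * u] vanishes at [flip true 1] and prevents removing a box
    from a zero part; the factor [w - u] lets the operator annihilate a chosen
    node. *)
Definition base_val u : E := (be - al * u) * (w - u) / u.

(** The nontrivial automorphism of the double cover [joukowski al be]. For
    [u = q ^ m * t ^ k] it turns [joukowski (al * q) be u] into the coordinate
    belonging to [m - 1]. *)
Definition flip (b : bool) u : E := if b then be / (al * u) else u.

Lemma flip_neq0 b u : u != 0 -> flip b u != 0.
Proof. by case: b => //= u0; rewrite mulf_neq0 ?invr_neq0 ?mulf_neq0. Qed.

Lemma joukowski_flip b u : u != 0 -> joukowski al be (flip b u) = joukowski al be u.
Proof. by case: b => //= u0; rewrite /joukowski; field; rewrite al0 be0 u0. Qed.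

(** The second component is a divided difference with respect to [flip]. *)
Lemma pair_val_flip P u : u != 0 ->
  pair_val P u - pair_val P (flip true u) =
  P.2.[joukowski al be u] * (al * u - be / u).
Proof.
move=> u0; rewrite /pair_val joukowski_flip //=; field.
by rewrite u0 al0.
Qed.

Lemma pair_step_val k P u : u != 0 ->
  pair_val (pair_step k P) u = pair_val P u * joukowski (al * k) be u.
Proof.
move=> u0; rewrite /pair_val /pair_step /= !(hornerD, hornerN, hornerM, hornerX, hornerZ); move: (P.1.[_]) (P.2.[_]) => A B.
by rewrite /joukowski; field.
Qed.

Lemma pair_col_val i a u : u != 0 ->
  pair_val (pair_col i a) u =
  base_val u * joukowski (al * t) be u ^+ i * joukowski (al * q) be u ^+ a.
Proof.
move=> u0; rewrite /pair_col; elim: a => [|a IH] /=.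
  rewrite expr0 mulr1; elim: i => [|i IH] /=.
    rewrite expr0 mulr1 /pair_val /pair_base /= !(hornerD, hornerN, hornerX, hornerZ, hornerC) /base_val /joukowski.
    by field.
  by rewrite pair_step_val // IH exprSr mulrA.
by rewrite pair_step_val // IH exprSr mulrA.
Qed.

Lemma pair_step_size k (P : {poly E} * {poly E}) d :
  (size P.1 <= d.+1)%N -> (size P.2 <= d)%N ->
  (size (pair_step k P).1 <= d.+2)%N /\ (size (pair_step k P).2 <= d.+1)%N.
Proof.
move=> s1 s2; have X1 (A : {poly E}) e : (size A <= e)%N -> (size ('X * A)%R <= e.+1)%N.
  move=> sA; apply: leq_trans (size_polyMleq _ _) _.
  by rewrite size_polyX.
split=> /=; apply: leq_trans (size_polyD _ _) _; rewrite geq_max; apply/andP; split.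
- exact: X1.
- rewrite size_polyN; apply: leq_trans (size_scale_leq _ _) _.
  by apply: leq_trans s2 _; rewrite leqW.
- exact: leq_trans (size_scale_leq _ _) _.
by apply: leq_trans (size_scale_leq _ _) _; apply: X1.
Qed.

Lemma pair_col_size i a :
  (size (pair_col i a).1 <= (i + a).+2)%N /\ (size (pair_col i a).2 <= (i + a).+1)%N.
Proof.
rewrite /pair_col; elim: a => [|a [IH1 IH2]] /=.
  rewrite addn0; elim: i => [|i [IH1 IH2]] /=.
    split; last by rewrite size_polyC; case: (_ != 0).
    apply: leq_trans (size_polyD _ _) _; rewrite geq_max size_polyN; apply/andP; split.
      by apply: leq_trans (size_scale_leq _ _) _; rewrite size_polyX.
    by rewrite size_polyC; case: (_ != 0).
  exact: pair_step_size.
by rewrite addnS; apply: pair_step_size.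
Qed.

(** Up to the division by [vandermonde] and by the product of the
    [al * u j - be / u j], this is the operator
    [f |-> \sum_eps lowering_coef u eps * f (flipped points)] on symmetric
    polynomials, where [f] is evaluated at the parameter [al * q] and the result
    at [al]: see [lowered_eval]. The determinant expands the Vandermonde
    determinant at the parameter [al * t] together with the monomials of [f], and
    taking second components performs the antisymmetrization in each variable. *)
Definition lowered n (f : {mpoly E[n]}) : {mpoly E[n]} :=
  \sum_(m <- msupp f) f@_m *:
     \det (\matrix_(j, i) in_var j (pair_col i (m j)).2).

Lemma lowered_antisym n (f : {mpoly E[n]}) (s : 'S_n) :
  f \is symmetric -> mpoly.msym s (lowered f) = (-1) ^+ s * lowered f.
Proof.
move=> sf; pose ph (m : 'X_{1..n}) := [multinom m (s^-1%g i) | i < n].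
have ph_inj : injective ph.
  move=> m m' /mnmP h; apply/mnmP => i; have := h (s i).
  by rewrite !mnmE permK.
have pm : perm_eq [seq ph m | m <- msupp f] (msupp f).
  apply: uniq_perm => [||m]; [by rewrite map_inj_uniq //; exact: msupp_uniq
    | exact: msupp_uniq |].
  apply/mapP/idP => [[m' m'f ->]|mf]; first by rewrite issym_msupp.
  exists [multinom m (s i) | i < n]; first by rewrite issym_msupp.
  by apply/mnmP => i; rewrite !mnmE permKV.
rewrite [in RHS]/lowered -(perm_big _ pm) big_map mulr_sumr /lowered raddf_sum.
apply: eq_bigr => m _ /=; rewrite msymZ -scalerAr msym_coeff //; congr (_ *: _).
rewrite msym_det -(det_row_perm (fun j i : 'I_n => in_var j (pair_col i (ph m j)).2)).
congr determinant; apply/matrixP => j i; rewrite !mxE msym_in_var.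
by rewrite mnmE permK.
Qed.

(** The degree grows by that of the Vandermonde determinant only: passing to second
    components lowers by one the degree that [base_val] has added. *)
Lemma wle_lowered n k d (f : {mpoly E[n]}) : (k <= n)%N -> wle k d f ->
  wle k (\sum_(i < n | (i < k)%N) (n - i.+1) + d) (lowered f).
Proof.
move=> kn /wleP wf; rewrite /lowered big_seq; apply: wle_sum => m /wf wm.
rewrite -mul_mpolyC.
rewrite -[(_ + d)%N]add0n; apply: (wleM (wleC n k _)); rewrite /determinant.
apply: wle_sum => s _.
have -> : (-1) ^+ s = ((-1) ^+ s : E)%:MP :> {mpoly E[n]}.
  by rewrite rmorph_sign.
have wp : wle k (\sum_(j < n) (j < k) * (s j + m j))%N
    (\prod_j (\matrix_(j, i) in_var j (pair_col i (m j)).2) j (s j)).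
  apply: wle_prod => j _; rewrite mxE; apply: wle_in_var.
  by case: (pair_col_size (s j) (m j)).
apply: wle_weak (wleM (wleC n k _) wp); rewrite add0n.
apply: leq_trans (leq_add (sum_perm_le s kn) wm).
rewrite /pdeg -big_split /= [leqRHS]big_mkcond; apply: leq_sum => j _.
by case: (j < k)%N; rewrite ?mul1n ?mul0n.
Qed.

Definition lowering_coef n (u : 'I_n -> E) (eps : {ffun 'I_n -> bool}) : E :=
  (\prod_j ((-1) ^+ eps j * base_val (flip (eps j) (u j)))) *
  \det (\matrix_(j, i) joukowski (al * t) be (flip (eps j) (u j)) ^+ i).

Lemma lowered_eval n (f : {mpoly E[n]}) u : (forall j, u j != 0) ->
  (lowered f).@[fun j => joukowski al be (u j)] * \prod_j (al * u j - be / u j) =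
  \sum_(eps : {ffun 'I_n -> bool}) lowering_coef u eps *
     f.@[fun j => joukowski (al * q) be (flip (eps j) (u j))].
Proof.
move=> u0; pose x j b := flip b (u j).
pose F j (i a : nat) (b : bool) : E := (-1) ^+ b * (base_val (x j b) *
    joukowski (al * t) be (x j b) ^+ i * joukowski (al * q) be (x j b) ^+ a).
have colE j i a : (pair_col i a).2.[joukowski al be (u j)] * (al * u j - be / u j)
    = \sum_(b : bool) F j i a b.
  rewrite -pair_val_flip // big_bool /F expr1 expr0 mul1r mulN1r addrC.
  by rewrite -!pair_col_val ?flip_neq0.
have detE (m : 'X_{1..n}) :
    (\det (\matrix_(j, i) in_var j (pair_col i (m j)).2)).@[fun j => joukowski al be (u j)]
      * \prod_j (al * u j - be / u j)
    = \sum_(eps : {ffun 'I_n -> bool}) lowering_coef u eps *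
        \prod_j joukowski (al * q) be (flip (eps j) (u j)) ^+ m j.
  rewrite /determinant rmorph_sum mulr_suml.
  transitivity (\sum_(s : 'S_n) \sum_(eps : {ffun 'I_n -> bool})
      (-1) ^+ s * \prod_j F j (s j) (m j) (eps j)).
    apply: eq_bigr => s _ /=; rewrite rmorphM /= rmorph_sign rmorph_prod /=.
    rewrite -mulrA -big_split /= -mulr_sumr; congr (_ * _).
    rewrite -(bigA_distr_bigA (fun j b => F j (s j) (m j) b)).
    by apply: eq_bigr => j _; rewrite mxE in_var_eval colE.
  rewrite exchange_big; apply: eq_bigr => eps _ /=.
  rewrite /lowering_coef /determinant mulr_sumr mulr_suml; apply: eq_bigr => s _.
  rewrite -!mulrA mulrCA; congr (_ * _); rewrite -!big_split /=.
  by apply: eq_bigr => j _; rewrite mxE /F /x !mulrA.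
rewrite /lowered raddf_sum mulr_suml.
transitivity (\sum_(m <- msupp f) \sum_(eps : {ffun 'I_n -> bool}) f@_m *
    (lowering_coef u eps * \prod_j joukowski (al * q) be (flip (eps j) (u j)) ^+ m j)).
  by apply: eq_bigr => m _ /=; rewrite mevalZ -mulrA detE mulr_sumr.
rewrite exchange_big; apply: eq_bigr => eps _ /=; rewrite mevalE mulr_sumr.
by apply: eq_bigr => m _; rewrite mulrCA.
Qed.

(** Antisymmetry makes [lowered f] divisible by the Vandermonde determinant, and
    the division brings the partial degrees back to their bounds for [f]. *)
Lemma lowering_exists n (b : nat -> nat) (f : {mpoly E[n]}) :
    2%:R != 0 :> E -> f \is symmetric ->
    (forall k, (k <= n)%N -> wle k (b k) f) ->
  exists g : {mpoly E[n]},
    [/\ g \is symmetric, forall k, (k <= n)%N -> wle k (b k) g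
      & forall u, (forall j, u j != 0) ->
        (vandermonde n E).@[fun j => joukowski al be (u j)]
          * g.@[fun j => joukowski al be (u j)]
          * \prod_j (al * u j - be / u j) =
        \sum_(eps : {ffun 'I_n -> bool}) lowering_coef u eps *
          f.@[fun j => joukowski (al * q) be (flip (eps j) (u j))]].
Proof.
move=> two sf wf; have [|g sg gE] := @dvd_vandermonde _ _ (lowered f) two.
  by move=> s; apply: lowered_antisym.
exists g; split=> // [k kn|u u0]; last by rewrite -lowered_eval // gE mevalM.
case: (eqVneq g 0) => [->|g0]; first by apply/wleP => m; rewrite msupp0.
have := wle_lowered kn (wf k kn); rewrite gE.
by move=> /(wle_cancel (wsize_vandermonde E kn) g0)[_]; rewrite addKn.
Qed.

End LoweringOperator.

(** * Extra vanishing *)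

Lemma nonincr_adj n mu :
  (forall i, (i.+1 < n)%N -> (mu i.+1 <= mu i)%N) -> nonincr n mu.
Proof.
move=> h i j; elim: j => [|j IH]; first by rewrite leqn0 => /eqP ->.
rewrite leq_eqVlt => /orP[/eqP -> //|ij] jn.
by apply: leq_trans (h _ jn) (IH _ (ltnW jn)).
Qed.

Section ExtraVanishing.
Variables (E : fieldType) (q t : E) (n : nat).
Implicit Types (mu nu lam ka : nat -> nat) (al be : E) (eps : {ffun 'I_n -> bool}).

Definition strip eps i : bool := if insub i is Some j then eps j else false.

Lemma strip_ord eps (j : 'I_n) : strip eps j = eps j.
Proof. by rewrite /strip valK. Qed.

Definition remove_strip ka eps i : nat := (ka i - strip eps i)%N.

(** Shortening row [i] but not an equal row [i + 1] makes two rows of the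
    determinant equal, and shortening a zero last row is excluded by [base_val].
    What is left is the removal of vertical strips. *)
Lemma lowering_coef_support al be w ka eps :
    generic q t al be -> nonincr n ka ->
    lowering_coef t al be w (fun j => node q t n ka j) eps != 0 ->
  (forall i, (i < n)%N -> (strip eps i <= ka i)%N) /\
  nonincr n (remove_strip ka eps).
Proof.
move=> gen pka; rewrite /lowering_coef mulf_eq0 negb_or => /andP[c1 c2].
have q0 := generic_q gen; have t0 := generic_t gen.
have al0 := generic_al gen; have be0 := generic_be gen.
have adj i : (i.+1 < n)%N -> strip eps i -> ~~ strip eps i.+1 -> ka i != ka i.+1.
  move=> iS ei eiS; apply: contraNneq c2 => kaE.
  have ilt : (i < n)%N := ltnW iS.
  pose a := Ordinal ilt; pose b := Ordinal iS.
  apply/eqP/(determinant_alternate (i1 := a) (i2 := b)).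
    by rewrite -val_eqE /= neq_ltn leqnn.
  move=> k; rewrite !mxE; congr (_ ^+ k).
  have -> : eps a by rewrite -strip_ord.
  have -> : eps b = false by rewrite -strip_ord; apply: negbTE.
  have tE : (n - i.+1 = (n - i.+2).+1)%N by lia.
  rewrite /= /joukowski /node kaE tE exprS.
  by field; rewrite al0 be0 t0 !expf_neq0.
have last : strip eps n.-1 -> (0 < n)%N -> (0 < ka n.-1)%N.
  move=> en n0; rewrite lt0n; apply: contraNneq c1 => ka0.
  have nn : (n.-1 < n)%N by rewrite ltn_predL.
  apply/prodf_eq0; exists (Ordinal nn) => //.
  have -> : eps (Ordinal nn) by rewrite -strip_ord.
  rewrite /= /base_val /node /= ka0 prednK // subnn !expr0 !mulr1.
  by rewrite [al * (be / al)]mulrC divfK // subrr mul0r mul0r mulr0.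
have pos i : (i < n)%N -> strip eps i -> (0 < ka i)%N.
  move=> ilt; have [d] := ubnP (n - i); elim: d => // d IH in i ilt *.
  move=> dn ei; case: (ltnP i.+1 n) => [iS|ni].
    case: (boolP (strip eps i.+1)) => eiS.
      by apply: leq_trans (IH _ iS _ eiS) (pka _ _ (leqnSn i) iS); lia.
    have := adj _ iS ei eiS; have := pka _ _ (leqnSn i) iS; lia.
  have iE : i = n.-1 by lia.
  by rewrite iE; apply: last; rewrite -?iE //; lia.
split=> [i ilt|]; first by case: strip (pos i ilt) => // ->.
apply: nonincr_adj => i iS; rewrite /remove_strip.
have := adj i iS; have := pka _ _ (leqnSn i) iS.
by case: (strip eps i); case: (strip eps i.+1) => /=; lia.
Qed.

Lemma flip_node al be ka eps (j : 'I_n) :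
    generic q t al be -> (forall i, (i < n)%N -> (strip eps i <= ka i)%N) ->
  joukowski (al * q) be (flip al be (eps j) (node q t n ka j)) =
  spectral q t (al * q) be (remove_strip ka eps) j.
Proof.
move=> gen h; have q0 := generic_q gen; have t0 := generic_t gen.
have al0 := generic_al gen; have be0 := generic_be gen.
rewrite /spectral /node /remove_strip strip_ord.
have := h j (ltn_ord j); rewrite strip_ord; case: (eps j) => /=; last by rewrite subn0.
case: (ka j) => // k _; rewrite subn1 /= exprS /joukowski.
by field; rewrite al0 be0 q0 !expf_neq0.
Qed.

Lemma psum_remove_strip ka eps :
  (forall i, (i < n)%N -> (strip eps i <= ka i)%N) ->
  psum ka n = (psum (remove_strip ka eps) n + \sum_(j < n) eps j)%N.
Proof.
move=> h; rewrite /psum -big_split /=; apply: eq_bigr => j _.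
by rewrite /remove_strip -strip_ord subnK // h.
Qed.

(** The lowering operator whose free parameter [w] is the node of [lam] in row
    [i0] sends [f] to a polynomial vanishing at [lam] too, hence to zero. Its
    value at [mu] then expresses [f] at [mu] through the values of [f] at the
    partitions obtained from [mu] by removing a nonempty vertical strip. *)
Theorem extra_vanishing al be lam mu i0 (f : {mpoly E[n]}) :
    generic q t al be -> nonincr n lam -> vanishing_below q t al be lam f ->
    nonincr n mu -> (i0 < n)%N -> (mu i0 < lam i0)%N ->
  f.@[spectral q t al be mu] = 0.
Proof.
move=> gen1 plam [sf wf vf] pmu i0n mu_lam.
have q0 := generic_q gen1; have t0 := generic_t gen1.
pose al' := al / q.
have alE : al = al' * q by rewrite divfK.
have gen : generic q t al' be.
  have := generic_shift gen1 (-1) 0 0 0.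
  by rewrite /mon !expr0z !mulr1 -invr_expz expr1z.
have al0 := generic_al gen; have be0 := generic_be gen.
pose w := node q t n lam i0.
have node0 ka i : node q t n ka i != 0 by rewrite mulf_neq0 ?expf_neq0.
have node_inj ka i j : (i < n)%N -> (j < n)%N ->
    node q t n ka i = node q t n lam j -> i = j /\ ka i = lam j.
  move=> ilt jlt; rewrite !node_mon => /(mon_inj gen)[]; lia.
have [g [sg wg gE]] := lowering_exists q t w al0 be0 (generic_2 gen) sf wf.
have {}gE ka : nonincr n ka ->
    (vandermonde n E).@[spectral q t al' be ka] * g.@[spectral q t al' be ka]
      * \prod_(j < n) (al' * node q t n ka j - be / node q t n ka j) =
    \sum_(eps : {ffun 'I_n -> bool})
      lowering_coef t al' be w (fun j => node q t n ka j) eps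
      * f.@[spectral q t al be (remove_strip ka eps)].
  move=> pka; rewrite gE; last by [].
  apply: eq_bigr => eps _.
  have [->|c0] := eqVneq (lowering_coef t al' be w (fun j => node q t n ka j) eps) 0.
    by rewrite !mul0r.
  have [h _] := lowering_coef_support gen pka c0.
  congr (_ * _); apply: meval_eq => j.
  by rewrite flip_node // -alE.
(* A term that survives at a partition dominated by [lam] has [lam] itself as
   its shortened partition; then nothing was removed and [w] is the node of row
   [i0], where [base_val] vanishes. *)
have g0 : g = 0.
  apply: (vanishing_determines (b := psum lam) gen sg wg) => ka pka dka.
  have := gE _ pka; rewrite [X in _ = X]big1 => [/eqP|eps _].
    rewrite !mulf_eq0 => /orP[/orP[|/eqP //]|].
      rewrite vandermonde_eval => /prodf_eq0[i _ /prodf_eq0[j ij]].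
      rewrite subr_eq0 /spectral !node_mon => /eqP/(joukowski_inj gen)[_].
      by move: (ltn_ord j) (ltn_ord i); lia.
    move=> /prodf_eq0[j _]; rewrite subr_eq0 => /eqP h; exfalso.
    have /eqP := generic_sub_neq0 gen ((ka j)%:Z + (ka j)%:Z)
      ((n - j.+1)%N%:Z + (n - j.+1)%N%:Z); apply.
    rewrite -(monD gen) -!node_mon.
    have nn := node0 ka j; apply: (mulIf nn); rewrite mul0r mulrBl h.
    by field.
  have [->|c0] := eqVneq (lowering_coef t al' be w (fun j => node q t n ka j) eps) 0.
    by rewrite mul0r.
  have [h pnu] := lowering_coef_support gen pka c0.
  case: (boolP [forall j : 'I_n, remove_strip ka eps j == lam j]) => [/forallP same|].
    exfalso; move/negP: c0; apply; rewrite /lowering_coef.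
    have psE : psum (remove_strip ka eps) n = psum lam n.
      by apply: eq_bigr => j _; apply/eqP/same.
    have := dka n (leqnn n); rewrite (psum_remove_strip h) psE -[leqRHS]addn0 leq_add2l leqn0.
    rewrite sum_nat_eq0 => /forallP eps0.
    rewrite mulf_eq0; apply/orP; left; apply/prodf_eq0; exists (Ordinal i0n) => //.
    have e0 : eps (Ordinal i0n) = false by apply/negbTE; move: (eps0 (Ordinal i0n)); rewrite /= eqb0.
    have := same (Ordinal i0n); rewrite /remove_strip strip_ord e0 subn0 /= => /eqP kaE.
    by rewrite /base_val /= /node kaE /w /node subrr mulr0 mul0r mulr0.
  rewrite negb_forall => /existsP[j nj]; rewrite vf ?mulr0 //; last by exists j.
  move=> k kn; apply: leq_trans (dka k kn); apply: leq_sum => i _.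
  exact: leq_subr.
have [d] := ubnP (psum mu n); elim: d => // d IH in mu pmu mu_lam *.
rewrite ltnS => mud.
have := gE mu pmu; rewrite g0 meval0 mulr0 mul0r (bigD1 [ffun=> false]) //=.
rewrite [X in _ + X]big1 => [|eps eps0]; last first.
  have [->|c0] := eqVneq (lowering_coef t al' be w (fun j => node q t n mu j) eps) 0.
    by rewrite mul0r.
  have [h pnu] := lowering_coef_support gen pmu c0.
  rewrite IH ?mulr0 //; first exact: leq_ltn_trans (leq_subr _ _) mu_lam.
  have := psum_remove_strip h.
  have : (0 < \sum_(j < n) eps j)%N; last by lia.
  rewrite lt0n sum_nat_eq0; apply: contra eps0 => /forallP e0.
  by apply/eqP/ffunP => j; rewrite ffunE; apply/negbTE; move: (e0 j); rewrite /= eqb0.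
(* The remaining term is [f] at [mu] times a coefficient that is not zero, since
   the node of [mu] in row [i0] differs from [w]. *)
rewrite addr0 => /esym/eqP; rewrite mulf_eq0 => /orP[|/eqP <-]; last first.
  apply: meval_eq => j; rewrite /spectral /node /remove_strip strip_ord ffunE.
  by rewrite subn0.
rewrite mulf_eq0 => /orP[/prodf_eq0[j _]|].
  rewrite ffunE expr0 mul1r /base_val /= !mulf_eq0 invr_eq0 (negPf (node0 _ _)) orbF.
  rewrite !subr_eq0 => /orP[/eqP h|/eqP h].
    have /eqP := generic_ratio gen (mu j) (n - j.+1)%N; case.
    by rewrite -node_mon -h.
  have [] := node_inj mu j i0 (ltn_ord j) i0n (esym h).
  by move=> ji; rewrite ji => h2; rewrite h2 ltnn in mu_lam.
under eq_mx => j i do rewrite ffunE /=.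
have gent : generic q t (al' * t) be.
  have := generic_shift gen 0 1 0 0.
  by rewrite /mon !expr0z !mulr1 mul1r expr1z.
rewrite det_powers => /prodf_eq0[i _ /prodf_eq0[j ij]].
rewrite subr_eq0 !node_mon => /eqP/(joukowski_inj gent)[_].
by move: (ltn_ord j) (ltn_ord i); lia.
Qed.

End ExtraVanishing.

(** * Partitions as functions *)

Section PartitionsAsFunctions.
Variable n : nat.
Implicit Types lam mu nu : part n.

Definition rows lam (i : nat) : nat := prow lam i.+1.

Lemma rowsE lam (i : 'I_n) : rows lam i = tnth lam i.
Proof. by rewrite /rows /prow /= (tnth_nth 0%N). Qed.

Lemma rows_nonincr lam : nonincr n (rows lam).
Proof.
case: lam => s srt; apply: nonincr_adj => i iS; rewrite /rows /prow /=.
have /(sortedP 0%N) h := srt; by apply: h; rewrite size_tuple.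
Qed.

Lemma rows_inj lam mu : (forall i, (i < n)%N -> rows lam i = rows mu i) -> lam = mu.
Proof.
move=> h; apply/val_inj/eq_from_tnth => i.
by rewrite -!rowsE h.
Qed.

Lemma rows_surj f : nonincr n f ->
  exists lam, forall i, (i < n)%N -> rows lam i = f i.
Proof.
move=> fn; pose s := [tuple f i | i < n].
have srt : sorted geq s.
  apply/(sortedP 0%N) => i; rewrite size_tuple => iS.
  have iS' := ltnW iS.
  rewrite -[i]/(nat_of_ord (Ordinal iS')) -[i.+1]/(nat_of_ord (Ordinal iS)).
  by rewrite -!tnth_nth !tnth_mktuple /= fn.
exists (Part srt) => i ilt; rewrite -[i]/(nat_of_ord (Ordinal ilt)) rowsE.
by rewrite tnth_mktuple.
Qed.

Lemma psum_rows lam k : (\sum_(1 <= i < k.+1) prow lam i)%N = psum (rows lam) k.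
Proof. by rewrite big_add1 big_mkord. Qed.

Lemma domleP mu lam : reflect (dominated n (rows mu) (rows lam)) (domle mu lam).
Proof.
apply: (iffP forallP) => [h k kn|h k]; last by rewrite !psum_rows h.
case: k kn => [|k] kn; first by rewrite /psum !big_ord0.
by have := h (Ordinal kn); rewrite !psum_rows.
Qed.

Lemma containedP mu lam :
  reflect (forall i, (i < n)%N -> (rows mu i <= rows lam i)%N) (contained mu lam).
Proof.
apply: (iffP forallP) => [h i ilt|h i]; first exact: (h (Ordinal ilt)).
exact: h.
Qed.

Lemma contained_domle mu lam : contained mu lam -> domle mu lam.
Proof.
move/containedP => h; apply/domleP => k kn; apply: leq_sum => i _.
by apply: h; apply: leq_trans (ltn_ord i) kn.
Qed.

Lemma contained_refl lam : contained lam lam.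
Proof. exact/containedP. Qed.

Lemma domle_refl lam : domle lam lam.
Proof. exact/contained_domle/contained_refl. Qed.

Lemma domle_trans mu nu lam : domle nu mu -> domle mu lam -> domle nu lam.
Proof.
move=> /domleP h1 /domleP h2; apply/domleP => k kn.
exact: leq_trans (h1 k kn) (h2 k kn).
Qed.

Lemma domle_anti mu lam : domle mu lam -> domle lam mu -> mu = lam.
Proof.
move=> /domleP h1 /domleP h2; apply: rows_inj => i ilt.
have e k : (k <= n)%N -> psum (rows mu) k = psum (rows lam) k.
  by move=> kn; apply/eqP; rewrite eqn_leq h1 // h2.
have := e i.+1 ilt; rewrite /psum !big_ord_recr /= -!/(psum _ i) e; last exact: ltnW.
by move=> /addnI.
Qed.

Lemma domlt_differ mu lam : mu != lam -> differ n (rows mu) (rows lam).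
Proof.
move=> ne; case: (boolP [exists i : 'I_n, rows mu i != rows lam i]).
  by move=> /existsP[i h]; exists i.
rewrite negb_exists => /forallP h; case/eqP: ne; apply: rows_inj => i ilt.
by apply/eqP; have := h (Ordinal ilt); rewrite negbK.
Qed.

Lemma psize_rows lam : psize lam = psum (rows lam) n.
Proof.
rewrite /psize sumnE big_tuple; apply: eq_bigr => i _; by rewrite rowsE.
Qed.

Lemma mem_parts_upto mu lam : domle mu lam -> mu \in parts_upto lam.
Proof.
move=> /domleP dom; rewrite mem_pmap_sub.
have bd (i : 'I_n) : (tnth mu i < (psize lam).+1)%N.
  rewrite -rowsE ltnS; apply: (@leq_trans (rows mu 0)).
    by apply: rows_nonincr.
  have n0 : (0 < n)%N by apply: leq_trans (ltn_ord i).
  have := dom 1 n0; rewrite /psum !big_ord1 => h; apply: leq_trans h _.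
  rewrite psize_rows /psum; move: n0; case: (n) (rows lam) => // m f _.
  by rewrite big_ord_recl leq_addr.
apply/imageP; exists [tuple inord (tnth mu i) | i < n] => //.
by apply: eq_from_tnth => i; rewrite tnth_map tnth_mktuple /= inordK.
Qed.

Lemma uniq_parts_upto lam : uniq (parts_upto lam).
Proof.
apply: pmap_sub_uniq; rewrite map_inj_uniq ?enum_uniq // => x y /(congr1 val) /=.
move=> h; apply: val_inj => /=; exact: (inj_map val_inj h).
Qed.

End PartitionsAsFunctions.

Section SortedSums.
Variables (n : nat) (mu : nat -> nat).
Hypothesis pmu : nonincr n mu.

Lemma sum_perm_psum (s : 'S_n) k : (k <= n)%N ->
  (\sum_(i < n | (i < k)%N) mu (s i) <= psum mu k)%N.
Proof.
case: k => [|k] kn; first by rewrite big_pred0.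
pose B := [set i : 'I_n | (i < k.+1)%N]; pose A := [set s i | i in B].
have sA : (\sum_(i < n | (i < k.+1)%N) mu (s i) = \sum_(i in A) mu i)%N.
  rewrite big_imset /=; last by move=> i j _ _ /perm_inj.
  by apply: eq_bigl => i; rewrite inE.
have sB : (psum mu k.+1 = \sum_(i in B) mu i)%N.
  rewrite /psum; under [RHS]eq_bigl do rewrite inE.
  by rewrite (big_ord_narrow kn).
rewrite sA sB (big_setID B) /= [leqRHS](big_setID A) /= setIC leq_add2l.
have cAB : #|A :\: B| = #|B :\: A|.
  have cA : #|A| = #|B| by apply: card_imset; apply: perm_inj.
  apply/eqP; rewrite -(eqn_add2l #|A :&: B|) cardsID cA [A :&: B]setIC.
  by rewrite cardsID.
apply: (@leq_trans (\sum_(i in A :\: B) mu k)%N).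
  apply: leq_sum => i; rewrite !inE -leqNgt => /andP[ki _].
  by apply: pmu => //; apply: ltnW.
rewrite sum_nat_const cAB -sum_nat_const; apply: leq_sum => i.
by rewrite !inE ltnS => /andP[_ ik]; apply: pmu.
Qed.

End SortedSums.

(** * Orbit sums in the variables x + 1/x *)

Section Chebyshev.
Variable E : fieldType.

Fixpoint cheb k : {poly E} :=
  match k with
  | 0 => (2%:R)%:P
  | 1 => 'X
  | (k'.+1 as k1).+1 => 'X * cheb k1 - cheb k'
  end.

Lemma chebSS k : cheb k.+2 = 'X * cheb k.+1 - cheb k.
Proof. by []. Qed.

Lemma cheb_eval k x : x != 0 -> (cheb k).[x + x^-1] = x ^+ k + x ^- k.
Proof.
move=> x0.
suff : (cheb k).[x + x^-1] = x ^+ k + x ^- k /\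
       (cheb k.+1).[x + x^-1] = x ^+ k.+1 + x ^- k.+1 by case.
elim: k => [|k [IH1 IH2]].
  split; first by rewrite hornerC expr0 invr1.
  by rewrite hornerX.
split=> //; rewrite chebSS hornerD hornerN hornerM hornerX IH1 IH2 !exprS !invfM.
move: (x ^+ k) (expf_neq0 k x0) => y y0.
by field; rewrite x0 y0.
Qed.

Lemma cheb_size_coef k :
  (size (cheb k) <= k.+1)%N /\ (cheb k)`_k = (1 + (k == 0))%:R.
Proof.
suff : ((size (cheb k) <= k.+1)%N /\ (cheb k)`_k = (1 + (k == 0))%:R) /\
       ((size (cheb k.+1) <= k.+2)%N /\ (cheb k.+1)`_k.+1 = 1) by case.
elim: k => [|k [[s1 _] [s2 c2]]].
  split; first by rewrite size_polyC_leq1 coefC.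
  by rewrite size_polyX coefX.
split; first by [].
rewrite chebSS; split.
  apply: leq_trans (size_polyD _ _) _; rewrite geq_max size_polyN; apply/andP; split.
    by apply: leq_trans (size_polyMleq _ _) _; rewrite size_polyX.
  by apply: leq_trans s1 _; rewrite leqW.
by rewrite coefB coefXM /= c2 (nth_default _ (leqW s1)) subr0.
Qed.

End Chebyshev.

Section OrbitSums.
Variables (n : nat) (E : fieldType).
Implicit Types (lam mu : part n) (w : 'S_n * {ffun 'I_n -> bool}).

Lemma mcoeff_prod_in_var (P : 'I_n -> {poly E}) (m : 'X_{1..n}) :
  (\prod_i in_var i (P i))@_m = \prod_i (P i)`_(m i).
Proof.
pose N := (\max_(i < n) size (P i) + mdeg m).+1.
have sN i : (size (P i) <= N)%N.
  apply: leqW; apply: leq_trans _ (leq_addr _ _).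
  exact: leq_bigmax.
have mN i : (m i < N)%N.
  rewrite ltnS; apply: leq_trans _ (leq_addl _ _).
  by rewrite mdegE (bigD1 i) //= leq_addr.
have inE' i : in_var i (P i) = \sum_(e < N) (P i)`_e *: 'X_i ^+ e.
  rewrite /in_var (big_ord_widen N (fun e => (P i)`_e *: 'X_i ^+ e) (sN i)).
  rewrite big_mkcond; apply: eq_bigr => e _; case: ltnP => // /(nth_default 0) ->.
  by rewrite scale0r.
under eq_bigr do rewrite inE'; rewrite bigA_distr_bigA raddf_sum /=.
pose f0 := [ffun i => Ordinal (mN i)].
have term (f : {ffun 'I_n -> 'I_N}) :
    (\prod_i ((P i)`_(f i) *: 'X_i ^+ (f i)))@_m =
    (\prod_i (P i)`_(f i)) * (f == f0)%:R :> E.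
  rewrite scaler_prod mcoeffZ; congr (_ * _).
  have -> : \prod_i 'X_i ^+ (f i) = 'X_[[multinom (f i : nat) | i < n]] :> {mpoly E[n]}.
    by rewrite mpolyXE_id; apply: eq_bigr => i _; rewrite mnmE.
  rewrite mcoeffX; congr (nat_of_bool _)%:R; apply/eqP/eqP => [h|->].
    by apply/ffunP => i; apply: val_inj; rewrite ffunE /= -h mnmE.
  by apply/mnmP => i; rewrite mnmE ffunE.
under eq_bigr do rewrite term; rewrite (bigD1 f0) //= eqxx mulr1.
rewrite [X in _ + X]big1 ?addr0 => [|f /negPf ->]; last by rewrite mulr0.
by apply: eq_bigr => i _; rewrite ffunE.
Qed.

Definition stab lam : nat := #|[pred w | bcact w (expo_of lam) == expo_of lam]|.

Definition row_mult (k m : nat) : nat := ((k == m) * (1 + (k == 0)))%N.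

(** For a given permutation the signs can be chosen freely exactly at the zero
    parts. *)
Lemma stabE lam :
  stab lam = (\sum_(s : 'S_n) \prod_(i < n) row_mult (rows lam (s i)) (rows lam i))%N.
Proof.
rewrite /stab -sum1_card; transitivity
  (\sum_(s : 'S_n) \sum_(e : {ffun 'I_n -> bool})
     \prod_(i < n) ((-1) ^+ e i * (rows lam (s i))%:Z == (rows lam i)%:Z)%R)%N.
  rewrite pair_big big_mkcond /=; apply: eq_bigr => -[s e] _ /=.
  case: ifP => [/eqP/ffunP h|/eqP h].
    rewrite big1 // => i _; have := h i; rewrite !ffunE /= => ->.
    by rewrite eqxx.
  case: (boolP [forall i, (-1) ^+ e i * (rows lam (s i))%:Z == (rows lam i)%:Z]).
    move=> /forallP all_eq; case: h; apply/ffunP => i; rewrite !ffunE /=.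
    exact/eqP.
  rewrite negb_forall => /existsP[i /negPf ni].
  by rewrite (bigD1 i) //= ni mul0n.
apply: eq_bigr => s _.
rewrite -(bigA_distr_bigA (fun i (b : bool) =>
  ((-1) ^+ b * (rows lam (s i))%:Z == (rows lam i)%:Z) : nat)).
apply: eq_bigr => i _; rewrite big_bool /row_mult /= expr1 expr0 mul1r mulN1r.
move: (rows lam (s i)) (rows lam i) => a b.
by case: (eqVneq a b) => [->|ab]; case: eqP; case: eqP => /=; lia.
Qed.

Lemma bcact_comp w0 : exists2 h : 'S_n * {ffun 'I_n -> bool} -> _,
  injective h & forall w a, bcact (h w) a = bcact w0 (bcact w a).
Proof.
case: w0 => s0 e0.
exists (fun w => ((s0 * w.1)%g, [ffun i => e0 i (+) w.2 (s0 i)])) => [[s e] [s' e']|[s e] a].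
  case=> /mulgI -> /ffunP h; congr (_, _); apply/ffunP => i.
  by have := h (s0^-1%g i); rewrite !ffunE permKV => /addbI.
by apply/ffunP => i; rewrite !ffunE /= permM signr_addb mulrA.
Qed.

Lemma bcact_inj w : injective (bcact w).
Proof.
case: w => s e a b /ffunP h; apply/ffunP => i.
have := h (s^-1%g i); rewrite !ffunE /= permKV.
by apply: mulfI; rewrite signr_eq0.
Qed.

Lemma orbit_sum (V : nmodType) (F : expo n -> V) lam :
  \sum_(w : 'S_n * {ffun 'I_n -> bool}) F (bcact w (expo_of lam)) =
  (\sum_(a <- orbit (expo_of lam)) F a) *+ stab lam.
Proof.
set a := expo_of lam.
have -> : \sum_w F (bcact w a) = \sum_(b <- [seq bcact w a | w : 'S_n * {ffun 'I_n -> bool}]) F b.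
  by rewrite big_image.
rewrite -big_undup_iterop_count -sumrMnl big_seq [RHS]big_seq.
apply: eq_bigr => b; rewrite mem_undup => /imageP[w0 _ ->].
have -> : count_mem (bcact w0 a) [seq bcact w a | w : 'S_n * {ffun 'I_n -> bool}] = stab lam.
  have [h h_inj hE] := bcact_comp w0.
  rewrite count_map -sum1_count big_enum_cond /= /stab -sum1_card.
  rewrite (reindex_inj h_inj) /=; apply: eq_bigl => w.
  by rewrite hE inE (inj_eq (@bcact_inj w0)).
by rewrite Monoid.iteropE /= iter_addr_0.
Qed.

Hypothesis char0 : [pchar E] =i pred0.

Lemma stab_neq0 lam : (stab lam)%:R != 0 :> E.
Proof.
rewrite (pcharf0P E).1 // -lt0n; apply/card_gt0P.
exists (1%g, [ffun=> false]); rewrite inE; apply/eqP/ffunP => i.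
by rewrite !ffunE /= perm1 expr0 mul1r.
Qed.

(** [msym lam] in the variables [y_i]: in the sum over the whole group, the two
    signs of a variable combine [x ^ k] and [x ^ -k] into [cheb k]. *)
Definition orbit_poly lam : {mpoly E[n]} :=
  (stab lam)%:R^-1 *:
    \sum_(s : 'S_n) \prod_(i < n) in_var i (cheb E (rows lam (s i))).

Lemma orbit_poly_sym lam : orbit_poly lam \is symmetric.
Proof.
apply/issymP => s; rewrite /orbit_poly msymZ; congr (_ *: _).
rewrite raddf_sum [RHS](reindex_inj (mulgI s^-1%g)) /=; apply: eq_bigr => r _.
rewrite rmorph_prod [RHS](reindex_inj (@perm_inj _ s)) /=.
by apply: eq_bigr => i _; rewrite msym_in_var permM permK.
Qed.

Lemma wle_orbit_poly k lam : (k <= n)%N -> wle k (psum (rows lam) k) (orbit_poly lam).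
Proof.
move=> kn; rewrite /orbit_poly -mul_mpolyC.
rewrite -[psum _ _]add0n; apply: (wleM (wleC _ k _)); apply: wle_sum => s _.
have wp : wle k (\sum_(i < n) (i < k) * rows lam (s i))%N
    (\prod_(i < n) in_var i (cheb E (rows lam (s i)))).
  apply: wle_prod => i _; apply: wle_in_var.
  by case: (cheb_size_coef E (rows lam (s i))).
apply: wle_weak wp; apply: leq_trans (sum_perm_psum (rows_nonincr lam) s kn).
rewrite [leqRHS]big_mkcond; apply: leq_sum => i _.
by case: (i < k)%N; rewrite ?mul1n ?mul0n.
Qed.

(** The permutations that contribute fix the rows of [lam], and the constant 2 of
    [cheb 0] counts the free signs; the total is [stab lam]. *)
Lemma orbit_poly_lead lam : (orbit_poly lam)@_(exponent n (rows lam)) = 1.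
Proof.
rewrite /orbit_poly mcoeffZ -[RHS](mulVf (stab_neq0 lam)); congr (_ * _).
rewrite raddf_sum stabE natr_sum; apply: eq_bigr => s _ /=.
rewrite mcoeff_prod_in_var natr_prod.
under eq_bigr do rewrite mnmE.
case: (boolP [forall i : 'I_n, (rows lam i <= rows lam (s i))%N]) => [/forallP le_all|].
  have : (\sum_(i < n) rows lam i == \sum_(i < n) rows lam (s i))%N.
    by rewrite [X in X == _](reindex_inj (@perm_inj _ s)).
  rewrite (leqif_sum (fun i _ => leqif_eq (le_all i))) => /forallP eq_all.
  apply: eq_bigr => i _; have /eqP <- := eq_all i.
  rewrite /row_mult eqxx mul1n.
  by case: (cheb_size_coef E (rows lam i)).
rewrite negb_forall => /existsP[i]; rewrite -ltnNge => lt_i.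
rewrite (bigD1 i) //= [RHS](bigD1 i) //= /row_mult (ltn_eqF lt_i) mul0n mul0r.
rewrite nth_default ?mul0r //.
by apply: leq_trans lt_i; case: (cheb_size_coef E (rows lam (s i))).
Qed.

Lemma orbit_poly_coef lam mu :
  (orbit_poly mu)@_(exponent n (rows lam)) != 0 -> domle lam mu.
Proof.
rewrite -mcoeff_msupp => lam_mu; apply/domleP => k kn.
have /wleP/(_ _ lam_mu) := wle_orbit_poly mu kn.
apply: leq_trans; rewrite /psum /pdeg (big_ord_narrow kn).
by apply: leq_sum => i _; rewrite mnmE.
Qed.

End OrbitSums.

(** * Interpolation at generic parameters *)

Section Rescale.
Variables (n : nat) (E : fieldType) (k : E).
Implicit Types (f : {mpoly E[n]}).

Definition rescale : {mpoly E[n]} -> {mpoly E[n]} :=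
  mmap (@mpolyC n E) (fun i : 'I_n => k *: 'X_i).

HB.instance Definition _ := GRing.RMorphism.on rescale.

Lemma rescaleX i : rescale 'X_i = k *: 'X_i.
Proof. by rewrite /rescale mmapX mmap1U. Qed.

Lemma rescaleC a : rescale a%:MP = a%:MP.
Proof. exact: mmapC. Qed.

Lemma rescale_eval f v : (rescale f).@[v] = f.@[fun i => k * v i].
Proof.
rewrite -[LHS]/((meval v \o rescale) f).
apply: mpoly_morph_ext => [a|i] /=; first by rewrite rescaleC !mevalC.
by rewrite rescaleX mevalZ !mevalXU.
Qed.

Lemma rescale_sym f : f \is symmetric -> rescale f \is symmetric.
Proof.
move=> /issymP sf; apply/issymP => s; rewrite -[in RHS](sf s).
rewrite -[LHS]/((mpoly.msym s \o rescale) f) -[RHS]/((rescale \o mpoly.msym s) f).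
apply: mpoly_morph_ext => [a|i] /=; first by rewrite !(rescaleC, msymC).
by rewrite rescaleX msymZ !msymX1 rescaleX.
Qed.

Lemma wle_rescale j d f : wle j d f -> wle j d (rescale f).
Proof.
move=> /wleP wf; rewrite (mpolyE f) rmorph_sum big_seq; apply: wle_sum => m /wf wm /=.
rewrite -mul_mpolyC rmorphM /= rescaleC mul_mpolyC mpolyXE_id rmorph_prod /=.
have -> : \prod_(i < n) rescale ('X_i ^+ m i) = (\prod_(i < n) k ^+ m i) *: 'X_[m].
  rewrite mpolyXE_id -scaler_prod; apply: eq_bigr => i _.
  by rewrite rmorphXn /= rescaleX exprZn.
rewrite scalerA; apply/wleP => m' /msuppZ_le.
by rewrite msuppX inE => /eqP ->.
Qed.

End Rescale.

Section DominanceWeight.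
Variable n : nat.
Implicit Types mu lam : part n.

Lemma domlt_strict mu lam : domlt mu lam -> domle mu lam /\ ~~ domle lam mu.
Proof.
move=> /andP[ne le]; split=> //; apply: contraNN ne => ge.
by rewrite (domle_anti le ge).
Qed.

(** A natural number on which inductions along strict dominance can rest, as the
    sizes of comparable partitions may agree. *)
Definition dominance_weight lam : nat := (\sum_(k < n) psum (rows lam) k.+1)%N.

Lemma dominance_weight_lt mu lam :
  domlt mu lam -> (dominance_weight mu < dominance_weight lam)%N.
Proof.
move=> /domlt_strict[/domleP le nle]; rewrite ltnNge; apply: contraNN nle => ge.
have le' (k : 'I_n) : (psum (rows mu) k.+1 <= psum (rows lam) k.+1)%N by exact: le.
have : dominance_weight mu == dominance_weight lam by rewrite eqn_leq ge andbT leq_sum.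
rewrite (leqif_sum (fun k _ => leqif_eq (le' k))) => /forallP eqs.
apply/domleP => -[|k] kn; first by rewrite /psum !big_ord0.
by have /eqP -> := eqs (Ordinal kn).
Qed.

End DominanceWeight.

Section InterpolationInY.
Variables (n : nat) (E : fieldType) (q t : E).
Hypothesis char0 : [pchar E] =i pred0.
Implicit Types (lam mu nu : part n) (al be : E) (f g : {mpoly E[n]}).

Definition lower_comb lam (c : part n -> E) : {mpoly E[n]} :=
  \sum_(mu <- parts_upto lam | domlt mu lam) c mu *: orbit_poly E mu.

Lemma lower_comb_sym lam c : lower_comb lam c \is symmetric.
Proof.
apply: rpred_sum => mu _; apply/issymP => s.
by rewrite msymZ (issymP _ (orbit_poly_sym E mu)).
Qed.

Lemma wle_lower_comb k lam c :
  (k <= n)%N -> wle k (psum (rows lam) k) (lower_comb lam c).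
Proof.
move=> kn; apply: wle_sum => mu /domlt_strict[/domleP/(_ k kn) le _].
rewrite -mul_mpolyC -[psum _ _]add0n; apply: (wleM (wleC _ k _)).
exact: wle_weak le (wle_orbit_poly E mu kn).
Qed.

Lemma lower_comb_lead lam c : (lower_comb lam c)@_(exponent n (rows lam)) = 0.
Proof.
rewrite /lower_comb raddf_sum big1 // => mu /domlt_strict[_ nle] /=.
rewrite mcoeffZ; apply/eqP; rewrite mulf_eq0; apply/orP; right.
by apply: contraNT nle => /orbit_poly_coef.
Qed.

(** Orbit sums are linearly independent: in a combination, the monomial
    attached to a partition maximal among those with a nonzero coefficient
    occurs in no other term. *)
Lemma lower_comb_eq0 lam c :
  lower_comb lam c = 0 -> forall mu, domlt mu lam -> c mu = 0.
Proof.
move=> c0; pose wt mu := dominance_weight mu.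
pose top := (\max_(mu <- parts_upto lam) wt mu)%N.
suff main d mu : (top - wt mu < d)%N -> domlt mu lam -> c mu = 0.
  by move=> mu; apply: (main (top - wt mu).+1).
elim: d mu => // d IH mu; rewrite ltnS => wmu mu_lam.
have mu_in nu : domlt nu lam -> nu \in parts_upto lam.
  by case/domlt_strict => le _; apply: mem_parts_upto.
have /(congr1 (mcoeff (exponent n (rows mu)))) := c0.
rewrite mcoeff0 /lower_comb raddf_sum /= -big_filter.
rewrite (bigD1_seq mu) ?filter_uniq ?uniq_parts_upto ?mem_filter ?mu_lam ?mu_in //=.
rewrite mcoeffZ orbit_poly_lead // mulr1 big_seq_cond big1 ?addr0 // => nu /andP[].
rewrite mem_filter => /andP[nu_lam _] nu_mu.
rewrite mcoeffZ; case: (eqVneq (orbit_poly E nu)@_(exponent n (rows mu)) 0) => [->|].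
  by rewrite mulr0.
move/orbit_poly_coef => mu_nu; have wlt : (wt mu < wt nu)%N.
  by apply: dominance_weight_lt; rewrite /domlt eq_sym nu_mu.
rewrite IH ?mul0r //.
have : (wt nu <= top)%N by apply: leq_bigmax_seq => //; apply: mu_in.
by move: wmu wlt; lia.
Qed.

Section AtParameters.
Variables (al be : E).
Hypothesis gen : generic q t al be.

Notation value f nu := (f.@[spectral q t al be (rows nu)]).

Lemma vanishing_belowP lam f : f \is symmetric ->
    (forall k, (k <= n)%N -> wle k (psum (rows lam) k) f) ->
    (forall nu, domlt nu lam -> value f nu = 0) ->
  vanishing_below q t al be (rows lam) f.
Proof.
move=> sf wf vf; split=> // mu pmu dmu df.
have [nu nuE] := rows_surj pmu.
rewrite -(vf nu).
  by apply: meval_eq => i; rewrite /spectral /node nuE.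
apply/andP; split.
  apply/eqP => e; have [i ilt /eqP []] := df; by rewrite -nuE // e.
apply/domleP => k kn; rewrite (@eq_psum _ mu n) //; first exact: dmu.
Qed.

(** A zero leading coefficient makes [f] vanish at [lam] too, by [leading_value],
    so that [vanishing_determines] applies. *)
Lemma vanishing_below_eq0 lam f :
    vanishing_below q t al be (rows lam) f -> f@_(exponent n (rows lam)) = 0 ->
  f = 0.
Proof.
move=> vb f0; have [sf wf vf] := vb.
have [c _ hc] := leading_value gen (rows_nonincr lam).
have flam : value f lam = 0 by rewrite hc // f0 mul0r.
apply: (vanishing_determines gen sf wf) => mu pmu dmu.
have [nu nuE] := rows_surj pmu.
have [nu_lam|ne] := eqVneq nu lam.
  rewrite -flam; apply: meval_eq => i.
  by rewrite /spectral /node -nuE // nu_lam.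
apply: vf => //; have [i ilt ni] := domlt_differ ne.
by exists i => //; rewrite -nuE.
Qed.

Lemma lower_comb_vanishing lam c :
    (forall nu, domlt nu lam -> value (lower_comb lam c) nu = 0) ->
  forall mu, domlt mu lam -> c mu = 0.
Proof.
move=> h; apply: lower_comb_eq0; apply: (@vanishing_below_eq0 lam).
  apply: vanishing_belowP => // [|k kn]; first exact: lower_comb_sym.
  exact: wle_lower_comb.
exact: lower_comb_lead.
Qed.

(** As many unknowns as equations, and the homogeneous system has only the zero
    solution by [lower_comb_vanishing]. *)
Lemma interpolation_exists lam : exists c : part n -> E,
  forall nu, domlt nu lam -> value (orbit_poly E lam + lower_comb lam c) nu = 0.
Proof.
pose J := [seq mu <- parts_upto lam | domlt mu lam]; pose N := size J.
have uJ : uniq J by rewrite filter_uniq // uniq_parts_upto.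
have memJ mu : (mu \in J) = domlt mu lam.
  rewrite mem_filter andb_idr // => /domlt_strict[le _].
  exact: mem_parts_upto.
pose part_at (i : 'I_N) := nth lam J i.
have part_at_lt i : domlt (part_at i) lam by rewrite -memJ mem_nth.
pose coef_of (u : 'rV[E]_N) mu : E :=
  if insub (index mu J) is Some i then u 0 i else 0.
have coef_at u i : coef_of u (part_at i) = u 0 i.
  by rewrite /coef_of index_uniq // valK.
have combE u : lower_comb lam (coef_of u) = \sum_i u 0 i *: orbit_poly E (part_at i).
  rewrite /lower_comb -big_filter -/J (big_nth lam) big_mkord.
  by apply: eq_bigr => i _; rewrite -/(part_at i) coef_at.
pose A : 'M[E]_N := \matrix_(i, j) value (orbit_poly E (part_at i)) (part_at j).
have valE u j : value (lower_comb lam (coef_of u)) (part_at j) = (u *m A) 0 j.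
  rewrite combE raddf_sum mxE; apply: eq_bigr => i _ /=.
  by rewrite mevalZ mxE.
have at_index nu : domlt nu lam -> exists j, nu = part_at j.
  rewrite -memJ => nuJ; have lt : (index nu J < N)%N by rewrite index_mem.
  by exists (Ordinal lt); rewrite /part_at nth_index.
have Aunit : A \in unitmx.
  rewrite -row_free_unit -kermx_eq0; apply/eqP/row_matrixP => i.
  rewrite row0; set u := row i _.
  have uA : u *m A = 0 by apply/sub_kermxP; apply: row_sub.
  apply/rowP => j; rewrite [RHS]mxE -coef_at.
  apply: (@lower_comb_vanishing lam) => // nu /at_index[k ->].
  by rewrite valE uA mxE.
pose b : 'rV[E]_N := \row_j - value (orbit_poly E lam) (part_at j).
exists (coef_of (b *m invmx A)) => nu /at_index[j ->].
by rewrite mevalD valE mulmxKV // mxE subrr.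
Qed.

Lemma interpolation_below lam c :
    (forall nu, domlt nu lam -> value (orbit_poly E lam + lower_comb lam c) nu = 0) ->
  vanishing_below q t al be (rows lam) (orbit_poly E lam + lower_comb lam c) /\
  (orbit_poly E lam + lower_comb lam c)@_(exponent n (rows lam)) = 1.
Proof.
move=> h; split; last by rewrite mcoeffD lower_comb_lead orbit_poly_lead // addr0.
apply: vanishing_belowP => // [|k kn].
  by rewrite rpredD // ?orbit_poly_sym ?lower_comb_sym.
by apply: wleD; [apply: wle_orbit_poly|apply: wle_lower_comb].
Qed.

Lemma monic_below_unique lam f g :
    vanishing_below q t al be (rows lam) f ->
    vanishing_below q t al be (rows lam) g ->
    f@_(exponent n (rows lam)) = 1 ->
  g = g@_(exponent n (rows lam)) *: f.
Proof.
move=> [sf wf vf] [sg wg vg] f1; set k := g@__.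
apply/eqP; rewrite -subr_eq0; apply/eqP.
apply: (@vanishing_below_eq0 lam); last by rewrite mcoeffB mcoeffZ f1 mulr1 subrr.
split=> [|j jn|mu pmu dmu df].
- rewrite rpredB //; apply/issymP => s; by rewrite msymZ (issymP _ sf).
- apply: wleD; first exact: wg.
  rewrite -scaleNr -mul_mpolyC -[psum _ _]add0n; apply: (wleM (wleC _ j _)).
  exact: wf.
by rewrite mevalB mevalZ vf // vg // mulr0 subrr.
Qed.

Lemma below_value_neq0 lam f :
    vanishing_below q t al be (rows lam) f -> f@_(exponent n (rows lam)) = 1 ->
  value f lam != 0.
Proof.
move=> vb f1; apply/eqP => v0; have [sf wf vf] := vb.
suff f0 : f = 0 by move: f1; rewrite f0 mcoeff0 => /eqP; rewrite eq_sym oner_eq0.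
apply: (vanishing_determines gen sf wf) => mu pmu dmu.
have [nu nuE] := rows_surj pmu.
have [nu_lam|ne] := eqVneq nu lam.
  by rewrite -v0; apply: meval_eq => i; rewrite /spectral /node -nuE // nu_lam.
apply: vf => //; have [i ilt ni] := domlt_differ ne.
by exists i => //; rewrite -nuE.
Qed.

Lemma below_extra_vanishing lam mu f :
    vanishing_below q t al be (rows lam) f -> ~~ contained lam mu ->
  value f mu = 0.
Proof.
move=> vb; rewrite negb_forall => /existsP[i]; rewrite -ltnNge => lt.
exact: (extra_vanishing gen (rows_nonincr lam) vb (rows_nonincr mu) (ltn_ord i) lt).
Qed.

End AtParameters.

(** Rescaling the variables multiplies both parameters by the same factor, so
    that quotients of values depend on [al / be] only. *)
Lemma value_ratio_scale al be k lam mu f g :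
    k != 0 -> generic q t al be -> generic q t (k * al) (k * be) ->
    vanishing_below q t al be (rows lam) f ->
    f@_(exponent n (rows lam)) = 1 ->
    vanishing_below q t (k * al) (k * be) (rows lam) g ->
    g@_(exponent n (rows lam)) = 1 ->
  f.@[spectral q t al be (rows mu)] / f.@[spectral q t al be (rows lam)] =
  g.@[spectral q t (k * al) (k * be) (rows mu)] /
    g.@[spectral q t (k * al) (k * be) (rows lam)].
Proof.
move=> k0 gen genk vf f1 vg g1.
pose sc := rescale k g.
have sc_spec nu : sc.@[spectral q t al be (rows nu)] =
    g.@[spectral q t (k * al) (k * be) (rows nu)].
  rewrite rescale_eval; apply: meval_eq => i; rewrite /spectral /joukowski.
  by rewrite mulrDr !mulrA.
have [sg wg hg] := vg.
have vsc : vanishing_below q t al be (rows lam) sc.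
  split=> [|j jn|nu pnu dnu df]; first exact: rescale_sym.
    by apply: wle_rescale; apply: wg.
  rewrite rescale_eval -(hg nu pnu dnu df); apply: meval_eq => i.
  by rewrite /spectral /joukowski mulrDr !mulrA.
have scE := monic_below_unique gen vf vsc f1.
set c := sc@__ in scE.
have c0 : c != 0.
  apply: contraTneq (below_value_neq0 genk vg g1) => cz.
  by rewrite -sc_spec scE cz scale0r meval0 eqxx.
by rewrite -!sc_spec scE !mevalZ -mulf_div mulfV // mul1r.
Qed.

End InterpolationInY.

(** * Substitution in rational functions *)

Section FractionSplit.
Local Open Scope quotient_scope.

Lemma fraction_split (R : idomainType) (r : {fraction R}) :
  r = tofrac \n_(repr r) / tofrac \d_(repr r).
Proof.
set x := repr r.
have d0 : tofrac \d_x != 0 by rewrite tofrac_eq0 denom_ratioP.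
apply: (mulIf d0); rewrite divfK // -[r]reprK -/x.
rewrite -[LHS]/(FracField.mul _ _) !piE; apply/eqmodP => /=.
rewrite FracField.equivfE /FracField.mulf !numden_Ratio ?mulf_neq0 ?oner_neq0 ?denom_ratioP //.
by rewrite !mulr1 mulrC.
Qed.

End FractionSplit.

Section Substitution.
Variables (k : nat) (E : fieldType).

Lemma ratfun_morph_ext (F G : {rmorphism ratfun k -> E}) :
    (forall c, F (cst k c) = G (cst k c)) -> (forall i, F (var i) = G (var i)) ->
  F =1 G.
Proof.
move=> FGc FGv r; rewrite (fraction_split r) !fmorph_div.
have ext p : F (tofrac p) = G (tofrac p).
  rewrite -[LHS]/((F \o (@FracField.tofrac _)) p) -[RHS]/((G \o (@FracField.tofrac _)) p).
  by apply: mpoly_morph_ext => [c|i] /=; [apply: FGc|apply: FGv].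
by rewrite !ext.
Qed.

Variables (phi : {rmorphism Fqt -> E}) (v : 'I_k -> E).
Hypothesis indep : forall p : {mpoly Fqt[k]}, p != 0 -> mmap phi v p != 0.

Lemma rsubst_frac (a b : {mpoly Fqt[k]}) : b != 0 ->
  rsubst phi v (tofrac a / tofrac b) = mmap phi v a / mmap phi v b.
Proof.
move=> b0; rewrite /rsubst; set r := tofrac a / tofrac b; set x := repr r.
have d0 : \d_x != 0 by exact: denom_ratioP.
apply/eqP; rewrite eqr_div ?indep //; apply/eqP; rewrite -!rmorphM; congr (mmap _ _ _).
have := fraction_split r; rewrite -/x {1}/r => /eqP.
by rewrite eqr_div ?tofrac_eq0 // -!tofracM tofrac_eq => /eqP <-.
Qed.

Lemma rsubst_tofrac (a : {mpoly Fqt[k]}) : rsubst phi v (tofrac a) = mmap phi v a.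
Proof.
rewrite -[tofrac a]divr1 -tofrac1 rsubst_frac ?oner_neq0 //.
by rewrite rmorph1 divr1.
Qed.

Lemma rsubst_is_zmod_morphism : zmod_morphism (rsubst phi v).
Proof.
move=> r1 r2; rewrite (fraction_split r1) (fraction_split r2).
set n1 := \n_(repr r1); set d1 := \d_(repr r1).
set n2 := \n_(repr r2); set d2 := \d_(repr r2).
have d10 : d1 != 0 by exact: denom_ratioP.
have d20 : d2 != 0 by exact: denom_ratioP.
rewrite -mulNr addf_div ?tofrac_eq0 // -tofracN -!tofracM -tofracD !rsubst_frac ?mulf_neq0 //.
rewrite -mulNr addf_div ?indep //.
by rewrite rmorphD !rmorphM rmorphN.
Qed.

Lemma rsubst_is_monoid_morphism : monoid_morphism (rsubst phi v).
Proof.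
split=> [|r1 r2]; first by rewrite -tofrac1 rsubst_tofrac rmorph1.
rewrite (fraction_split r1) (fraction_split r2).
set n1 := \n_(repr r1); set d1 := \d_(repr r1).
set n2 := \n_(repr r2); set d2 := \d_(repr r2).
have d10 : d1 != 0 by exact: denom_ratioP.
have d20 : d2 != 0 by exact: denom_ratioP.
by rewrite mulf_div -!tofracM !rsubst_frac ?mulf_neq0 // !rmorphM mulf_div.
Qed.

(** Algebraic independence of the [v i] keeps the denominators of all
    representatives from vanishing, hence [rsubst] respects sums and products. *)
Lemma rsubst_morph : exists H : {rmorphism ratfun k -> E},
  [/\ H =1 rsubst phi v, forall c, H (cst k c) = phi c & forall i, H (var i) = v i].
Proof.
pose M := GRing.isZmodMorphism.Build _ _ (rsubst phi v) rsubst_is_zmod_morphism.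
pose M' := GRing.isMonoidMorphism.Build _ _ (rsubst phi v) rsubst_is_monoid_morphism.
pose H : {rmorphism ratfun k -> E} := HB.pack (rsubst phi v) M M'.
exists H; split=> // [c|i]; rewrite -[LHS]/(rsubst phi v _) rsubst_tofrac.
  exact: mmapC.
by rewrite mmapX mmap1U.
Qed.

End Substitution.

Section MonomialIndependence.
Variables (k : nat) (R : fieldType).

Definition int_pos (a : int) : nat := if a is Posz m then m else 0.
Definition int_neg (a : int) : nat := if a is Negz m then m.+1 else 0.

Lemma exprz_split (E : fieldType) (x : E) a : x ^ a = x ^+ int_pos a / x ^+ int_neg a.
Proof. by case: a => m; rewrite /= ?expr0 ?divr1 ?div1r. Qed.

Lemma monomial_independence (a : 'I_k -> int) (c : R) :
  \prod_(i < k) (tofrac ('X_i : {mpoly R[k]})) ^ a i = tofrac (c%:MP) ->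
  forall i, a i = 0.
Proof.
under eq_bigr do rewrite exprz_split; rewrite prodf_div.
pose m1 := [multinom int_pos (a i) | i < k]; pose m2 := [multinom int_neg (a i) | i < k].
have XE (m : 'X_{1..k}) :
    \prod_(i < k) tofrac ('X_i : {mpoly R[k]}) ^+ m i = tofrac 'X_[m].
  by rewrite mpolyXE_id rmorph_prod; apply: eq_bigr => i _; rewrite rmorphXn.
have -> : \prod_(i < k) tofrac ('X_i : {mpoly R[k]}) ^+ int_pos (a i) = tofrac 'X_[m1].
  by rewrite -XE; apply: eq_bigr => i _; rewrite mnmE.
have -> : \prod_(i < k) tofrac ('X_i : {mpoly R[k]}) ^+ int_neg (a i) = tofrac 'X_[m2].
  by rewrite -XE; apply: eq_bigr => i _; rewrite mnmE.
have X0 : tofrac ('X_[m2] : {mpoly R[k]}) != 0.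
  rewrite tofrac_eq0; apply/eqP => /(congr1 (mcoeff m2)).
  by rewrite mcoeffX eqxx mcoeff0 => /eqP; rewrite oner_eq0.
move=> /(canRL (divfK X0)); rewrite -tofracM => /eqP; rewrite tofrac_eq.
move=> /eqP/(congr1 (mcoeff m1)); rewrite mcoeffX eqxx mcoeffCM mcoeffX.
case: eqP => [m12 _ i|_ /eqP]; last by rewrite mulr0 oner_eq0.
have /mnmP/(_ i) := m12; rewrite !mnmE.
by case: (a i) => [[|m]|m] //=.
Qed.

End MonomialIndependence.

(** * Generic and hatted parameters *)

Definition cst_morph k : {rmorphism Fqt -> ratfun k} :=
  (@FracField.tofrac _) \o (@mpolyC k Fqt).

Lemma cst_morphE k c : cst_morph k c = cst k c.
Proof. by []. Qed.

Lemma pchar_Fqt : [pchar Fqt] =i pred0.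
Proof.
pose f : {rmorphism rat -> Fqt} := (@FracField.tofrac _) \o (@mpolyC 2 rat).
by move=> p; rewrite (fmorph_pchar f) Num.Theory.pchar_num.
Qed.

Lemma pchar_ratfun k : [pchar (ratfun k)] =i pred0.
Proof. by move=> p; rewrite (fmorph_pchar (cst_morph k)) pchar_Fqt. Qed.

Lemma prod2 (V : comNzRingType) (F : 'I_2 -> V) :
  \prod_i F i = F ord0 * F ord_max.
Proof.
by rewrite big_ord_recl big_ord1; congr (_ * F _); apply: val_inj.
Qed.

Lemma prod4 (V : comNzRingType) (F : 'I_4 -> V) :
  \prod_i F i = F (inord 0) * F (inord 1) * F (inord 2) * F (inord 3).
Proof.
rewrite !big_ord_recl big_ord0 mulr1 !mulrA.
by congr (F _ * F _ * F _ * F _); apply: val_inj; rewrite /= inordK.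
Qed.

Lemma sum4 (F : 'I_4 -> nat) :
  (\sum_i F i = F (inord 0) + F (inord 1) + F (inord 2) + F (inord 3))%N.
Proof.
rewrite !big_ord_recl big_ord0 addn0 !addnA.
by congr (F _ + F _ + F _ + F _)%N; apply: val_inj; rewrite /= inordK.
Qed.

Lemma morph_ratio4 (A B : fieldType) (f : {rmorphism A -> B}) (a b c d e : A) :
  f (a * b * c * d / e) = f a * f b * f c * f d / f e.
Proof. by rewrite fmorph_div !rmorphM. Qed.

Lemma mon_Fqt a b : mon qF tF a b = 1 -> a = 0 /\ b = 0.
Proof.
move=> h; have := @monomial_independence 2 rat (fun i => if i == ord0 then a else b) 1.
rewrite prod2 /= tofrac1 => /(_ h) z.
by split; [have := z ord0|have := z ord_max].
Qed.

Lemma qF_neq0 : qF != 0.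
Proof.
rewrite tofrac_eq0; apply/eqP => /(congr1 (mcoeff U_(ord0)%MM)).
by rewrite mcoeffXU eqxx mcoeff0 => /eqP; rewrite oner_eq0.
Qed.

Lemma tF_neq0 : tF != 0.
Proof.
rewrite tofrac_eq0; apply/eqP => /(congr1 (mcoeff U_(ord_max)%MM)).
by rewrite mcoeffXU eqxx mcoeff0 => /eqP; rewrite oner_eq0.
Qed.

Lemma var_neq0 k (i : 'I_k) : var i != 0.
Proof.
rewrite tofrac_eq0; apply/eqP => /(congr1 (mcoeff U_(i)%MM)).
by rewrite mcoeffXU eqxx mcoeff0 => /eqP; rewrite oner_eq0.
Qed.

Lemma cst_mon k a b : mon (cst k qF) (cst k tF) a b = cst k (mon qF tF a b).
Proof.
rewrite /mon -!cst_morphE rmorphM /=.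
by rewrite -!(fmorphXz (cst_morph k)).
Qed.

Lemma ratfun_monomial k (e : 'I_k -> int) c :
  cst k c * \prod_i var i ^ e i = 1 -> forall i, e i = 0.
Proof.
have [->|c0] := eqVneq c 0.
  rewrite -cst_morphE rmorph0 mul0r => /eqP.
  by rewrite eq_sym oner_eq0.
have cc0 : cst k c != 0 by rewrite -cst_morphE fmorph_eq0.
move=> h; apply: (@monomial_independence _ _ _ c^-1).
rewrite -[RHS]/(cst_morph k c^-1) fmorphV cst_morphE.
by apply: (mulfI cc0); rewrite [LHS]h mulfV.
Qed.

Section GenericMorphism.
Variables (E E' : fieldType) (f : {rmorphism E -> E'}).

Lemma mon_morph q t a b : mon (f q) (f t) a b = f (mon q t a b).
Proof. by rewrite /mon rmorphM /= !fmorphXz. Qed.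

Lemma generic_morph q t al be :
  generic q t al be -> generic (f q) (f t) (f al) (f be).
Proof.
case=> q0 t0 al0 be0 two gm gr; split; rewrite ?fmorph_eq0 //.
- by rewrite -(rmorph_nat f) fmorph_eq0.
- by move=> a b; rewrite mon_morph -(rmorph1 f) => /fmorph_inj/gm.
- by move=> a b; rewrite mon_morph -rmorphM (inj_eq (fmorph_inj f)).
Qed.

End GenericMorphism.

Lemma mon_ratfun k a b : mon (cst k qF) (cst k tF) a b = 1 -> a = 0 /\ b = 0.
Proof.
rewrite cst_mon -cst_morphE -(rmorph1 (cst_morph k)) => /fmorph_inj.
exact: mon_Fqt.
Qed.

Lemma two_ratfun k : 2%:R != 0 :> ratfun k.
Proof. by rewrite ((pcharf0P _).1 (pchar_ratfun k)). Qed.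

Lemma cst_neq0 k c : c != 0 -> cst k c != 0.
Proof. by move=> c0; rewrite -cst_morphE fmorph_eq0. Qed.

Lemma generic_Fs : generic (cst 1 qF) (cst 1 tF) sv sv^-1.
Proof.
have sv0 : sv != 0 by exact: var_neq0.
split; [exact: cst_neq0 qF_neq0|exact: cst_neq0 tF_neq0|by []|by rewrite invr_eq0
  |exact: two_ratfun|exact: mon_ratfun|].
move=> a b; apply/eqP => h.
have : cst 1 (mon qF tF a b) * \prod_(i < 1) var i ^ (2%:Z) = 1.
  rewrite big_ord1 -cst_mon -[var _]/sv -exprnP expr2 mulrA [mon _ _ _ _ * sv]mulrC h.
  by rewrite mulVf.
by move=> /ratfun_monomial /(_ ord0).
Qed.

Definition Sparam : FT := tpar 0 * tpar 1 * tpar 2 * tpar 3 / cst 4 qF.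

Lemma tpar_prod (e : nat -> int) :
  \prod_(i < 4) var i ^ e i =
  tpar 0 ^ e 0%N * tpar 1 ^ e 1%N * tpar 2 ^ e 2%N * tpar 3 ^ e 3%N.
Proof.
by rewrite prod4 !inordK.
Qed.

Lemma monomial_ratio (F : fieldType) (x q y p : F) : x / q * y * p = p / q * (x * y).
Proof. by ring. Qed.

Lemma generic_FT : generic (cst 4 qF) (cst 4 tF) Sparam 1.
Proof.
have v0 i : tpar i != 0 by exact: var_neq0.
have q0 : cst 4 qF != 0 by exact: cst_neq0 qF_neq0.
split; [by []|exact: cst_neq0 tF_neq0| |exact: oner_neq0|exact: two_ratfun
  |exact: mon_ratfun|].
  exact: (mulf_neq0 (mulf_neq0 (mulf_neq0 (mulf_neq0 (v0 _) (v0 _)) (v0 _)) (v0 _))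
    (invr_neq0 q0)).
move=> a b; apply/eqP => h.
have : cst 4 (mon qF tF (a - 1) b) * \prod_(i < 4) var i ^ (1%:Z) = 1.
  rewrite (tpar_prod (fun=> 1)) !expr1z -cst_mon -h /Sparam /mon.
  rewrite expfzDr // -invr_expz expr1z.
  exact: monomial_ratio.
by move=> /ratfun_monomial /(_ ord0).
Qed.

(** The exponents produced by [hat_monomial] determine the initial ones. *)
Lemma hat_exponents_inj (a0 a1 a2 a3 b0 b1 b2 b3 e f D : nat) :
    (a0 + (a1 + a2 + a3) = e.*2)%N -> (b0 + (b1 + b2 + b3) = f.*2)%N ->
    (a1 + a2 + a3 <= D)%N -> (b1 + b2 + b3 <= D)%N ->
    (e + D = f + D)%N ->
    (e + D - (a1 + a2 + a3) + a1 = f + D - (b1 + b2 + b3) + b1)%N ->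
    (e + D - (a1 + a2 + a3) + a2 = f + D - (b1 + b2 + b3) + b2)%N ->
    (e + D - (a1 + a2 + a3) + a3 = f + D - (b1 + b2 + b3) + b3)%N ->
  [/\ a0 = b0, a1 = b1, a2 = b2 & a3 = b3].
Proof.
move=> ea eb Sa Sb /addIn ef; subst f.
move=> h1 h2 h3; have SS : (a1 + a2 + a3 = b1 + b2 + b3)%N by lia.
by rewrite SS in ea h1 h2 h3 *; move: h1 h2 h3 => /addnI -> /addnI -> /addnI ->; split=> //;
   apply: (@addIn (b1 + b2 + b3)); rewrite ea eb.
Qed.

Section HattedParameters.
Variables (L : fieldType) (iota : {rmorphism FT -> L}) (h : L).
Hypothesis hh : h ^+ 2 = iota Sparam.

Definition embL : {rmorphism Fqt -> L} := iota \o cst_morph 4.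

Lemma hat_param_neq0 : h != 0.
Proof.
apply/eqP => h0; have := generic_al generic_FT; rewrite -(fmorph_eq0 iota) -hh h0.
by rewrite expr0n eqxx.
Qed.

Let i0 : 'I_4 := inord 0.
Let i1 : 'I_4 := inord 1.
Let i2 : 'I_4 := inord 2.
Let i3 : 'I_4 := inord 3.

Notation K := {mpoly Fqt[4]}.

Definition negate : K -> K := mmap (@mpolyC 4 Fqt) (fun i => - 'X_i).
HB.instance Definition _ := GRing.RMorphism.on negate.

Lemma negateX i : negate 'X_i = - 'X_i.
Proof. by rewrite /negate mmapX mmap1U. Qed.

Lemma negateC c : negate c%:MP = c%:MP.
Proof. exact: mmapC. Qed.

Lemma negateK p : negate (negate p) = p.
Proof.
rewrite -[LHS]/((negate \o negate) p) -[RHS]/((GRing.RMorphism.clone _ _ idfun _) p).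
apply: mpoly_morph_ext => [c|i] /=; first by rewrite !negateC.
by rewrite negateX rmorphN /= negateX opprK.
Qed.

Lemma mcoeff_negate p m : (negate p)@_m = (-1) ^+ mdeg m * p@_m.
Proof.
have negateXm m' : negate 'X_[m'] = (-1) ^+ mdeg m' *: 'X_[m'].
  rewrite mpolyXE_id rmorph_prod mdegE -prodrXr -scaler_prod.
  apply: eq_bigr => i _ /=; rewrite rmorphXn /= negateX.
  by rewrite -scaleN1r exprZn.
rewrite {1}(mpolyE p) rmorph_sum raddf_sum /=.
rewrite [X in _ = _ * X@__](mpolyE p) raddf_sum mulr_sumr; apply: eq_bigr => m' _ /=.
rewrite -mul_mpolyC rmorphM /= negateC negateXm !mul_mpolyC !mcoeffZ mcoeffX.
by case: eqP => [->|_] /=; rewrite ?(mulr0, mulr1) // mulrC.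
Qed.

(** When the total degree is even, [h] disappears from the substituted monomial.
    The factor of exponent [D] clears the denominators for all the monomials of a
    polynomial at once. *)
Lemma hat_monomial (x y1 y2 y3 qL : L) (m0 m1 m2 m3 e D : nat) :
    x != 0 -> y1 != 0 -> y2 != 0 -> y3 != 0 -> qL != 0 ->
    h ^+ 2 = x * y1 * y2 * y3 / qL -> (m0 + (m1 + m2 + m3) = e.*2)%N ->
    (m1 + m2 + m3 <= D)%N ->
  h ^+ m0 * (x * y1 / h) ^+ m1 * (x * y2 / h) ^+ m2 * (x * y3 / h) ^+ m3
    * (x * y1 * y2 * y3) ^+ D =
  qL ^+ (m1 + m2 + m3) / qL ^+ e *
    (x ^+ (e + D) * y1 ^+ (e + D - (m1 + m2 + m3) + m1)
     * y2 ^+ (e + D - (m1 + m2 + m3) + m2) * y3 ^+ (e + D - (m1 + m2 + m3) + m3)).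
Proof.
move=> x0 y10 y20 y30 q0 h2 me SD; have h0 := hat_param_neq0.
set S := (m1 + m2 + m3)%N in me SD *; pose d := (D - S)%N.
have DE : D = (d + S)%N by rewrite subnK.
have -> : (e + D - S = e + d)%N by lia.
have hpow : h ^+ m0 * h ^+ S = (x * y1 * y2 * y3) ^+ e / qL ^+ e.
  by rewrite -exprD me -mul2n exprM h2 exprMn exprVn.
have hS0 : h ^+ S != 0 by rewrite expf_neq0.
have qe0 : qL ^+ e != 0 by rewrite expf_neq0.
have -> : h ^+ m0 = (x * y1 * y2 * y3) ^+ e / qL ^+ e / h ^+ S.
  by rewrite -hpow mulfK.
have ratios : (x * y1 / h) ^+ m1 * (x * y2 / h) ^+ m2 * (x * y3 / h) ^+ m3
    = x ^+ S * y1 ^+ m1 * y2 ^+ m2 * y3 ^+ m3 / h ^+ S.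
  rewrite !exprMn !exprVn /S !exprD; field.
  by rewrite !expf_neq0.
have -> : (x * y1 * y2 * y3) ^+ D =
    (x * y1 * y2 * y3) ^+ d * (qL ^+ S * (h ^+ S * h ^+ S)).
  have -> : x * y1 * y2 * y3 = qL * (h * h) by rewrite -expr2 h2 [RHS]mulrC divfK.
  by rewrite DE exprD -!exprMn.
have alg (u a b c v : L) : u * a * b * c * v = u * (a * b * c) * v by rewrite !mulrA.
rewrite alg ratios DE; clearbody d; clearbody S.
rewrite !exprD !exprMn.
by field; rewrite hS0 qe0.
Qed.

Definition hat_eval : K -> L := mmap embL (fun i : 'I_4 => hatpar iota h i).
HB.instance Definition _ := GRing.RMorphism.on hat_eval.

Lemma hat_evalC c : hat_eval c%:MP = embL c.
Proof. exact: mmapC. Qed.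

Lemma hat_evalX i : hat_eval 'X_i = hatpar iota h i.
Proof. by rewrite /hat_eval mmapX mmap1U. Qed.

(** The product of [p] and [p(-X)] has only monomials of even total degree, whose
    substitutions involve even powers of [h] alone. After clearing denominators
    these are distinct monomials in the original parameters. *)
Lemma hat_independent (p : K) : p != 0 -> hat_eval p != 0.
Proof.
move=> p0; apply/eqP => hp0.
have h0 := hat_param_neq0.
pose N := p * negate p.
have N0 : N != 0.
  rewrite mulf_neq0 //; apply: contraNneq p0 => np.
  by rewrite -[p]negateK np rmorph0.
have Neven m : m \in msupp N -> ~~ odd (mdeg m).
  rewrite mcoeff_msupp; apply: contraNN => odd_m.
  have := mcoeff_negate N m; rewrite {1}/N rmorphM /= negateK mulrC -/N.
  rewrite -signr_odd odd_m expr1 mulN1r => /eqP.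
  rewrite -subr_eq0 opprK -mulr2n -mulr_natl mulf_eq0 => /orP[|//].
  by rewrite ((pcharf0P _).1 pchar_Fqt).
have hN0 : hat_eval N = 0.
  by rewrite /N rmorphM /= hp0 mul0r.
pose D := msize N.
pose S' (m : 'X_{1..4}) := (m i1 + m i2 + m i3)%N.
pose half (m : 'X_{1..4}) := ((mdeg m)./2)%N.
pose b (m : 'X_{1..4}) : 'X_{1..4} :=
  [multinom (if i == i0 then half m + D else half m + D - S' m + m i)%N | i < 4].
have degE m : mdeg m = (m i0 + S' m)%N by rewrite mdegE sum4 /S' !addnA.
have SD m : m \in msupp N -> (S' m <= D)%N.
  move=> /msize_mdeg_lt; rewrite degE -/D; lia.
have evenE m : m \in msupp N -> mdeg m = (half m).*2.
  by move=> /Neven nodd; rewrite -[LHS]odd_double_half (negPf nodd).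
have i01 : i1 != i0 by rewrite -val_eqE /= !inordK.
have i02 : i2 != i0 by rewrite -val_eqE /= !inordK.
have i03 : i3 != i0 by rewrite -val_eqE /= !inordK.
have b_inj m m' : m \in msupp N -> m' \in msupp N -> b m = b m' -> m = m'.
  move=> mN mN' /mnmP bb.
  have := bb i0; have := bb i1; have := bb i2; have := bb i3.
  rewrite !mnmE eqxx (negPf i01) (negPf i02) (negPf i03) => e3 e2 e1 e0.
  have all4 : [/\ m i0 = m' i0, m i1 = m' i1, m i2 = m' i2 & m i3 = m' i3].
    apply: (hat_exponents_inj _ _ (SD _ mN) (SD _ mN') e0 e1 e2 e3).
      by rewrite -[RHS]evenE // degE.
    by rewrite -[RHS]evenE // degE.
  case: all4 => f0 f1 f2 f3; apply/mnmP => i.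
  have : (i == i0) || (i == i1) || (i == i2) || (i == i3).
    by case: i => [[|[|[|[|]]]]] //= ?; rewrite -!val_eqE /= !inordK.
  by move=> /orP[/orP[/orP[]|]|] /eqP ->.
pose x := iota (tpar 0) : L; pose y1 := iota (tpar 1) : L.
pose y2 := iota (tpar 2) : L; pose y3 := iota (tpar 3) : L.
pose qL := iota (cst 4 qF) : L.
have qL0 : qL != 0 by rewrite fmorph_eq0; exact: cst_neq0 qF_neq0.
have tpar0 i : iota (tpar i) != 0 by rewrite fmorph_eq0; exact: var_neq0.
have x0 : x != 0 := tpar0 0%N; have y10 : y1 != 0 := tpar0 1%N.
have y20 : y2 != 0 := tpar0 2%N; have y30 : y3 != 0 := tpar0 3%N.
have h2 : h ^+ 2 = x * y1 * y2 * y3 / qL.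
  rewrite hh; exact: (morph_ratio4 iota (tpar 0) (tpar 1) (tpar 2) (tpar 3) (cst 4 qF)).
pose T := x * y1 * y2 * y3.
have T0 : T != 0 by rewrite !mulf_neq0.
pose w m : Fqt := qF ^+ S' m / qF ^+ half m.
have term m : m \in msupp N ->
    \prod_(i < 4) hatpar iota h i ^+ m i * T ^+ D
    = embL (w m) * iota (tofrac 'X_[b m]).
  move=> mN; rewrite prod4 /hatpar !inordK //= -/(par iota 0) -/(par iota 1) -/(par iota 2) -/(par iota 3).
  have XE : iota (tofrac 'X_[b m]) = x ^+ (b m) i0 * y1 ^+ (b m) i1 * y2 ^+ (b m) i2 * y3 ^+ (b m) i3.
    rewrite mpolyXE_id rmorph_prod rmorph_prod prod4.
    by rewrite !rmorphXn.
  rewrite XE !mnmE eqxx (negPf i01) (negPf i02) (negPf i03).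
  have -> : iota (tofrac (w m)%:MP) = qL ^+ S' m / qL ^+ half m.
    by rewrite -[LHS]/(embL (w m)) /w fmorph_div !rmorphXn.
  have := evenE _ mN; rewrite degE => me.
  exact: (hat_monomial x0 y10 y20 y30 qL0 h2 me (SD _ mN)).
pose G : K := \sum_(m <- msupp N) (N@_m * w m) *: 'X_[b m].
have G0 : G = 0.
  apply/eqP; rewrite -tofrac_eq0 -(fmorph_eq0 iota); apply/eqP.
  rewrite -[RHS](mul0r (T ^+ D)) -hN0 /hat_eval /mmap mulr_suml.
  rewrite !rmorph_sum big_seq [RHS]big_seq; apply: eq_bigr => m mN.
  rewrite -mulrA [mmap1 _ _ * _]term // mulrA -rmorphM /=.
  by rewrite -mul_mpolyC tofracM rmorphM.
have [m mN] : exists m, m \in msupp N.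
  case E : (msupp N) => [|m r]; last by exists m; rewrite mem_head.
  by move/msuppnil0: E N0 => ->; rewrite eqxx.
have := congr1 (mcoeff (b m)) G0; rewrite mcoeff0 /G raddf_sum /=.
rewrite (bigD1_seq m) ?msupp_uniq //= mcoeffZ mcoeffX eqxx mulr1.
rewrite big_seq_cond big1 ?addr0 => [/eqP|m' /andP[m'N ne]]; last first.
  rewrite mcoeffZ mcoeffX; case: eqP => [/b_inj e|_]; last by rewrite mulr0.
  by rewrite e ?eqxx in ne.
rewrite mulf_eq0 => /orP[|]; first by move: mN; rewrite mcoeff_msupp => /negPf ->.
by rewrite /w mulf_eq0 invr_eq0 !expf_eq0 (negPf qF_neq0) !andbF.
Qed.

End HattedParameters.

Section OneVariable.

(** Embeds polynomials in one parameter into those in four: [t_0] and [h] are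
    transcendental as first members of algebraically independent quadruples. *)
Definition first_var : {mpoly Fqt[1]} -> {mpoly Fqt[4]} :=
  mmap (@mpolyC 4 Fqt) (fun _ => 'X_(inord 0)).
HB.instance Definition _ := GRing.RMorphism.on first_var.

Lemma first_var_neq0 p : p != 0 -> first_var p != 0.
Proof.
pose r := mmap (@mpolyC 1 Fqt) (fun _ : 'I_4 => 'X_ord0).
have rK : r (first_var p) = p.
  rewrite -[LHS]/((r \o first_var) p).
  rewrite -[RHS]/((GRing.RMorphism.clone _ _ idfun _) p).
  apply: mpoly_morph_ext => [c|i] /=; first by rewrite /first_var mmapC /r mmapC.
  by rewrite /first_var mmapX mmap1U /r mmapX mmap1U (ord1 i).
by apply: contraNneq => p0; rewrite -rK p0 /r rmorph0.
Qed.

Lemma first_var_mmap (E : fieldType) (f : {rmorphism {mpoly Fqt[4]} -> E})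
    (phi : {rmorphism Fqt -> E}) (a : E) p :
    (forall c, f c%:MP = phi c) -> f 'X_(inord 0) = a ->
  mmap phi (fun _ : 'I_1 => a) p = f (first_var p).
Proof.
move=> fc fa; rewrite -[RHS]/((f \o first_var) p).
apply: mpoly_morph_ext => [c|i] /=; first by rewrite /first_var !mmapC fc.
by rewrite /first_var !mmapX !mmap1U fa.
Qed.

End OneVariable.

(** * The normalizing factor *)

Section CSymbolLemmas.
Variables (n : nat).
Implicit Types (lam : part n).

Lemma C_morph (E E' : fieldType) (f : {rmorphism E -> E'}) (q t x : E) lam :
  [/\ f (C0 q t lam x) = C0 (f q) (f t) lam (f x),
      f (Cminus q t lam x) = Cminus (f q) (f t) lam (f x)
    & f (Cplus q t lam x) = Cplus (f q) (f t) lam (f x)].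
Proof.
split; rewrite rmorph_prod; apply: eq_bigr => i _; rewrite rmorph_prod;
by apply: eq_bigr => j _ /=; rewrite rmorphB rmorph1 !rmorphM /= !fmorphXz.
Qed.

Lemma k0_morph (E E' : fieldType) (f : {rmorphism E -> E'}) (q t T t0 t1 t2 t3 : E) lam :
  f (k0 q t T t0 t1 t2 t3 lam) = k0 (f q) (f t) (f T) (f t0) (f t1) (f t2) (f t3) lam.
Proof.
have C0E x : f (C0 q t lam x) = C0 (f q) (f t) lam (f x) by case: (C_morph f q t x lam).
have CmE x : f (Cminus q t lam x) = Cminus (f q) (f t) lam (f x).
  by case: (C_morph f q t x lam).
have CpE x : f (Cplus q t lam x) = Cplus (f q) (f t) lam (f x).
  by case: (C_morph f q t x lam).
rewrite /k0 fmorph_div !rmorphM /= fmorphXz !C0E CmE CpE rmorphXn.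
by rewrite !(fmorphV, rmorphM, rmorphXn).
Qed.

Lemma pcol_conjugate lam j : pcol lam j.+1 = conjugate n (rows lam) j.
Proof.
rewrite /pcol -sum1_count big_tuple /conjugate big_mkcond /=.
by apply: eq_bigr => i _; rewrite rowsE; case: ltnP.
Qed.

Lemma Cplus_hook (E : fieldType) (q t x : E) lam : q != 0 -> t != 0 ->
  Cplus q t lam ((t ^+ n) ^+ 2 * x / t ^+ 2) = hook_product q t n (rows lam) x.
Proof.
move=> q0 t0; rewrite /Cplus /hook_product big_add1 /= big_mkord.
apply: eq_bigr => i _; rewrite -/(rows lam i) big_add1 /= big_mkord.
apply: eq_bigr => j _; rewrite pcol_conjugate; congr (1 - _).
have -> : ((rows lam i)%:Z + j.+1%:Z - 1) = (rows lam i + j)%N%:Z by lia.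
set z1 := (2 - _ - _); set m := ((n + n).-1 - i - _)%N.
have tz : t ^ z1 * (t ^ (2 * n%:Z) * t ^ (-2)) = t ^+ m.
  rewrite -!expfzDr // exprnP; congr (_ ^ _); rewrite /z1 /m.
  have := conjugate_le n (rows lam) j; have := ltn_ord i; lia.
have tt : (t ^+ n) ^+ 2 * x / t ^+ 2 = x * (t ^ (2 * n%:Z) * t ^ (-2)).
  by rewrite -exprM mulnC -exprnN -exprnP mulrAC mulrC.
by rewrite tt -tz -exprnP mulrCA -!mulrA.
Qed.

Lemma C_factor_neq0 (E : fieldType) (F : int -> int -> E) lam :
    (forall i j : nat, (1 <= i <= n)%N -> (1 <= j <= rows lam i.-1)%N ->
       F i j != 0) ->
  \prod_(1 <= i < n.+1) \prod_(1 <= j < (prow lam i).+1) F i%:Z j%:Z != 0.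
Proof.
move=> h; rewrite prodf_seq_neq0; apply/allP => i; rewrite mem_index_iota ltnS => iP.
rewrite prodf_seq_neq0; apply/allP => j; rewrite mem_index_iota ltnS => jP /=.
apply: h => //; rewrite /rows prednK //; by case/andP: iP.
Qed.

End CSymbolLemmas.

Section NonvanishingK0.

Lemma mon_shift (E : fieldType) (q t x : E) (n : nat) a b : t != 0 ->
  q ^ a * t ^ b * (t ^+ n * x / t) = mon q t a (b + n%:Z - 1) * x.
Proof.
move=> t0; rewrite /mon !expfzDr // -exprnP -invr_expz expr1z.
move: (q ^ a) (t ^ b) (t ^+ n) t^-1 => A B N M; ring.
Qed.

Lemma mon_shift2 (E : fieldType) (q t x y z w : E) (n : nat) a b : q != 0 -> t != 0 ->
  q ^ a * t ^ b * ((t ^+ n) ^+ 2 * x * y * z * w / (q * t ^+ 2)) =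
  mon q t (a - 1) (b + n%:Z + n%:Z - 2) * (x * y * z * w).
Proof.
move=> q0 t0; rewrite /mon !expfzDr // -!exprnP -!invr_expz expr1z.
rewrite -exprnP expr2 invfM.
move: (q ^ a) (t ^ b) (t ^+ n) (t ^+ 2) => A B N M; ring.
Qed.

Lemma one_sub_tpar_neq0 (e : nat -> int) c : e 0%N = 1 ->
  1 - cst 4 c * (tpar 0 ^ e 0%N * tpar 1 ^ e 1%N * tpar 2 ^ e 2%N * tpar 3 ^ e 3%N) != 0.
Proof.
move=> e0; rewrite subr_eq0 eq_sym; apply/eqP; rewrite -tpar_prod.
by move=> /ratfun_monomial /(_ (inord 0)); rewrite inordK // e0.
Qed.

Lemma one_sub_pair_neq0 c k : k \in [:: 1; 2; 3]%N ->
  1 - cst 4 c * (tpar 0 * tpar k) != 0.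
Proof.
move=> k123.
have := @one_sub_tpar_neq0 (fun i => if (i == 0%N) || (i == k) then 1 else 0) c erefl.
suff -> : tpar 0 * tpar k = tpar 0 ^ (if (0 == 0)%N || (0 == k)%N then 1 else 0)
  * tpar 1 ^ (if (1 == 0)%N || (1 == k)%N then 1 else 0)
  * tpar 2 ^ (if (2 == 0)%N || (2 == k)%N then 1 else 0)
  * tpar 3 ^ (if (3 == 0)%N || (3 == k)%N then 1 else 0) by [].
move: k123; rewrite !inE => /or3P[] /eqP -> /=;
by rewrite !expr0z !expr1z !mulr1.
Qed.

Lemma mon_one_sub_neq0 a b : b != 0 ->
  1 - mon (cst 4 qF) (cst 4 tF) a b != 0.
Proof.
move=> b0; rewrite subr_eq0 eq_sym; apply/eqP => /mon_ratfun[_ bz].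
by rewrite bz eqxx in b0.
Qed.

Lemma conjugate_ge n mu i j : nonincr n mu -> (i <= n)%N -> (1 <= i)%N ->
  (j < mu i.-1)%N -> (i <= conjugate n mu j)%N.
Proof.
move=> pmu iN i1 jmu.
have -> : i = (\sum_(k < n | (k < i)%N) 1)%N.
  by rewrite (big_ord_narrow iN) sum1_card card_ord.
rewrite big_mkcond; apply: leq_sum => k _; case: ifP => // ki.
suff -> : (j < mu k)%N by [].
by apply: leq_trans jmu _; apply: pmu; lia.
Qed.

Variable n : nat.

(** Every factor of the C-symbols is [1] minus a monomial in [q], [t] and the [t_i]
    that is not trivial. In [Cminus] and in the first [C0] the power of [t] is what
    tells it from [1]; in the others it is the occurrence of [t_0]. *)
Lemma k0_neq0 (lam : part n) :
  k0 (cst 4 qF) (cst 4 tF) (cst 4 tF ^+ n) (tpar 0) (tpar 1) (tpar 2) (tpar 3) lam != 0.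
Proof.
have q0 : cst 4 qF != 0 := cst_neq0 4 qF_neq0.
have t0 : cst 4 tF != 0 := cst_neq0 4 tF_neq0.
have v0 i : tpar i != 0 by exact: var_neq0.
have C0pair k : k \in [:: 1; 2; 3]%N ->
    C0 (cst 4 qF) (cst 4 tF) lam (cst 4 tF ^+ n * tpar 0 * tpar k / cst 4 tF) != 0.
  move=> k123; apply: (C_factor_neq0 (F := fun i j =>
    1 - cst 4 qF ^ (j - 1) * cst 4 tF ^ (1 - i)
      * (cst 4 tF ^+ n * tpar 0 * tpar k / cst 4 tF))) => i j _ _.
  by rewrite -[cst 4 tF ^+ n * _ * _]mulrA (mon_shift _ _ _ _ _ t0) cst_mon one_sub_pair_neq0.
have C01 : C0 (cst 4 qF) (cst 4 tF) lam (cst 4 tF ^+ n) != 0.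
  apply: (C_factor_neq0 (F := fun i j =>
    1 - cst 4 qF ^ (j - 1) * cst 4 tF ^ (1 - i) * cst 4 tF ^+ n)) => i j iP _.
  have -> : cst 4 qF ^ (j%:Z - 1) * cst 4 tF ^ (1 - i%:Z) * cst 4 tF ^+ n =
      mon (cst 4 qF) (cst 4 tF) (j%:Z - 1) (1 - i%:Z + n%:Z).
    by rewrite /mon [_ ^ (1 - i%:Z + n%:Z)]expfzDr // mulrA.
  by apply: mon_one_sub_neq0; lia.
have Cm : Cminus (cst 4 qF) (cst 4 tF) lam (cst 4 tF) != 0.
  rewrite /Cminus prodf_seq_neq0; apply/allP => i; rewrite mem_index_iota ltnS => iP.
  rewrite prodf_seq_neq0; apply/allP => j; rewrite mem_index_iota ltnS => jP /=.
  have -> : cst 4 qF ^ ((prow lam i)%:Z - j%:Z) * cst 4 tF ^ ((pcol lam j)%:Z - i%:Z) * cst 4 tF =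
      mon (cst 4 qF) (cst 4 tF) ((prow lam i)%:Z - j%:Z) ((pcol lam j)%:Z - i%:Z + 1).
    by rewrite /mon [_ ^ (_ + 1)]expfzDr // expr1z mulrA.
  apply: mon_one_sub_neq0; case: j jP => // j jP.
  have := @conjugate_ge n (rows lam) i j (rows_nonincr lam); rewrite -pcol_conjugate.
  by rewrite /rows prednK; lia.
have Cp : Cplus (cst 4 qF) (cst 4 tF) lam
    ((cst 4 tF ^+ n) ^+ 2 * tpar 0 * tpar 1 * tpar 2 * tpar 3 / (cst 4 qF * cst 4 tF ^+ 2)) != 0.
  rewrite /Cplus prodf_seq_neq0; apply/allP => i _.
  rewrite prodf_seq_neq0; apply/allP => j _ /=.
  rewrite (mon_shift2 _ _ _ _ _ _ _ q0 t0) cst_mon.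
  have := one_sub_tpar_neq0 (mon qF tF ((prow lam i)%:Z + j%:Z - 1 - 1)
    (2 - (pcol lam j)%:Z - i%:Z + n%:Z + n%:Z - 2)) (erefl ((fun=> 1) 0%N : int)).
  by rewrite /= 4!expr1z.
have C3 := mulf_neq0 (mulf_neq0 (mulf_neq0 C01 (C0pair 1%N isT)) (C0pair 2%N isT)) (C0pair 3%N isT).
have base : tpar 0 * cst 4 tF ^+ n / cst 4 tF != 0.
  exact: (mulf_neq0 (mulf_neq0 (v0 _) (expf_neq0 _ t0)) (invr_neq0 t0)).
exact: (mulf_neq0 (mulf_neq0 (mulf_neq0 (expfz_neq0 _ base) (expf_neq0 _ t0)) C3)
  (invr_neq0 (mulf_neq0 Cm Cp))).
Qed.

End NonvanishingK0.

Section HatInvariance.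
Variables (n : nat) (L : fieldType) (q t h x0 x1 x2 x3 : L) (lam : part n).
Hypotheses (q0 : q != 0) (t0 : t != 0) (h0 : h != 0) (x00 : x0 != 0).
Hypothesis hh : h ^+ 2 = x0 * x1 * x2 * x3 / q.

(** The parameters enter [k0] through the products [x0 * xi], which are
    invariant, through a power of [x0], which cancels against that of [a], and
    through the argument of [Cplus], a power of [t] times [h ^+ 2]. Thus [Cplus] on
    each side is the hook product of [a] on the other side. *)
Lemma k0_hat_ratio (c : L) (a : L -> L) :
    (forall s, a s = c * s^-1 ^+ psize lam * hook_product q t n (rows lam) (s / s^-1)) ->
  a x0 / k0 q t (t ^+ n) x0 x1 x2 x3 lam =
  a h / k0 q t (t ^+ n) h (x0 * x1 / h) (x0 * x2 / h) (x0 * x3 / h) lam.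
Proof.
move=> aE; rewrite !aE /k0.
have pairE y : t ^+ n * h * (x0 * y / h) / t = t ^+ n * x0 * y / t.
  by field; rewrite t0 h0.
have argE : (t ^+ n) ^+ 2 * x0 * x1 * x2 * x3 / (q * t ^+ 2)
    = (t ^+ n) ^+ 2 * h ^+ 2 / t ^+ 2.
  by rewrite hh; field; rewrite q0 t0.
have argE' : (t ^+ n) ^+ 2 * h * (x0 * x1 / h) * (x0 * x2 / h) * (x0 * x3 / h) / (q * t ^+ 2)
    = (t ^+ n) ^+ 2 * x0 ^+ 2 / t ^+ 2.
  have -> : (t ^+ n) ^+ 2 * h * (x0 * x1 / h) * (x0 * x2 / h) * (x0 * x3 / h) / (q * t ^+ 2)
     = (t ^+ n) ^+ 2 * x0 ^+ 2 / t ^+ 2 * ((x0 * x1 * x2 * x3 / q) / h ^+ 2).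
    by field; rewrite q0 t0 h0.
  by rewrite -hh mulfV ?mulr1 // expf_neq0.
rewrite !pairE argE argE' !Cplus_hook // !invrK -!expr2.
move: (hook_product _ _ _ _ (x0 ^+ 2)) (hook_product _ _ _ _ (h ^+ 2)) => H0 Hh.
move: (Cminus _ _ _ _) (C0 _ _ _ _ * _ * _ * _) (t ^+ nstat lam) => Cm A tn.
have powE s : s != 0 -> s^-1 ^+ psize lam / (s * t ^+ n / t) ^ (- (psize lam)%:Z)
    = (t ^+ n / t) ^+ psize lam.
  move=> s0; rewrite -exprnN invrK -exprMn; congr (_ ^+ _); field.
  by rewrite t0 s0.
have split s H K : c * s^-1 ^+ psize lam * H /
    ((s * t ^+ n / t) ^ (- (psize lam)%:Z) * tn * A / (Cm * K)) =
    (s^-1 ^+ psize lam / (s * t ^+ n / t) ^ (- (psize lam)%:Z)) * (c * (H * K) * Cm / (tn * A)).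
  rewrite !invfM !invrK.
  move: (s^-1 ^+ _) ((_ ^ _)^-1) tn^-1 A^-1 => a1 a2 a3 a4; ring.
by rewrite !split !powE // [H0 * _]mulrC.
Qed.

End HatInvariance.

(** * Binomial coefficients as rational functions *)

Section MapVanishing.
Variables (n : nat) (E E' : fieldType) (f : {rmorphism E -> E'}).

Lemma map_meval (p : {mpoly E[n]}) v :
  (map_mpoly f p).@[fun i => f (v i)] = f p.@[v].
Proof.
rewrite -[LHS]/((meval (fun i => f (v i)) \o map_mpoly f) p).
rewrite -[RHS]/((f \o meval v) p).
apply: mpoly_morph_ext => [c|i] /=; first by rewrite map_mpolyC ?mevalC ?raddf0.
by rewrite map_mpolyX !mevalXU.
Qed.

Lemma map_spectral q t al be mu (i : 'I_n) :
  spectral (f q) (f t) (f al) (f be) mu i = f (spectral q t al be mu i).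
Proof.
by rewrite /spectral /joukowski /node rmorphD fmorph_div !rmorphM !rmorphXn.
Qed.

Lemma map_value q t al be mu (p : {mpoly E[n]}) :
  (map_mpoly f p).@[spectral (f q) (f t) (f al) (f be) mu]
  = f p.@[spectral q t al be mu].
Proof.
by rewrite -map_meval; apply: meval_eq => i; rewrite map_spectral.
Qed.

Lemma map_value_eq q t al be al' be' mu (p : {mpoly E[n]}) :
    f al = al' -> f be = be' ->
  f p.@[spectral q t al be mu] =
  (map_mpoly f p).@[spectral (f q) (f t) al' be' mu].
Proof. by move=> <- <-; rewrite map_value. Qed.

Lemma map_vanishing_below q t al be mu (p : {mpoly E[n]}) :
  vanishing_below q t al be mu p ->
  vanishing_below (f q) (f t) (f al) (f be) mu (map_mpoly f p).
Proof.
move=> [sp wp vp]; split=> [|k kn|nu pnu dnu df].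
- apply/issymP => s; apply/mpolyP => m.
  by rewrite mcoeff_sym !mcoeff_map_mpoly -mcoeff_sym (issymP _ sp).
- apply/wleP => m; rewrite (perm_mem (msupp_map_mpoly p (fmorph_inj f))).
  exact: (wleP _ _ _ (wp k kn)).
by rewrite map_value vp // rmorph0.
Qed.

End MapVanishing.

Section ModelBinomial.
Variable n : nat.
Implicit Types lam mu nu : part n.

Definition is_model nu (f : {mpoly FT[n]}) :=
  vanishing_below (cst 4 qF) (cst 4 tF) Sparam 1 (rows nu) f /\
  f@_(exponent n (rows nu)) = 1.

Definition model nu : {mpoly FT[n]} := epsilon (inhabits 0) (is_model nu).

Lemma modelP nu : is_model nu (model nu).
Proof.
apply: epsilon_spec.
have char0 := pchar_ratfun 4.
have [c hc] := interpolation_exists char0 generic_FT nu.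
by exists (orbit_poly FT nu + lower_comb nu c); apply: interpolation_below.
Qed.

(** The binomial coefficient as a rational function of
    [t_0 t_1 t_2 t_3 / q] alone. *)
Definition model_binom lam nu : FT :=
  (model nu).@[spectral (cst 4 qF) (cst 4 tF) Sparam 1 (rows lam)]
  / (model nu).@[spectral (cst 4 qF) (cst 4 tF) Sparam 1 (rows nu)].

Lemma model_binom_morph (L : fieldType) (psi : {rmorphism FT -> L}) (a : L)
    (f : {mpoly L[n]}) lam nu :
    generic (psi (cst 4 qF)) (psi (cst 4 tF)) a a^-1 -> psi Sparam = a * a ->
    vanishing_below (psi (cst 4 qF)) (psi (cst 4 tF)) a a^-1 (rows nu) f ->
    f@_(exponent n (rows nu)) = 1 ->
  psi (model_binom lam nu) =
  f.@[spectral (psi (cst 4 qF)) (psi (cst 4 tF)) a a^-1 (rows lam)]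
  / f.@[spectral (psi (cst 4 qF)) (psi (cst 4 tF)) a a^-1 (rows nu)].
Proof.
move=> gen aS vf f1; have [vm m1] := modelP nu.
have char0 : [pchar L] =i pred0 by move=> p; rewrite (fmorph_pchar psi) pchar_ratfun.
have a0 := generic_al gen.
have aV : a * a^-1 = psi 1 by rewrite rmorph1 mulfV.
have valE (ka : part n) : psi (model nu).@[spectral (cst 4 qF) (cst 4 tF) Sparam 1 (rows ka)] =
    (map_mpoly psi (model nu)).@[spectral (psi (cst 4 qF)) (psi (cst 4 tF)) (a * a) (a * a^-1)
      (rows ka)].
  exact: (@map_value_eq n _ _ psi _ _ _ _ _ _ _ _ aS (esym aV)).
rewrite /model_binom [LHS]fmorph_div (valE lam) (valE nu).
apply/esym; apply: (value_ratio_scale (k := a)) => //.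
- by rewrite aV -aS; apply: generic_morph generic_FT.
- by rewrite aV -aS; apply: map_vanishing_below.
by rewrite mcoeff_map_mpoly m1; exact: rmorph1.
Qed.

End ModelBinomial.

From mathcomp.multinomials Require Import monalg.

(** * Interpolation by Laurent polynomials *)

Section EvaluateOrbitSums.
Variables (n : nat) (E : fieldType).
Hypothesis char0 : [pchar E] =i pred0.

Lemma leval_msym (lam : part n) (x : 'I_n -> E) : (forall i, x i != 0) ->
  leval (Defs.msym E lam) x = (orbit_poly E lam).@[fun i => x i + (x i)^-1].
Proof.
move=> x0; rewrite /orbit_poly mevalZ; apply: (mulfI (stab_neq0 char0 lam)).
rewrite mulrA mulfV ?stab_neq0 // mul1r.
pose mono (a : expo n) := \prod_(i < n) x i ^ a i.
have -> : leval (Defs.msym E lam) x = \sum_(a <- orbit (expo_of lam)) mono a.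
  rewrite -[LHS]/(mmap idfun mono _) /Defs.msym raddf_sum; apply: eq_bigr => a _ /=.
  by rewrite mmapU mul1r.
rewrite mulr_natl -orbit_sum -(pair_big xpredT xpredT (fun s e => mono (bcact (s, e) (expo_of lam)))) /=.
rewrite raddf_sum; apply: eq_bigr => s _ /=.
rewrite rmorph_prod /=.
transitivity (\sum_(e : {ffun 'I_n -> bool})
  \prod_(i < n) x i ^ ((-1) ^+ e i * (rows lam (s i))%:Z)).
  by apply: eq_bigr => e _; apply: eq_bigr => i _; rewrite !ffunE.
rewrite -(bigA_distr_bigA (fun i (b : bool) => x i ^ ((-1) ^+ b * (rows lam (s i))%:Z))).
apply: eq_bigr => i _; rewrite big_bool /= expr1 expr0 mul1r mulN1r in_var_eval.
by rewrite cheb_eval // addrC -exprnN.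
Qed.

End EvaluateOrbitSums.

Local Notation "p @_ a" := (monalg.mcoeff a p) : ring_scope.

Lemma mcoeff_sumU (K : choiceType) (G : zmodType) (d : {fset K}) (F : K -> G) b :
  (\sum_(a <- d) << F a *g a >>)@_b = if b \in d then F b else 0.
Proof.
rewrite raddf_sum /=; case: ifP => [bd|nbd].
  rewrite (big_fsetD1 b) //= mcoeffUU big1_fset ?addr0 // => a.
  by rewrite in_fsetD1 mcoeffU; case: eqP.
rewrite big1_fset // => a ad _; rewrite mcoeffU; case: eqP => // ab.
by rewrite -ab ad in nbd.
Qed.

Section LaurentOperations.
Variables (n : nat) (E E' : fieldType).
Implicit Types (p : laurent n E) (x : 'I_n -> E) (lam mu : part n).

Lemma leval_mmap p x : leval p x = monalg.mmap idfun (fun a : expo n => \prod_(i < n) x i ^ a i) p.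
Proof. by []. Qed.

Lemma levalD p1 p2 x : leval (p1 + p2) x = leval p1 x + leval p2 x.
Proof. by rewrite !leval_mmap raddfD. Qed.

Lemma leval0 x : leval (0 : laurent n E) x = 0.
Proof. by rewrite leval_mmap raddf0. Qed.

Lemma levalZ c p x : leval (c *: p) x = c * leval p x.
Proof.
rewrite !leval_mmap (monalg.mmapEw (monalg.msuppZ_le _ _)) mulr_sumr.
by apply: eq_bigr => a _; rewrite monalg.mcoeffZ mulrA.
Qed.

Lemma leval_sum (I : Type) (r : seq I) (P : pred I) (c : I -> E) (F : I -> laurent n E) x :
  leval (\sum_(i <- r | P i) c i *: F i) x = \sum_(i <- r | P i) c i * leval (F i) x.
Proof.
apply: (big_ind2 (fun p y => leval p x = y)); first exact: leval0.
  by move=> p1 y1 p2 y2 <- <-; rewrite levalD.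
by move=> i _; rewrite levalZ.
Qed.

Lemma mcoeff_lmap (f : {additive E -> E'}) p a : (lmap f p)@_a = f p@_a.
Proof.
rewrite /lmap (mcoeff_sumU _ (fun a => f p@_a)); case: ifPn => // nap.
by rewrite monalg.mcoeff_outdom // raddf0.
Qed.

Lemma eq_lmap (f g : E -> E') p : f =1 g -> lmap f p = lmap g p.
Proof. by move=> fg; apply: eq_bigr => a _; rewrite fg. Qed.

Lemma lmapD (f : {additive E -> E'}) p1 p2 : lmap f (p1 + p2) = lmap f p1 + lmap f p2.
Proof. by apply/malgP => a; rewrite monalg.mcoeffD !mcoeff_lmap monalg.mcoeffD raddfD. Qed.

Lemma lmap_sum (f : {rmorphism E -> E'}) (I : Type) (r : seq I) (P : pred I)
    (c : I -> E) (F : I -> laurent n E) :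
  lmap f (\sum_(i <- r | P i) c i *: F i) = \sum_(i <- r | P i) f (c i) *: lmap f (F i).
Proof.
apply/malgP => a; rewrite mcoeff_lmap !raddf_sum; apply: eq_bigr => i _ /=.
by rewrite !monalg.mcoeffZ mcoeff_lmap rmorphM.
Qed.

Lemma mcoeff_msym lam a : (msym E lam)@_a = (a \in orbit (expo_of lam))%:R.
Proof.
rewrite /msym raddf_sum /=.
have -> : \sum_(i <- orbit (expo_of lam)) (<< i >> : laurent n E)@_a =
    \sum_(i <- orbit (expo_of lam) | i == a) 1.
  by rewrite [RHS]big_mkcond; apply: eq_bigr => i _; rewrite mcoeffU; case: eqP.
rewrite big_const_seq iter_addr_0 -/(count_mem a _) count_uniq_mem //.
exact: undup_uniq.
Qed.

Lemma leval_lmap (f : {rmorphism E -> E'}) p x :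
  leval (lmap f p) (fun i => f (x i)) = f (leval p x).
Proof.
rewrite [leval p x]leval_mmap /monalg.mmap rmorph_sum /=.
have sub : (msupp (lmap f p) `<=` msupp p)%fset.
  apply/fsubsetP => a; rewrite -!monalg.mcoeff_neq0 mcoeff_lmap.
  by apply: contra_neq => ->; rewrite raddf0.
rewrite -[LHS]/(monalg.mmap idfun (fun a : expo n => \prod_(i < n) f (x i) ^ a i) _).
rewrite (monalg.mmapEw sub); apply: eq_bigr => a _ /=.
rewrite mcoeff_lmap rmorphM rmorph_prod; congr (_ * _).
by apply: eq_bigr => i _; rewrite fmorphXz.
Qed.

End LaurentOperations.

Lemma lmap_msym n (E E' : fieldType) (f : {rmorphism E -> E'}) (lam : part n) :
  lmap f (msym E lam) = msym E' lam.
Proof. by apply/malgP => a; rewrite mcoeff_lmap !mcoeff_msym /= rmorph_nat. Qed.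

Lemma lmap_comp n (E E' E'' : fieldType) (f : {rmorphism E -> E'})
    (g : {rmorphism E' -> E''}) (p : laurent n E) :
  lmap g (lmap f p) = lmap (g \o f) p.
Proof. by apply/malgP => a; rewrite !mcoeff_lmap. Qed.

Section LaurentSymmetry.
Variables (n : nat) (E : fieldType).
Implicit Types (p : laurent n E) (w : 'S_n * {ffun 'I_n -> bool}) (lam mu : part n).

Lemma mcoeff_lact w p a : (lact w p)@_(bcact w a) = p@_a.
Proof.
rewrite /lact raddf_sum /=.
have -> : \sum_(b <- msupp p) (<< p@_b *g bcact w b >> : laurent n E)@_(bcact w a)
    = \sum_(b <- msupp p) (<< p@_b *g b >> : laurent n E)@_a.
  by apply: eq_bigr => b _; rewrite !mcoeffU (inj_eq (@bcact_inj _ w)).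
by rewrite -raddf_sum -monalg.monalgE.
Qed.

Lemma bcact_surj w a : exists b, bcact w b = a.
Proof.
case: w => s e; exists [ffun i => (-1) ^+ e (s^-1%g i) * a (s^-1%g i)].
by apply/ffunP => i; rewrite !ffunE /= permK mulrA -expr2 sqrr_sign mul1r.
Qed.

Lemma bcsymP p : bcsym p <-> forall w a, p@_(bcact w a) = p@_a.
Proof.
split=> [sp w a|h w]; first by rewrite -{1}(sp w) mcoeff_lact.
apply/malgP => a; have [b <-] := bcact_surj w a.
by rewrite mcoeff_lact h.
Qed.

Lemma bcsym_lin (I : Type) (r : seq I) (P : pred I) (c : I -> E) (F : I -> laurent n E) :
  (forall i, P i -> bcsym (F i)) -> bcsym (\sum_(i <- r | P i) c i *: F i).
Proof.
move=> h; apply/bcsymP => w a; rewrite !raddf_sum; apply: eq_bigr => i Pi /=.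
by rewrite !monalg.mcoeffZ; congr (_ * _); apply: (bcsymP _).1; apply: h.
Qed.

Lemma bcsymD p1 p2 : bcsym p1 -> bcsym p2 -> bcsym (p1 + p2).
Proof.
move=> /bcsymP h1 /bcsymP h2; apply/bcsymP => w a.
by rewrite !monalg.mcoeffD h1 h2.
Qed.

Lemma bcsym_msym lam : bcsym (msym E lam).
Proof.
apply/bcsymP => w a; rewrite !mcoeff_msym; congr (nat_of_bool _)%:R.
have fwd w' b : b \in orbit (expo_of lam) -> bcact w' b \in orbit (expo_of lam).
  rewrite !mem_undup => /imageP[w0 _ ->]; have [h _ hE] := bcact_comp w'.
  by apply/imageP; exists (h w0).
apply/idP/idP; last exact: fwd.
case: w => s e; pose w' := ((s^-1)%g, [ffun i => e (s^-1%g i)]).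
move=> /(fwd w'); suff -> : bcact w' (bcact (s, e) a) = a by [].
apply/ffunP => i.
by rewrite !ffunE /= permKV mulrA -expr2 sqrr_sign mul1r.
Qed.

(** Lets sums that range over partitions below [lam] and below [mu] be compared. *)
Lemma big_parts_upto (V : nmodType) lam mu (P : pred (part n)) (F : part n -> V) :
    (forall nu, P nu -> domle nu lam) -> (forall nu, P nu -> domle nu mu) ->
  \sum_(nu <- parts_upto lam | P nu) F nu = \sum_(nu <- parts_upto mu | P nu) F nu.
Proof.
move=> Pl Pm; rewrite -big_filter -[RHS]big_filter; apply: perm_big.
apply: uniq_perm => [||nu]; rewrite ?filter_uniq ?uniq_parts_upto // !mem_filter.
by case Pnu: (P nu); rewrite //= !mem_parts_upto // ?Pl ?Pm.
Qed.

Definition lower lam p := exists c : part n -> E,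
  p = \sum_(mu <- parts_upto lam | domlt mu lam) c mu *: msym E mu.

Lemma lower0 lam : lower lam 0.
Proof. by exists (fun=> 0); rewrite big1 // => mu _; rewrite scale0r. Qed.

Lemma lowerD lam p1 p2 : lower lam p1 -> lower lam p2 -> lower lam (p1 + p2).
Proof.
move=> [c1 ->] [c2 ->]; exists (fun mu => c1 mu + c2 mu).
by rewrite -big_split; apply: eq_bigr => mu _; rewrite scalerDl.
Qed.

Lemma lowerZ lam a p : lower lam p -> lower lam (a *: p).
Proof.
move=> [c ->]; exists (fun mu => a * c mu).
by rewrite scaler_sumr; apply: eq_bigr => mu _; rewrite scalerA.
Qed.

Lemma triangular_lower mu lam p : domlt mu lam -> triangular mu p -> lower lam p.
Proof.
move=> mu_lam [c ->]; apply: lowerD.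
  exists (fun nu => (nu == mu)%:R); rewrite -big_filter.
  rewrite (bigD1_seq mu) /= ?eqxx ?scale1r ?filter_uniq ?uniq_parts_upto //.
    by rewrite big1 ?addr0 // => nu /negPf ->; rewrite scale0r.
  rewrite mem_filter mu_lam mem_parts_upto //.
  by case: (domlt_strict mu_lam).
have [le_mu _] := domlt_strict mu_lam.
have lt_trans nu : domlt nu mu -> domlt nu lam.
  move=> nu_mu; have [le nle] := domlt_strict nu_mu.
  apply/andP; split; last exact: domle_trans le le_mu.
  by apply: contraNneq nle => ->.
exists (fun nu => if domlt nu mu then c nu else 0).
rewrite (@big_parts_upto _ mu lam); last first.
- by move=> nu /lt_trans/domlt_strict[].
- by move=> nu /domlt_strict[].
rewrite big_mkcond [RHS]big_mkcond; apply: eq_bigr => nu _.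
case nu_mu: (domlt nu mu); first by rewrite lt_trans.
by rewrite scale0r if_same.
Qed.

Lemma triangular_comb lam (k : part n -> E) (F : part n -> laurent n E) :
    k lam = 1 -> (forall mu, triangular mu (F mu)) ->
  triangular lam (\sum_(mu <- parts_upto lam | contained mu lam) k mu *: F mu).
Proof.
move=> k1 tF; rewrite -big_filter (bigD1_seq lam) /=; last 2 first.
- by rewrite mem_filter contained_refl mem_parts_upto ?domle_refl.
- by rewrite filter_uniq ?uniq_parts_upto.
have : lower lam (\sum_(mu <- [seq mu <- parts_upto lam | contained mu lam] | mu != lam)
    k mu *: F mu).
  rewrite big_filter_cond; apply: big_ind; [exact: lower0|exact: lowerD|].
  move=> mu /andP[mu_lam ne]; apply/lowerZ/(@triangular_lower mu) => //.
  by rewrite /domlt ne contained_domle.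
have [c ->] := tF lam; rewrite k1 scale1r => low.
have : lower lam (\sum_(mu <- parts_upto lam | domlt mu lam) c mu *: msym E mu) by exists c.
move=> /lowerD/(_ low)[c' c'E]; exists c'.
by rewrite -addrA c'E.
Qed.

End LaurentSymmetry.

Lemma bcsym_lmap n (E E' : fieldType) (f : {rmorphism E -> E'}) (p : laurent n E) :
  bcsym p -> bcsym (lmap f p).
Proof.
by move=> /bcsymP h; apply/bcsymP => w a; rewrite !mcoeff_lmap h.
Qed.

Lemma lmap_comb n (E E' : fieldType) (f : {rmorphism E -> E'})
    (lam : part n) (c : part n -> E) :
  lmap f (msym E lam + \sum_(mu <- parts_upto lam | domlt mu lam) c mu *: msym E mu) =
  msym E' lam + \sum_(mu <- parts_upto lam | domlt mu lam) f (c mu) *: msym E' mu.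
Proof.
rewrite lmapD lmap_msym; congr (_ + _); rewrite lmap_sum.
by apply: eq_bigr => mu _; congr (_ *: _); apply: lmap_msym.
Qed.

Lemma triangular_lmap n (E E' : fieldType) (f : {rmorphism E -> E'})
    (lam : part n) (p : laurent n E) :
  triangular lam p -> triangular lam (lmap f p).
Proof.
by move=> [c ->]; exists (fun mu => f (c mu)); apply: lmap_comb.
Qed.


Section LaurentInterpolation.
Variables (n : nat) (E : fieldType) (q t s : E).
Hypothesis char0 : [pchar E] =i pred0.
Hypothesis gen : generic q t s s^-1.
Implicit Types (p : laurent n E) (lam mu : part n).

Definition laurent_interp lam p :=
  [/\ bcsym p, triangular lam p
    & forall mu, domlt mu lam -> leval p (spec q t s mu) = 0].

Lemma spec_neq0 mu (i : 'I_n) : spec q t s mu i != 0.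
Proof.
have q0 := generic_q gen; have t0 := generic_t gen; have s0 := generic_al gen.
by rewrite !mulf_neq0 ?expf_neq0.
Qed.

Lemma spec_spectral mu (i : 'I_n) :
  spec q t s mu i + (spec q t s mu i)^-1 = spectral q t s s^-1 (rows mu) i.
Proof. by rewrite /spec /spectral /joukowski /node /rows mulrC [(s * _)^-1]invfM. Qed.

Lemma leval_comb lam c x : (forall i, x i != 0) ->
  leval (msym E lam + \sum_(mu <- parts_upto lam | domlt mu lam) c mu *: msym E mu) x =
  (orbit_poly E lam + lower_comb lam c).@[fun i => x i + (x i)^-1].
Proof.
move=> x0; rewrite levalD leval_sum leval_msym // mevalD; congr (_ + _).
rewrite /lower_comb raddf_sum; apply: eq_bigr => mu _ /=.
by rewrite mevalZ leval_msym.
Qed.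

Lemma leval_comb_spec lam c nu :
  leval (msym E lam + \sum_(mu <- parts_upto lam | domlt mu lam) c mu *: msym E mu)
    (spec q t s nu) =
  (orbit_poly E lam + lower_comb lam c).@[spectral q t s s^-1 (rows nu)].
Proof.
rewrite leval_comb; last exact: spec_neq0.
by apply: meval_eq => i; rewrite spec_spectral.
Qed.

Lemma laurent_interp_exists lam : exists p, laurent_interp lam p.
Proof.
have [c hc] := interpolation_exists char0 gen lam.
exists (msym E lam + \sum_(mu <- parts_upto lam | domlt mu lam) c mu *: msym E mu).
split; first by apply: bcsymD; [|apply: bcsym_lin => mu _]; apply: bcsym_msym.
  by exists c.
by move=> mu mu_lam; rewrite leval_comb_spec hc.
Qed.

Lemma laurent_interp_poly lam p : laurent_interp lam p ->
  exists f, [/\ vanishing_below q t s s^-1 (rows lam) f,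
                mpoly.mcoeff (exponent n (rows lam)) f = 1
              & forall nu, leval p (spec q t s nu) =
                  f.@[spectral q t s s^-1 (rows nu)]].
Proof.
move=> [_ [c pE] vp]; exists (orbit_poly E lam + lower_comb lam c).
have val nu : leval p (spec q t s nu) =
    (orbit_poly E lam + lower_comb lam c).@[spectral q t s s^-1 (rows nu)].
  by rewrite pE leval_comb_spec.
have [|vb lead] := @interpolation_below n E q t char0 s s^-1 lam c.
  by move=> nu nu_lam; rewrite -val vp.
by split.
Qed.

Lemma leval_lmap_comb (E0 : fieldType) (f : {rmorphism E0 -> E}) lam c nu :
  leval (lmap f (msym E0 lam + \sum_(mu <- parts_upto lam | domlt mu lam) c mu *: msym E0 mu))
    (spec q t s nu) =
  (orbit_poly E lam + lower_comb lam (fun mu => f (c mu))).@[spectral q t s s^-1 (rows nu)].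
Proof. by rewrite lmap_comb (leval_comb_spec lam (fun mu => f (c mu))). Qed.

(** The difference of the two polynomials is a combination of lower orbit sums
    that vanishes at all partitions below [lam]. The coefficients may live in a
    smaller field than the values. *)
Lemma triangular_inj (E0 : fieldType) (f : {rmorphism E0 -> E}) lam (p p' : laurent n E0) :
    triangular lam p -> triangular lam p' ->
    (forall mu, domlt mu lam ->
       leval (lmap f p) (spec q t s mu) = leval (lmap f p') (spec q t s mu)) ->
  p = p'.
Proof.
move=> [c ->] [c' ->] same; congr (_ + _); apply: eq_bigr => mu mu_lam.
congr (_ *: _); apply: (fmorph_inj f); apply/eqP; rewrite -subr_eq0; apply/eqP.
apply: (lower_comb_vanishing char0 gen (c := fun mu => f (c mu) - f (c' mu)) _ mu_lam).
move=> nu nu_lam; have := etrans (etrans (esym (leval_lmap_comb f lam c nu)) (same nu nu_lam))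
  (leval_lmap_comb f lam c' nu).
rewrite !mevalD => /addrI h.
apply/eqP; move/eqP: h; rewrite -subr_eq0 => /eqP <-; rewrite -mevalB.
apply/eqP; congr (meval _ _); rewrite /lower_comb -sumrB.
by apply: eq_bigr => ka _; rewrite scalerBl.
Qed.

End LaurentInterpolation.

Lemma laurent_interp_lmap n (E E' : fieldType) (f : {rmorphism E -> E'}) q t s
    (lam : part n) (p : laurent n E) :
  laurent_interp q t s lam p -> laurent_interp (f q) (f t) (f s) lam (lmap f p).
Proof.
move=> [sp tp vp]; split; [exact: bcsym_lmap|exact: triangular_lmap|].
move=> mu mu_lam; rewrite -(rmorph0 f) -(vp mu mu_lam) -leval_lmap.
apply: eq_bigr => a _; congr (_ * _); apply: eq_bigr => i _.
by rewrite /spec !rmorphM !rmorphXn.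
Qed.

(** * Koornwinder polynomials *)

(** The choice operator in [interp] does find an interpolation polynomial. *)
Lemma interp_laurent_interp n (nu : part n) :
  laurent_interp (cst 1 qF) (cst 1 tF) sv nu (interp nu).
Proof.
have [p hp] := laurent_interp_exists (pchar_ratfun 1) generic_Fs nu.
exact: (epsilon_spec (inhabits 0) (is_interp nu) (ex_intro _ p hp)).
Qed.

Section Specialize.
Variables (n : nat) (E : fieldType) (phi : {rmorphism Fqt -> E}) (a : E).
Implicit Types nu mu lam : part n.
Hypothesis indep : forall p : mpoly.mpoly 1 Fqt, p != 0 -> mpoly.mmap phi (fun _ : 'I_1 => a) p != 0.

Lemma specialize_generic : generic (phi qF) (phi tF) a a^-1.
Proof.
have [A [_ Ac Av]] := rsubst_morph indep.
by have := generic_morph A generic_Fs; rewrite fmorphV !Ac Av.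
Qed.

Lemma specialize_pchar : [pchar E] =i pred0.
Proof. by move=> p; rewrite (fmorph_pchar phi) pchar_Fqt. Qed.

(** Substituting for [s] and then applying a field morphism is one substitution. *)
Lemma interp_at_lmap (F : fieldType) (psi : {rmorphism E -> F}) (b : F) nu
    (phi' : {rmorphism Fqt -> F}) :
    (forall p : mpoly.mpoly 1 Fqt, p != 0 -> mpoly.mmap phi' (fun _ : 'I_1 => b) p != 0) ->
    (forall c, psi (phi c) = phi' c) -> psi a = b ->
  lmap psi (interp_at phi a nu) = interp_at phi' b nu.
Proof.
move=> indep' psic psia.
have [A [AE Ac Av]] := rsubst_morph indep.
have [A' [AE' Ac' Av']] := rsubst_morph indep'.
rewrite /interp_at -(eq_lmap _ AE) -(eq_lmap _ AE') lmap_comp; apply: eq_lmap.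
by apply: ratfun_morph_ext => [c|i] /=; rewrite ?Ac ?Av ?Ac' ?Av' ?psic ?psia.
Qed.

Lemma interp_at_laurent_interp nu :
  laurent_interp (phi qF) (phi tF) a nu (interp_at phi a nu).
Proof.
have [A [AE Ac Av]] := rsubst_morph indep.
rewrite /interp_at -(eq_lmap _ AE).
have := laurent_interp_lmap A (interp_laurent_interp nu).
by rewrite !Ac Av.
Qed.

Lemma interp_val_poly nu : exists f : mpoly.mpoly n E,
  [/\ vanishing_below (phi qF) (phi tF) a a^-1 (rows nu) f,
      mpoly.mcoeff (exponent n (rows nu)) f = 1
    & forall mu, interp_val phi a nu mu =
        f.@[spectral (phi qF) (phi tF) a a^-1 (rows mu)]].
Proof.
exact: (laurent_interp_poly specialize_pchar specialize_generic
  (interp_at_laurent_interp nu)).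
Qed.

Lemma interp_val_neq0 nu : interp_val phi a nu nu != 0.
Proof.
have [f [vf f1 fE]] := interp_val_poly nu; rewrite fE.
exact: (below_value_neq0 specialize_generic vf f1).
Qed.

Lemma interp_val_eq0 nu mu : ~~ contained nu mu -> interp_val phi a nu mu = 0.
Proof.
have [f [vf f1 fE]] := interp_val_poly nu; rewrite fE.
exact: (below_extra_vanishing specialize_generic vf).
Qed.

Lemma interp_val_binom (psi : {rmorphism FT -> E}) lam nu :
    (forall c, psi (cst 4 c) = phi c) -> psi Sparam = a * a ->
  interp_val phi a nu lam / interp_val phi a nu nu = psi (model_binom lam nu).
Proof.
move=> psic psiS; have [f [vf f1 fE]] := interp_val_poly nu.
rewrite !fE -!psic; apply/esym; apply: model_binom_morph => //; rewrite !psic //.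
exact: specialize_generic.
Qed.

End Specialize.

Lemma swap_summand (E : fieldType) (a b d k l : E) : k != 0 -> d != 0 ->
  a * (k / l) * b / k = a * (b / d) * (d / l).
Proof.
move=> k0 d0; move: l^-1 => l'; field; by rewrite k0 d0.
Qed.

(** Hatting the square of [h] gives the square of [x0]. *)
Lemma hat_involution (E : fieldType) (h x0 x1 x2 x3 q : E) :
    h != 0 -> x0 != 0 -> q != 0 -> h ^+ 2 = x0 * x1 * x2 * x3 / q ->
  h * (x0 * x1 / h) * (x0 * x2 / h) * (x0 * x3 / h) / q = x0 * x0.
Proof.
move=> h0 x00 q0 hh.
transitivity (x0 * x0 * ((x0 * x1 * x2 * x3 / q) / h ^+ 2)).
  by field; rewrite q0 h0.
by rewrite -hh mulfV ?mulr1 // expf_neq0.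
Qed.

Lemma domlt_ind n (P : part n -> Prop) :
  (forall lam, (forall mu, domlt mu lam -> P mu) -> P lam) -> forall lam, P lam.
Proof.
move=> IH lam; have [d] := ubnP (dominance_weight lam).
elim: d lam => // d IHd lam; rewrite ltnS => lam_d; apply: IH => mu mu_lam.
apply: IHd; apply: leq_trans lam_d; exact: dominance_weight_lt.
Qed.

Section KoornwinderPolynomials.
Variables (n : nat) (L : fieldType) (iota : {rmorphism FT -> L}) (h : L).
Hypotheses (n_gt0 : (1 <= n)%N) (hh : h ^+ 2 = iota Sparam).
Implicit Types nu mu lam : part n.

Let phi : {rmorphism Fqt -> L} := embL iota.

Lemma indep_t0 p : p != 0 -> mpoly.mmap phi (fun _ : 'I_1 => par iota 0) p != 0.
Proof.
move=> p0.
rewrite (@first_var_mmap _ (iota \o (@FracField.tofrac _)) phi (par iota 0)) //.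
by rewrite /= fmorph_eq0 tofrac_eq0 first_var_neq0.
Qed.

Lemma indep_h p : p != 0 -> mpoly.mmap phi (fun _ : 'I_1 => h) p != 0.
Proof.
move=> p0; rewrite (@first_var_mmap _ (hat_eval iota h) phi h).
- by apply: hat_independent => //; apply: first_var_neq0.
- exact: hat_evalC.
by rewrite /= hat_evalX inordK.
Qed.

Lemma indep_FT p : p != 0 -> mpoly.mmap (cst_morph 4) (fun _ : 'I_1 => tpar 0) p != 0.
Proof.
move=> p0.
rewrite (@first_var_mmap _ (@FracField.tofrac _) (cst_morph 4) (tpar 0)) //.
by rewrite tofrac_eq0 first_var_neq0.
Qed.

(** Since [hat] is a field morphism, it carries the defining expansion of
    [koornwinder] to one over [L]. *)
Lemma hat_morph : exists H : {rmorphism FT -> L},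
  [/\ H =1 hat iota h, forall c, H (cst 4 c) = phi c
    & forall i, (i < 4)%N -> H (tpar i) = hatpar iota h i].
Proof.
have indep p : p != 0 -> mpoly.mmap phi (fun i : 'I_4 => hatpar iota h i) p != 0.
  by move=> p0; apply: (hat_independent hh p0).
have [H [HE Hc Hv]] := rsubst_morph indep.
by exists H; split=> // i i4; rewrite Hv inordK.
Qed.

Definition k0F lam : FT :=
  k0 (cst 4 qF) (cst 4 tF) (cst 4 tF ^+ n) (tpar 0) (tpar 1) (tpar 2) (tpar 3) lam.

(** With [model_binom] for the binomial coefficients, the coefficients lie in
    [FT] and do not mention [h]. *)
Definition koornwinder lam : laurent n FT :=
  \sum_(nu <- parts_upto lam | contained nu lam)
     (model_binom lam nu * (k0F lam / k0F nu)) *: interp_at (cst_morph 4) (tpar 0) nu.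

Lemma lmap_koornwinder (psi : {rmorphism FT -> L}) (b : L) lam :
    (forall c, psi (cst 4 c) = phi c) -> psi (tpar 0) = b ->
    (forall p, p != 0 -> mpoly.mmap phi (fun _ : 'I_1 => b) p != 0) ->
  lmap psi (koornwinder lam) =
  \sum_(nu <- parts_upto lam | contained nu lam)
    (psi (model_binom lam nu) * (psi (k0F lam) / psi (k0F nu)))
      *: interp_at phi b nu.
Proof.
move=> psic psib indep; rewrite /koornwinder lmap_sum; apply: eq_bigr => nu _.
rewrite rmorphM (fmorph_div _ (k0F lam)) (@interp_at_lmap _ _ _ _ indep_FT _ psi b nu phi) //.
Qed.

Notation V := (interp_val phi).
Notation t0 := (par iota 0).
Notation kpar := (k0par iota (par iota)).
Notation khat := (k0par iota (hatpar iota h)).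

Lemma iota_k0F lam : iota (k0F lam) = kpar lam.
Proof. by rewrite /k0F k0_morph rmorphXn. Qed.

Lemma hat_k0F (H : {rmorphism FT -> L}) lam :
    (forall c, H (cst 4 c) = phi c) ->
    (forall i, (i < 4)%N -> H (tpar i) = hatpar iota h i) ->
  H (k0F lam) = khat lam.
Proof. by move=> Hc Hv; rewrite /k0F k0_morph rmorphXn !Hc !Hv. Qed.

Lemma kpar_neq0 lam : kpar lam != 0.
Proof. by rewrite -iota_k0F fmorph_eq0 k0_neq0. Qed.

Lemma khat_neq0 lam : khat lam != 0.
Proof.
by have [H [_ Hc Hv]] := hat_morph; rewrite -(hat_k0F lam Hc Hv) fmorph_eq0 k0_neq0.
Qed.

Lemma gbinom_interp lam nu :
  gbinom (embF iota) (embF iota tF ^+ (n - 1) * h) lam nu = V h nu lam / V h nu nu.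
Proof.
rewrite /gbinom /=; have -> // : embF iota tF ^ (1 - n%:Z) * (embF iota tF ^+ (n - 1) * h) = h.
have tn0 : embF iota tF != 0 by rewrite fmorph_eq0 cst_neq0 ?tF_neq0.
rewrite mulrA exprnP -expfzDr //.
have -> : 1 - n%:Z + (n - 1)%:Z = 0 by lia.
by rewrite expr0z mul1r.
Qed.

(** The point is that [c] is the same for all [a], in particular for [t_0] and
    [h]. *)
Lemma interp_val_self nu : exists2 c, c != 0 & forall a,
    (forall p, p != 0 -> mpoly.mmap phi (fun _ : 'I_1 => a) p != 0) ->
  V a nu nu = c * a^-1 ^+ psize nu
    * hook_product (phi qF) (phi tF) n (rows nu) (a / a^-1).
Proof.
have gen0 := specialize_generic indep_t0.
have [c c0 cE] := leading_value gen0 (rows_nonincr nu).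
exists c => // a indep; have [f [vf f1 ->]] := interp_val_poly indep nu.
rewrite (cE _ _ _ (specialize_generic indep) vf) f1 mul1r psize_rows //.
Qed.

Lemma interp_val_k0 nu : V t0 nu nu / kpar nu = V h nu nu / khat nu.
Proof.
have [c _ cE] := interp_val_self nu.
rewrite (cE _ indep_t0) (cE _ indep_h).
apply: (k0_hat_ratio _ _ _ _ _ (c := c)
  (a := fun s => c * s^-1 ^+ psize nu * hook_product (phi qF) (phi tF) n (rows nu) (s / s^-1))).
- by rewrite fmorph_eq0 cst_neq0 ?qF_neq0.
- by rewrite fmorph_eq0 cst_neq0 ?tF_neq0.
- exact: hat_param_neq0 hh.
- by rewrite fmorph_eq0 var_neq0.
- by rewrite hh; apply: morph_ratio4.
by [].
Qed.

Lemma lmap_iota_koornwinder lam :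
  lmap iota (koornwinder lam) =
  \sum_(nu <- parts_upto lam | contained nu lam)
    (V h nu lam / V h nu nu * (kpar lam / kpar nu)) *: interp_at phi t0 nu.
Proof.
rewrite (lmap_koornwinder _ (b := t0)) //; last exact: indep_t0.
apply: eq_bigr => nu _; rewrite !iota_k0F.
by rewrite (interp_val_binom indep_h lam nu (psi := iota)) // -hh expr2.
Qed.

Lemma lmap_hat_koornwinder mu :
  lmap (hat iota h) (koornwinder mu) =
  \sum_(nu <- parts_upto mu | contained nu mu)
    (V t0 nu mu / V t0 nu nu * (khat mu / khat nu)) *: interp_at phi h nu.
Proof.
have [H [HE Hc Hv]] := hat_morph; rewrite -(eq_lmap _ HE).
rewrite (lmap_koornwinder _ (b := h)) ?Hv //; last exact: indep_h.
apply: eq_bigr => nu _; rewrite !(hat_k0F _ Hc Hv).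
rewrite (interp_val_binom indep_t0 mu nu (psi := H)) //.
rewrite [LHS](morph_ratio4 H (tpar 0) (tpar 1) (tpar 2) (tpar 3) (cst 4 qF)).
have x00 : t0 != 0 by rewrite fmorph_eq0 var_neq0.
have h0 : h != 0 := hat_param_neq0 hh.
have qL0 : phi qF != 0 by rewrite fmorph_eq0 qF_neq0.
rewrite !Hv // Hc /hatpar.
have := hh; rewrite [X in _ = X](morph_ratio4 iota (tpar 0) (tpar 1) (tpar 2) (tpar 3) (cst 4 qF)).
exact: hat_involution.
Qed.

Lemma koornwinder_sym lam : bcsym (koornwinder lam).
Proof.
apply: bcsym_lin => nu _.
by case: (interp_at_laurent_interp indep_FT nu).
Qed.

Lemma model_binom_self lam : model_binom lam lam = 1.
Proof.
have [vm m1] := modelP lam.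
apply: mulfV; exact: (below_value_neq0 generic_FT vm m1).
Qed.

Lemma koornwinder_triangular lam : triangular lam (koornwinder lam).
Proof.
apply: (@triangular_comb _ _ lam (fun nu => model_binom lam nu * (k0F lam / k0F nu))).
  rewrite model_binom_self mul1r; apply: mulfV; exact: k0_neq0.
by move=> mu; case: (interp_at_laurent_interp indep_FT mu).
Qed.

(** Both sides expand into sums of the same terms, over [nu] contained in [lam] and
    in [mu] respectively, and extra vanishing kills the terms for which [nu] is
    not contained in both. *)
Lemma koornwinder_evaluation lam mu :
  leval (lmap iota (koornwinder lam)) (spec (phi qF) (phi tF) t0 mu) / kpar lam
  = leval (lmap (hat iota h) (koornwinder mu)) (spec (phi qF) (phi tF) h lam)
    / khat mu.
Proof.
pose G nu := V h nu lam / V h nu nu * (V t0 nu mu / V t0 nu nu) * (V t0 nu nu / kpar nu).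
have G0 nu : ~~ (contained nu lam && contained nu mu) -> G nu = 0.
  rewrite negb_and => /orP[] c; rewrite /G.
    by rewrite (interp_val_eq0 indep_h c) !mul0r.
  by rewrite (interp_val_eq0 indep_t0 c) mul0r mulr0 mul0r.
transitivity (\sum_(nu <- parts_upto lam | contained nu lam) G nu).
  rewrite lmap_iota_koornwinder leval_sum mulr_suml; apply: eq_bigr => nu _.
  exact: (swap_summand _ _ _ (kpar_neq0 lam) (interp_val_neq0 indep_t0 nu)).
transitivity (\sum_(nu <- parts_upto mu | contained nu mu) G nu); last first.
  rewrite lmap_hat_koornwinder leval_sum mulr_suml; apply: eq_bigr => nu _.
  rewrite /G interp_val_k0 [V h nu lam / _ * _]mulrC; apply/esym.
  exact: (swap_summand _ _ _ (khat_neq0 mu) (interp_val_neq0 indep_h nu)).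
transitivity (\sum_(nu <- parts_upto lam | contained nu lam && contained nu mu) G nu).
  rewrite big_mkcondr; apply: eq_bigr => nu lam_nu; case: ifP => // /negbT c.
  by rewrite G0 // lam_nu.
rewrite (@big_parts_upto _ _ lam mu).
- under eq_bigl do rewrite andbC.
  rewrite big_mkcondr; apply/esym/eq_bigr => nu mu_nu; case: ifP => // /negbT c.
  by rewrite G0 // mu_nu andbT.
- by move=> nu /andP[/contained_domle].
by move=> nu /andP[_ /contained_domle].
Qed.

(** By the evaluation symmetry the values of [K lam] at the partitions below [lam]
    are those of the polynomials already identified. *)
Lemma koornwinder_unique (K : part n -> laurent n FT) :
  is_koornwinder iota h K -> forall lam, K lam = koornwinder lam.
Proof.
move=> [_ tK eK]; elim/domlt_ind => lam IH.
apply: (triangular_inj (f := iota) (specialize_pchar phi) (specialize_generic indep_t0)).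
- exact: tK.
- exact: koornwinder_triangular.
move=> mu mu_lam; apply: (mulIf (invr_neq0 (kpar_neq0 lam))).
by rewrite [LHS]eK // IH // koornwinder_evaluation.
Qed.

End KoornwinderPolynomials.

Theorem theorem5p1 (n : nat) (hn : (1 <= n)%N)
    (L : fieldType) (iota : {rmorphism FT -> L}) (h : L)
    (hh : h ^+ 2 = iota (tpar 0 * tpar 1 * tpar 2 * tpar 3 / cst 4 qF)) :
  exists K : part n -> laurent n FT,
    [/\ is_koornwinder iota h K,
        forall K' : part n -> laurent n FT,
          is_koornwinder iota h K' -> forall lam, K' lam = K lam
      & forall lam : part n,
          lmap iota (K lam)
          = \sum_(mu <- parts_upto lam | contained mu lam)
              (gbinom (embF iota) (embF iota tF ^+ (n - 1) * h) lam mu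
               * (k0par iota (par iota) lam / k0par iota (par iota) mu))
              *: interp_at (embF iota) (par iota 0) mu].
Proof.
exists (@koornwinder n); split.
- split; [exact: koornwinder_sym|exact: koornwinder_triangular|].
  move=> mu lam _; exact: (koornwinder_evaluation hh lam mu).
- exact: koornwinder_unique.
move=> lam; rewrite (lmap_iota_koornwinder hh).
by apply: eq_bigr => mu _; rewrite (gbinom_interp iota h hn).
Qed.
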